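(* Let $p\ge1$, $\beta_0\in\mathbb R^p$, let $X$ be a random vector in $\mathbb R^p$ with Lebesgue density $f^X$ such that $\mathbb P(\|X\|\le B)=1$ for some $B>0$ and $\mathbb P(v^\top X=0)=0$ for every $v\in\mathbb R^p\setminus\{0\}$. Let $\epsilon$ be independent of $X$ with density $f(t)=c_\alpha\exp(-d^{-\alpha}|t|^\alpha)$, where $\alpha\ge1$, $d>0$, $c_\alpha=\frac{\alpha}{2d\Gamma(1/\alpha)}$, and $Y=\beta_0^\top X+\epsilon$, with density $f^Y(y)=\int f(y-\beta_0^\top x)f^X(x)\,dx$. Let $\tilde X_1,\dots,\tilde X_n$ be i.i.d. copies of $X$, $\tilde Y_1,\dots,\tilde Y_n$ i.i.d. copies of $Y$, and $(X_1,Y_1),\dots,(X_m,Y_m)$ i.i.d. copies of $(X,Y)$, the three samples mutually independent, and let $n,m\to\infty$ with $m/n\to\lambda\in(0,1)$. Define $$\ell_{n,m}(\beta)=\frac{1}{n+m}\sum_{j=1}^n\log\Big(\frac1n\sum_{i=1}^n f(\tilde Y_j-\beta^\top\tilde X_i)\Big)+\frac{1}{n+m}\sum_{k=1}^m\log f(Y_k-\beta^\top X_k),$$ $$\ell(\beta)=\frac{1}{1+\lambda}\int\log\Big(\int f(y-\beta^\top x)f^X(x)\,dx\Big)f^Y(y)\,dy+\frac{\lambda}{1+\lambda}\iint\log f(y-\beta^\top x)\,f(y-\beta_0^\top x)f^X(x)\,dx\,dy,$$ and $R^\ast=\max\Big(2\cdot 3^{1/\alpha}\big(\frac{1+\lambda}{\lambda}\cdot\frac{C}{b}\big)^{1/\alpha},\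 \|\beta_0\|\Big)$ with $b=\inf_{\|u\|=1}\mathbb E|u^\top X|^\alpha$ and $C=\mathbb E|Y|^\alpha$. Then $$\sup_{\|\beta\|\le R^\ast}|\ell_{n,m}(\beta)-\ell(\beta)|\to0\quad\text{in probability},$$ and for every $r>0$, $$\sup_{\beta\in\mathcal O_r}\ell(\beta)<\ell(\beta_0),\qquad \mathcal O_r=\{\beta:\|\beta\|<R^\ast\}\cap\{\beta:\|\beta-\beta_0\|>r\}.$$ In particular, $\widehat\beta_{n,m}\to\beta_0$ in probability as $n,m\to\infty$, where $\widehat\beta_{n,m}$ is any maximizer of $\ell_{n,m}$ over $\mathbb R^p$.
   Context: Linear regression with a matched sample of pairs and an unmatched sample of separately observed covariates and responses; probabilities refer to the joint law of all samples. $\|\cdot\|$ denotes the Euclidean norm. *)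

(* Defs.v *)
From HB Require Import structures.
From mathcomp Require Import all_boot all_order all_algebra.
From mathcomp Require Import all_classical all_reals all_analysis.
Set Implicit Arguments. Unset Strict Implicit. Unset Printing Implicit Defensive.
Import Order.TTheory GRing.Theory Num.Theory.
Import numFieldNormedType.Exports.
Local Open Scope classical_set_scope.
Local Open Scope ring_scope.

Section Defs.
Variable R : realType.
Local Notation mu := (@lebesgue_measure R).

Definition dotp p (u v : 'rV[R]_p) : R := \sum_(i < p) u ord0 i * v ord0 i.
Definition enorm p (v : 'rV[R]_p) : R := Num.sqrt (\sum_(i < p) v ord0 i ^+ 2).

Definition borel_rV p : set (set 'rV[R]_p) :=
  <<s [set S | exists (i : 'I_p) (B : set R), measurable B /\
                 S = [set v : 'rV[R]_p | B (v ord0 i)]] >>.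

Definition borel_pair p : set (set ('rV[R]_p * R)) :=
  <<s [set S | exists (A : set 'rV[R]_p) (B : set R),
          [/\ @borel_rV p A, measurable B & S = A `*` B]] >>.

(* p-dimensional Lebesgue integral, as the iterated one-dimensional
   Lebesgue integral over the coordinates (Tonelli) *)
Fixpoint iter_int (n : nat) (g : (nat -> R) -> \bar R) : \bar R :=
  match n with
  | 0 => g (fun _ => 0)
  | n'.+1 => (\int[mu]_t iter_int n' (fun s => g (fun i => if i == n' then t else s i)))%E
  end.
Definition lebint p (g : 'rV[R]_p -> \bar R) : \bar R :=
  iter_int p (fun s => g (\row_(i < p) s i)).

Definition Gamma (s : R) : R :=
  fine (\int[mu]_(t in `]0%R, +oo[%classic) (t `^ (s - 1) * expR (- t))%:E)%E.

Definition c_alpha (alpha d : R) : R := alpha / (2 * d * Gamma (1 / alpha)).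
Definition fdens (alpha d : R) (t : R) : R :=
  c_alpha alpha d * expR (- (d `^ (- alpha) * `|t| `^ alpha)).

Definition rmeas d (Om : measurableType d) T (S : set (set T)) (Z : Om -> T) :=
  forall A, S A -> measurable (Z @^-1` A).

Definition preim_class d (Om : measurableType d) T (S : set (set T)) (Z : Om -> T)
  : set (set Om) := [set Z @^-1` A | A in S].

Definition mutual_indep d (Om : measurableType d) (P : probability Om R)
    (I : eqType) (E : I -> set (set Om)) :=
  forall (s : seq I) (A : I -> set Om), uniq s ->
    (forall i, i \in s -> E i (A i)) ->
    P (\bigcap_(i in [set i | i \in s]) A i) = (\big[*%E/1%E]_(i <- s) P (A i))%E.

(* convergence to 0 in (outer) probability of a sequence of events *)
Definition prob_to0 d (Om : measurableType d) (P : probability Om R)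
    (E : nat -> set Om) :=
  exists A : nat -> set Om, (forall k, measurable (A k) /\ E k `<=` A k) /\
    (P (A k) @[k --> \oo] --> 0%E).

Definition ell_nm p (alpha d : R) (Xt : nat -> 'rV[R]_p) (Yt : nat -> R)
    (Xm : nat -> 'rV[R]_p) (Ym : nat -> R) (n m : nat) (beta : 'rV[R]_p) : R :=
  (n + m)%:R^-1 * \sum_(j < n)
      ln (n%:R^-1 * \sum_(i < n) fdens alpha d (Yt j - dotp beta (Xt i)))
  + (n + m)%:R^-1 * \sum_(k < m) ln (fdens alpha d (Ym k - dotp beta (Xm k))).

Definition fY p (alpha d : R) (fX : 'rV[R]_p -> R) (beta0 : 'rV[R]_p) (y : R) : R :=
  fine (lebint (fun x => (fdens alpha d (y - dotp beta0 x) * fX x)%:E)).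

Definition ell p (alpha d lambda : R) (fX : 'rV[R]_p -> R) (beta0 beta : 'rV[R]_p)
  : \bar R :=
  ((1 + lambda)^-1)%:E *
    (\int[mu]_y (ln (fine (lebint (fun x => (fdens alpha d (y - dotp beta x) * fX x)%:E)))
                 * fY alpha d fX beta0 y)%:E)%E
  + (lambda / (1 + lambda))%:E *
    (\int[mu]_y lebint (fun x => (ln (fdens alpha d (y - dotp beta x))
                                  * fdens alpha d (y - dotp beta0 x) * fX x)%:E))%E.

End Defs.

(* Main.v *)
Require Import Defs.
From HB Require Import structures.
From mathcomp Require Import all_boot all_order all_algebra.
From mathcomp Require Import all_classical all_reals all_analysis.
From mathcomp Require Import measurable_realfun ring lra.
Set Implicit Arguments. Unset Strict Implicit. Unset Printing Implicit Defensive.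
Import Order.TTheory GRing.Theory Num.Theory.
Import numFieldNormedType.Exports.
Local Open Scope classical_set_scope.
Local Open Scope ring_scope.

(**
With [Q_A y = (|y| + A)^alpha], all logarithms in [ell_{n,m}] on a ball of radius [r] are
bounded by a multiple of [Q_{rB+1}], which has two moments, and they are Lipschitz in [beta]
with a constant proportional to it.  Hence the averages of [Q] make [ell_{n,m}] equi-Lipschitz
outside events of small probability, and pointwise convergence in probability becomes uniform
through a finite net.  Pointwise, the matched average is covered by the weak law; in the
unmatched one the empirical mixture converges to the mixture density uniformly in [|y| <= K],
and the part with [|y| > K] is at most a multiple of [E Q^2 / K].

Identifiability is Gibbs' inequality for both Kullback-Leibler terms.  Equality in the matched
one forces [|eps + (beta0 - beta).X| = |eps|] almost surely; as [(beta0 - beta).X] is almost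
surely nonzero, [eps] would be a function of [X], which its density excludes.

For consistency, [|x + y|^alpha <= 2^alpha (|x|^alpha + |y|^alpha)] bounds the mean matched
residual at [beta] below by [|beta|^alpha b / 2^alpha - C], so that [ell_{n,m}(beta)] is below
[ell_{n,m}(0)] for [|beta| >= R*] with probability tending to one.  Maximizers then exist and
lie in the ball of radius [R*], where uniform convergence and separation apply.
*)

(** Suprema over balls and an arbitrary choice of maximizers need not give measurable events, so
    everything is phrased with measurable covers of small probability ([small]); an outcome outside
    finitely many such events is treated pathwise. No regularity of the limiting integrals is
    studied directly: a pointwise limit of equi-Lipschitz functions is Lipschitz, so [ell] inherits
    continuity from [ell_nm], and the moment function on the unit sphere from its empirical version.
    Compactness then yields the separation gap and the positivity of [b]. The law of the noise
    forces both total mass one and a positive [c_alpha], without evaluating the Gamma integral. In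
    [R*] the factor 2 is the 2^alpha of the power inequality. Far from zero only the matched part is
    used as a penalty, with limiting weight w' = lambda / (1 + lambda). There |beta|^alpha b /
    2^alpha >= 3 C / w', so up to the common factor d^(-alpha) the mean penalty is at least w' (3 C
    / w' - C) >= 2 C, against C at zero; this margin absorbs the sampling errors. *)

(** * Powers, averages and logarithms of reals, and the closing arithmetic of later proofs *)

Section real_inequalities.
Variable R : realType.
Implicit Types (a s t T x y : R).

(** Mean value theorem: the derivative a x^(a-1) on [0, T] is at most a T^(a-1), hence at most a T^a
    because 1 <= T. *)
Lemma powR_lipschitz a T s t : 1 <= a -> 1 <= T -> 0 <= s <= T -> 0 <= t <= T ->
  `|s `^ a - t `^ a| <= a * T `^ a * `|s - t|.
Proof.
move=> a1 T1; wlog st : s t / s <= t => [hw sT tT|/andP[s0 sT] /andP[t0 tT]].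
  have [st|/ltW st] := leP s t; first exact: hw.
  by rewrite distrC (distrC s); exact: hw.
have a0 : 0 <= a by exact: le_trans ler01 a1.
rewrite distrC (distrC s) ger0_norm ?subr_ge0 ?ge0_ler_powR ?nnegrE// ger0_norm ?subr_ge0//.
move: st; rewrite le_eqVlt => /predU1P[->|st]; first by rewrite !subrr mulr0.
have {}s0 : s = 0 \/ 0 < s by move: s0; rewrite le_eqVlt => /predU1P[->|]; [left|right].
have Ta x : 0 <= x <= T -> x `^ (a - 1) <= T `^ a.
  move=> /andP[x0 xT]; apply: (@le_trans _ _ (T `^ (a - 1))).
    by rewrite ge0_ler_powR ?nnegrE ?subr_ge0// (le_trans x0).
  by rewrite ler_powR// lerBlDr lerDl.
(* The derivative of the power is available at positive points only, so the left endpoint 0 is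
   handled by t^a = t^(a-1) t. *)
case: s0 st => [->|s0] st.
  rewrite powR0 ?subr0 ?gt_eqF ?(lt_le_trans ltr01)// -[in leLHS](subrK 1 a) powRD; last by rewrite subrK gt_eqF// (lt_le_trans ltr01).
  by rewrite powRr1// ler_wpM2r// -[leLHS]mul1r ler_pM ?powR_ge0 ?Ta ?t0.
have dp (x : R) : s <= x -> is_derive x 1 (@powR R ^~ a) (a * x `^ (a - 1)).
  by move=> sx; exact/is_derive1_powR/(lt_le_trans s0 sx).
case: (@MVT R (@powR R ^~ a) (fun x => a * x `^ (a - 1)) s t st) => [x /[!in_itv]/= /andP[/ltW sx _]||c /[!in_itv]/= /andP[sc ct] ->].
- exact: dp.
- apply: derivable_within_continuous => x /[!in_itv]/= /andP[sx _]; by case: (dp x sx).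
- rewrite ler_wpM2r ?subr_ge0 ?(ltW st)// ler_wpM2l// Ta//.
  by rewrite (le_trans (ltW ct) tT) (le_trans (ltW s0))// ltW.
Qed.

Lemma norm_powR_lipschitz a T x y : 1 <= a -> 1 <= T -> `|x| <= T -> `|y| <= T ->
  `| `|x| `^ a - `|y| `^ a| <= a * T `^ a * `|x - y|.
Proof.
move=> a1 T1 xT yT; apply: le_trans (powR_lipschitz a1 T1 _ _) _; rewrite ?normr_ge0 ?xT ?yT//.
by rewrite ler_wpM2l ?mulr_ge0 ?powR_ge0 ?(le_trans ler01 a1)// ler_dist_dist.
Qed.

(** The sum is at most twice the larger of the two terms; this 2 is the leading factor of [R*]. *)
Lemma norm_powRD a x y : 0 <= a ->
  `|x + y| `^ a <= 2 `^ a * (`|x| `^ a + `|y| `^ a).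
Proof.
move=> a0; wlog xy : x y / `|x| <= `|y| => [hw|].
  have [xy|/ltW xy] := leP `|x| `|y|; first exact: hw.
  by rewrite addrC [in leRHS]addrC; exact: hw.
apply: (@le_trans _ _ ((2 * `|y|) `^ a)).
  rewrite ge0_ler_powR ?nnegrE ?mulr_ge0//.
  by rewrite (le_trans (ler_normD _ _))// mulrC mulr_natr mulr2n lerD2r.
by rewrite powRM// ler_wpM2l ?powR_ge0// lerDr powR_ge0.
Qed.

(** A multiplicative comparison survives averaging, so the logarithm of the empirical mixture
    inherits the Lipschitz constant of the log-density with no loss from small values of the
    mixture. *)
Lemma ln_mean_le n (u v : 'I_n.+1 -> R) (e : R) : (forall i, 0 < u i) -> (forall i, 0 < v i) ->
  (forall i, u i <= expR e * v i) ->
  ln (n.+1%:R^-1 * \sum_i u i) <= e + ln (n.+1%:R^-1 * \sum_i v i).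
Proof.
move=> u0 v0 uv.
have pos w : (forall i, 0 < w i) -> 0 < n.+1%:R^-1 * \sum_(i < n.+1) w i :> R.
  move=> w0; rewrite mulr_gt0 ?invr_gt0 ?ltr0n// big_ord_recl ltr_pwDl//.
  by apply: sumr_ge0 => i _; exact/ltW.
rewrite -[e in leRHS]expRK -lnM ?posrE ?expR_gt0 ?(pos v)// ler_ln ?posrE ?(pos u)//; last by rewrite mulr_gt0 ?expR_gt0 ?(pos v).
rewrite mulrCA ler_wpM2l ?invr_ge0// mulr_sumr; exact: ler_sum.
Qed.

Lemma expR_lnB_mul x y : 0 < x -> 0 < y -> expR (ln x - ln y) * y = x.
Proof. by move=> x0 y0; rewrite expRD expRN !lnK ?posrE// divfK// gt_eqF. Qed.

Lemma norm_sub_le_of x y t : x <= t + y -> y <= t + x -> `|x - y| <= t.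
Proof. by move=> h1 h2; rewrite ler_norml; apply/andP; split; lra. Qed.

Lemma norm_mean_sub_le n (u v e : 'I_n -> R) : (forall i, `|u i - v i| <= e i) ->
  `|n%:R^-1 * \sum_i u i - n%:R^-1 * \sum_i v i| <= n%:R^-1 * \sum_i e i.
Proof.
move=> uv; rewrite -mulrBr -sumrB normrM ger0_norm ?invr_ge0// ler_wpM2l ?invr_ge0//.
by apply: le_trans (ler_norm_sum _ _ _) _; exact: ler_sum.
Qed.

Lemma mean_le_cst n (u : 'I_n.+1 -> R) c : (forall i, u i <= c) ->
  n.+1%:R^-1 * \sum_i u i <= c.
Proof.
move=> uc; rewrite mulrC ler_pdivrMr ?ltr0n//.
apply: le_trans (ler_sum _ (fun i _ => uc i)) _.
by rewrite sumr_const card_ord mulr_natr.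
Qed.

Lemma mean_ge_cst n (u : 'I_n.+1 -> R) c : (forall i, c <= u i) ->
  c <= n.+1%:R^-1 * \sum_i u i.
Proof.
move=> uc; rewrite mulrC ler_pdivlMr ?ltr0n//.
apply: le_trans _ (ler_sum _ (fun i _ => uc i)).
by rewrite sumr_const card_ord mulr_natr.
Qed.

Lemma ln_le_of_exp x y t : 0 < x -> 0 < y -> x <= expR t * y -> ln x <= t + ln y.
Proof.
move=> x0 y0 xy; rewrite -[t in leRHS]expRK -lnM ?posrE ?expR_gt0//.
by rewrite ler_ln ?posrE// mulr_gt0// expR_gt0.
Qed.

(** As T <= v, u <= v + |u - v| <= (1 + |u - v| / T) v, and 1 + z <= exp z. *)
Lemma norm_ln_sub_le T x y : 0 < T -> T <= x -> T <= y -> `|ln x - ln y| <= `|x - y| / T.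
Proof.
move=> T0; suff h u v : T <= u -> T <= v -> ln u <= `|u - v| / T + ln v.
  by move=> Tx Ty; apply: norm_sub_le_of; [exact: h|rewrite distrC; exact: h].
move=> Tu Tv; have u0 := lt_le_trans T0 Tu; have v0 := lt_le_trans T0 Tv.
apply: ln_le_of_exp => //; apply: (@le_trans _ _ ((1 + `|u - v| / T) * v)).
  have : `|u - v| / T * T <= `|u - v| / T * v by rewrite ler_wpM2l// divr_ge0// ltW.
  by rewrite divfK ?gt_eqF//; have := ler_norm (u - v); lra.
by rewrite ler_wpM2r ?(ltW v0)// expR_ge1Dx.
Qed.

Lemma mean_affine n a t (u : 'I_n -> R) : (0 < n)%N ->
  n%:R^-1 * \sum_i (a + t * u i) = a + t * (n%:R^-1 * \sum_i u i).
Proof.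
move=> n0; have na : n%:R^-1 * (a *+ n) = a.
  by rewrite -[a *+ n]mulr_natl mulrA mulVf ?mul1r// pnatr_eq0 -lt0n.
by rewrite big_split/= sumr_const card_ord -mulr_sumr mulrDr na mulrCA.
Qed.

(* [8 x / t + 1] is the truncation level; the added [1] keeps it positive when [x = 0]. *)
Lemma cutoff_bound t x : 0 < t -> 0 <= x -> 2 * x / (8 * x / t + 1) <= t / 4.
Proof.
move=> t0 x0; have h : 0 <= 8 * x / t by rewrite divr_ge0 ?mulr_ge0// ltW.
rewrite ler_pdivrMr ?ltr_wpDl// (_ : t / 4 * (8 * x / t + 1) = 2 * x + t / 4); first by lra.
by field; rewrite gt_eqF.
Qed.

(* The left-hand side bounds [ell_{n,m}(beta)] above, with [t = |beta|^alpha], [s] the empirical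
   moment of [beta / |beta|] and [res] the mean residual; the right-hand side is [ell_{n,m}(0)]. *)
Lemma coercive_arith (kap lc w w' aY aM s t res C bb eta rho pw : R) :
  0 < kap -> 0 <= w -> 0 <= w' -> w + w' = 1 -> 0 < C -> 0 < bb -> 0 < pw -> 0 <= rho ->
  aY <= C + eta -> aM <= C + eta -> bb - eta <= s -> eta <= bb / 6 -> eta <= C / 12 ->
  pw * (3 * rho * (C / bb)) <= t -> t * s <= pw * (aM + res) -> 11 / 12 <= w' * rho ->
  w * lc + w' * (lc - kap * res) < w * (lc - kap * aY) + w' * (lc - kap * aM).
Proof.
move=> k0 w0 w0' ww C0 bb0 pw0 rho0 hY hM hs e1 e2 ht hts hr.
have w1 : w' <= 1 by lra.
have t0 : 0 <= t.
  apply: le_trans ht; apply: mulr_ge0; first exact: ltW.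
  by apply: mulr_ge0; [exact: mulr_ge0|exact: ltW (divr_gt0 C0 bb0)].
(* 5/2 = 3 * 5/6: at least 5/6 of [bb] survives the error [eta <= bb / 6]. *)
have h1 : pw * (5 / 2 * (rho * C)) <= pw * (aM + res).
  apply: le_trans hts; apply: (@le_trans _ _ (t * (5 / 6 * bb))); last by rewrite ler_wpM2l//; lra.
  apply: (@le_trans _ _ (pw * (3 * rho * (C / bb)) * (5 / 6 * bb))).
    by rewrite le_eqVlt; apply/orP; left; apply/eqP; field; rewrite gt_eqF.
  by rewrite ler_wpM2r//; lra.
move: h1; rewrite ler_pM2l// => h1.
have h2 : w' * (5 / 2 * (rho * C)) <= w' * (aM + res) by rewrite ler_wpM2l.
have h3 : 11 / 12 * (5 / 2 * C) <= w' * rho * (5 / 2 * C) by rewrite ler_wpM2r//; lra.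
have h4 : w' * aM <= w' * (13 / 12 * C) by rewrite ler_wpM2l//; lra.
have h5 : w * aY <= w * (13 / 12 * C) by rewrite ler_wpM2l//; lra.
have h6 : w' * (13 / 12 * C) <= 1 * (13 / 12 * C) by rewrite ler_wpM2r//; lra.
have h7 : w * (13 / 12 * C) = (1 - w') * (13 / 12 * C) by congr (_ * _); lra.
(* By [h2] and [h3], w' (aM + res) >= 55/24 C, while w aY + 2 w' aM <= (1 + w') 13/12 C <= 52/24
   C. *)
have h8 : w * aY + w' * aM < w' * res by lra.
have : kap * (w * aY + w' * aM) < kap * (w' * res) by rewrite ltr_pM2l.
by lra.
Qed.

Lemma midpoint_of x y t : t - x = - (t - y) -> t = (x + y) / 2.
Proof. by move=> h; lra. Qed.

Lemma convex_comb_le w w' x y t : 0 <= w -> 0 <= w' -> w + w' = 1 -> x <= t -> y <= t ->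
  w * x + w' * y <= t.
Proof.
move=> w0 w0' ww xt yt; apply: le_trans (lerD (ler_wpM2l w0 xt) (ler_wpM2l w0' yt)) _.
by rewrite -mulrDl ww mul1r.
Qed.

Lemma norm_weighted_sub_le w w' x x' y y' s s' L D : 0 <= w -> 0 <= w' ->
  `|x - x'| <= L * s * D -> `|y - y'| <= L * s' * D ->
  `|w * x + w' * y - (w * x' + w' * y')| <= L * (w * s + w' * s') * D.
Proof.
move=> w0 w0' h h'.
rewrite (_ : _ - _ = w * (x - x') + w' * (y - y')); last by ring.
rewrite (_ : L * _ * D = w * (L * s * D) + w' * (L * s' * D)); last by ring.
apply: le_trans (ler_normD _ _) _; rewrite !normrM (ger0_norm w0) (ger0_norm w0').
exact: lerD (ler_wpM2l w0 h) (ler_wpM2l w0' h').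
Qed.

(** Error budget of [cvgp_unmatched], with [t] the empirical tail and [v] a bound on its mean: one
    quarter of [e] each for the body, the mean of the tail, the fluctuation of the tail and the weak
    law. *)
Lemma cutoff_arith e M v t x y z : 0 <= M -> 0 < e -> 2 * M * v <= e / 4 ->
  t <= v + e / 4 / (2 * M + 1) -> `|x - y| <= e / 4 + 2 * M * t -> `|y - z| <= e / 4 ->
  `|x - z| <= e.
Proof.
move=> M0 e0 Mv tv xy yz.
have M10 : 0 < 2 * M + 1 by lra.
have h1 : 2 * M * t <= 2 * M * (v + e / 4 / (2 * M + 1)) by rewrite ler_wpM2l// mulr_ge0.
have h2 : 2 * M * (e / 4 / (2 * M + 1)) <= e / 4.
  by rewrite mulrA ler_pdivrMr// [leRHS]mulrDr [leLHS]mulrC mulr1 lerDl; lra.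
have := ler_normD (x - y) (y - z); rewrite addrA subrK.
by move: h1; rewrite mulrDr => h1 h3; lra.
Qed.

Lemma argmax_close_arith g x x' y y' : 0 < g -> x <= x' -> `|x - y| <= g / 3 ->
  `|x' - y'| <= g / 3 -> y - g < y'.
Proof. by rewrite !ler_norml => g0 xx /andP[h1 h2] /andP[h3 h4]; lra. Qed.

Lemma powR_radius a x y z s : 0 < a -> 0 <= x -> 0 <= y -> 0 <= z ->
  x * y `^ (1 / a) * z `^ (1 / a) <= s -> x `^ a * (y * z) <= s `^ a.
Proof.
move=> a0 x0 y0 z0 xs; have aV : 1 / a * a = 1 by rewrite mul1r mulVf// gt_eqF.
have xyz0 : 0 <= x * y `^ (1 / a) * z `^ (1 / a) by rewrite !mulr_ge0// powR_ge0.
have -> : x `^ a * (y * z) = (x * y `^ (1 / a) * z `^ (1 / a)) `^ a.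
  rewrite powRM ?mulr_ge0 ?powR_ge0// powRM ?powR_ge0// -!powRrM aV !powRr1//.
  by rewrite mulrA.
by apply: ge0_ler_powR; rewrite ?nnegrE ?(ltW a0) ?(le_trans xyz0).
Qed.

End real_inequalities.

(** * Euclidean norm on row vectors: Cauchy-Schwarz, compactness of balls, maxima of Lipschitz
    functions *)

Section euclid.
Variables (R : realType) (p : nat).
Implicit Types u v : 'rV[R]_p.

Lemma dotpDl u v x : dotp (u + v) x = dotp u x + dotp v x.
Proof. by rewrite /dotp -big_split; apply: eq_bigr => i _; rewrite mxE mulrDl. Qed.

Lemma dotpZl a u x : dotp (a *: u) x = a * dotp u x.
Proof. by rewrite /dotp mulr_sumr; apply: eq_bigr => i _; rewrite mxE mulrA. Qed.

Lemma dotpBl u v x : dotp (u - v) x = dotp u x - dotp v x.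
Proof. by rewrite -scaleN1r dotpDl dotpZl mulN1r. Qed.

Lemma dot0p u : dotp 0 u = 0.
Proof. by rewrite /dotp big1// => i _; rewrite mxE mul0r. Qed.

Lemma enorm_ge0 v : 0 <= enorm v. Proof. exact: sqrtr_ge0. Qed.

Lemma sqr_enorm v : enorm v ^+ 2 = \sum_(i < p) v ord0 i ^+ 2.
Proof. by rewrite sqr_sqrtr// sumr_ge0// => i _; exact: sqr_ge0. Qed.

Lemma enorm0_eq0 v : enorm v = 0 -> v = 0.
Proof.
move=> v0; have : \sum_(i < p) v ord0 i ^+ 2 = 0 by rewrite -sqr_enorm v0 expr0n.
move=> /eqP; rewrite psumr_eq0 => [/allP h|i _]; last exact: sqr_ge0.
apply/rowP => i; rewrite mxE; have := h i (mem_index_enum _).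
by rewrite sqrf_eq0 => /eqP.
Qed.

Lemma enormZ a v : enorm (a *: v) = `|a| * enorm v.
Proof.
rewrite /enorm -sqrtr_sqr -sqrtrM ?sqr_ge0// mulr_sumr; congr Num.sqrt.
by apply: eq_bigr => i _; rewrite mxE exprMn.
Qed.

Lemma enorm0 : enorm (0 : 'rV[R]_p) = 0.
Proof. by rewrite -(scale0r 0) enormZ normr0 mul0r. Qed.

Lemma enormN v : enorm (- v) = enorm v.
Proof. by rewrite -scaleN1r enormZ normrN1 mul1r. Qed.

Lemma dotp_le_enorm u v : `|dotp u v| <= enorm u * enorm v.
Proof.
suff h w : dotp w v <= enorm w * enorm v.
  rewrite ler_norml h andbT lerNl -(enormN u) (_ : - dotp u v = dotp (- u) v) ?h//.
  by rewrite -mulN1r -dotpZl scaleN1r.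
have [w0|w0] := eqVneq (enorm w) 0; first by rewrite (enorm0_eq0 w0) dot0p mulr_ge0 ?enorm_ge0.
have [v0|v0] := eqVneq (enorm v) 0.
  rewrite (enorm0_eq0 v0) /dotp big1 ?mulr_ge0 ?enorm_ge0// => i _.
  by rewrite mxE mulr0.
have a0 : 0 < enorm w by rewrite lt_def w0 enorm_ge0.
have b0 : 0 < enorm v by rewrite lt_def v0 enorm_ge0.
(* Expanded, this sum of squares is 2 |v| |w| (|w| |v| - w.v). *)
have : 0 <= \sum_(i < p) (enorm v * w ord0 i - enorm w * v ord0 i) ^+ 2.
  by rewrite sumr_ge0// => i _; exact: sqr_ge0.
rewrite (_ : \sum_(i < p) _ = 2 * (enorm v * enorm w) * (enorm w * enorm v - dotp w v)).
  by rewrite pmulr_rge0 ?subr_ge0// !mulr_gt0.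
have -> : 2 * (enorm v * enorm w) * (enorm w * enorm v - dotp w v) =
    enorm v ^+ 2 * enorm w ^+ 2 + enorm w ^+ 2 * enorm v ^+ 2
    - 2 * (enorm v * enorm w) * dotp w v by ring.
rewrite [in X in X + _ - _](sqr_enorm w) [in X in _ + X - _](sqr_enorm v).
rewrite /dotp !mulr_sumr -big_split -sumrB/=.
by apply: eq_bigr => i _; ring.
Qed.

Lemma enorm_ge_coord v i : `|v ord0 i| <= enorm v.
Proof.
rewrite -(@ler_pXn2r _ 2)// ?nnegrE ?enorm_ge0// sqr_enorm real_normK ?num_real//.
rewrite (bigD1 i)//= lerDl sumr_ge0// => j _; exact: sqr_ge0.
Qed.

Lemma continuous_enorm : continuous (@enorm R p).
Proof.
have cs (r : seq 'I_p) : continuous (fun v : 'rV[R]_p => \sum_(i <- r) v ord0 i ^+ 2).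
  elim: r => [|i r IH] v.
    rewrite (_ : (fun _ => _) = cst 0); first exact: cst_continuous.
    by apply/funext => w; rewrite big_nil.
  rewrite (_ : (fun _ => _) = (fun v : 'rV[R]_p => v ord0 i * v ord0 i + \sum_(j <- r) v ord0 j ^+ 2)); last first.
    by apply/funext => w; rewrite big_cons expr2.
  have cf : (fun w : 'rV[R]_p => w ord0 i) @ v --> v ord0 i by exact: coord_continuous.
  exact: (cvgD (cvgM cf cf) (IH v)).
move=> v; apply: (@continuous_comp _ _ _ (fun v : 'rV[R]_p => \sum_(i < p) v ord0 i ^+ 2) Num.sqrt).
  exact: cs.
exact: sqrt_continuous.
Qed.

Lemma continuous_enormB u : continuous (fun v => enorm (v - u)).
Proof.
move=> v; apply: (@continuous_comp _ _ _ (fun v : 'rV[R]_p => v - u) (@enorm R p)).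
  exact: (@cvgB _ _ _ _ _ _ _ _ _ (@cvg_id _ _) (cvg_cst _)).
exact: continuous_enorm.
Qed.

Lemma closed_enorm_le r : closed [set v : 'rV[R]_p | enorm v <= r].
Proof.
change (closed ((@enorm R p) @^-1` [set x : R | x <= r])).
by apply: preimage_closed => [x _|]; [exact: continuous_enorm|exact: closed_le].
Qed.

Lemma closed_enorm_ge u r : closed [set v : 'rV[R]_p | r <= enorm (v - u)].
Proof.
change (closed ((fun v : 'rV[R]_p => enorm (v - u)) @^-1` [set x : R | r <= x])).
by apply: preimage_closed => [x _|]; [exact: continuous_enormB|exact: closed_ge].
Qed.

(** The topology on row vectors is the coordinatewise one, hence the detour through the cube
    [-r, r]^p, a product of segments. *)
Lemma compact_enorm_ball r (S : set 'rV[R]_p) : closed S -> S `<=` [set v | enorm v <= r] ->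
  compact S.
Proof.
move=> cS Sr; apply: (subclosed_compact cS _ Sr).
apply: (@subclosed_compact _ _ [set v : 'rV[R]_p | forall i, `[- r, r]%classic (v ord0 i)]).
- change (closed ((@enorm R p) @^-1` [set x : R | x <= r])).
  by apply: preimage_closed => [x _|]; [exact: continuous_enorm|exact: closed_le].
- by apply: (@rV_compact _ _ (fun=> `[- r, r]%classic)) => _; exact: segment_compact.
- by move=> v/= vr i; rewrite in_itv/= -ler_norml (le_trans (enorm_ge_coord _ _)).
Qed.

Lemma lipschitz_argmax (S : set 'rV[R]_p) (F : 'rV[R]_p -> R) L : compact S -> S !=set0 ->
  (forall u v, S u -> S v -> `|F u - F v| <= L * enorm (u - v)) ->
  exists2 u, S u & forall v, S v -> F v <= F u.
Proof.
move=> cS S0 FL.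
have cF : {within S, continuous F}.
  apply/subspace_continuousP => u uS.
  apply/cvgrPdist_le => e e0.
  (* [L] comes without a sign; |L| + 1 is a positive modulus that dominates it. *)
  have L0 : 0 < `|L| + 1 by rewrite ltr_wpDl.
  near=> v.
  have vS : S v by near: v; exact: withinT.
  have : enorm (v - u) < e / (`|L| + 1).
    near: v; apply: cvg_within.
    have := @continuous_enormB u u; rewrite /continuous_at subrr enorm0.
    move/cvgrPdist_lt => /(_ _ (divr_gt0 e0 L0)); apply: filterS => v.
    by rewrite sub0r normrN ger0_norm ?enorm_ge0.
  rewrite ltr_pdivlMr// => /ltW vu; apply: le_trans vu.
  apply: le_trans (FL _ _ uS vS) _; rewrite -opprB enormN mulrC ler_wpM2l ?enorm_ge0//.
  by rewrite (le_trans (ler_norm _))// lerDl.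
have [u uS Fu] := compact_EVT_max S0 cS cF.
by exists u; [rewrite -inE|move=> v vS; apply: Fu; rewrite inE].
Unshelve. all: by end_near. Qed.

End euclid.

(** * Finite nets *)

(** [dist] is any two-place function so that one notion serves both vectors and responses; [List.In]
    replaces boolean membership because [T] carries no decidable equality. *)
Definition totally_bounded (R : realType) (T : Type) (dist : T -> T -> R) (S : set T) :=
  forall e : R, 0 < e -> exists s : seq T, (forall y, List.In y s -> S y) /\
    forall x, S x -> exists2 y, List.In y s & dist x y <= e.

Lemma compact_totally_bounded (R : realType) (T : ptopologicalType) (dist : T -> T -> R) (S : set T) :
  compact S -> (forall x, dist x x = 0) -> (forall y, continuous (dist^~ y)) ->
  totally_bounded dist S.
Proof.
move=> + d0 dc e e0; rewrite compact_cover => /(_ T S (fun y => [set x | dist x y < e])).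
case=> [y _||D DS SD].
- rewrite (_ : [set x | _] = (dist^~ y) @^-1` [set r | r < e])//.
  by apply: open_comp => [x _|]; [exact: dc|exact: open_lt].
- by move=> x Sx; exists x => //=; rewrite d0.
- have inE' (s : seq T) y : (y \in s) <-> List.In y s.
    elim: s => //= z s IH; rewrite inE; split => [/predU1P[->|/IH]|[->|/IH ys]]; [by left|by right| |].
      by rewrite eqxx.
    by rewrite ys orbT.
  exists (finmap.enum_fset D); split => [y /inE' yD|x /SD[y yD /ltW xy]].
    by have /set_mem := DS y yD.
  by exists y => //; exact/inE'.
Qed.

Lemma totally_bounded_enorm (R : realType) p (S : set 'rV[R]_p) : compact S ->
  totally_bounded (fun u v => enorm (u - v)) S.
Proof.
move=> cS; apply: (compact_totally_bounded cS); first by move=> x; rewrite subrr enorm0.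
exact: continuous_enormB.
Qed.

(** * Events of vanishing outer probability and convergence in probability *)

Section small.
Context d (Om : measurableType d) (R : realType) (P : probability Om R).
Implicit Types E : nat -> set Om.

(** A separate measurable cover for each tolerance makes finite unions and subsequences elementary;
    [small_prob_to0] recovers a single sequence of covers. *)
Definition small E := forall e : R, 0 < e -> exists k0, forall k, (k0 <= k)%N ->
  exists A, [/\ measurable A, E k `<=` A & (P A <= e%:E)%E].

Lemma small_sub E E' : (exists k0, forall k, (k0 <= k)%N -> E k `<=` E' k) -> small E' -> small E.
Proof.
move=> [k0 EF] sF e /sF[k1 h]; exists (maxn k0 k1) => k; rewrite geq_max => /andP[k0k k1k].
have [A [mA FA PA]] := h _ k1k; exists A; split => //.
exact: subset_trans (EF _ k0k) FA.
Qed.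

Lemma small_subset E E' : (forall k, E k `<=` E' k) -> small E' -> small E.
Proof. by move=> EF; apply: small_sub; exists 0. Qed.

Lemma smallU E E' : small E -> small E' -> small (fun k => E k `|` E' k).
Proof.
move=> sE sF e e0; have e20 : 0 < e / 2 by lra.
have [k0 h0] := sE _ e20; have [k1 h1] := sF _ e20.
exists (maxn k0 k1) => k; rewrite geq_max => /andP[/h0[A [mA EA PA]] /h1[B [mB FB PB]]].
exists (A `|` B); split; [exact: measurableU|exact: setUSS|].
rewrite (le_trans (measureU2 _ mA mB))// [e]splitr EFinD; exact: leeD.
Qed.

Lemma small_set0 : small (fun=> set0).
Proof. by move=> e e0; exists 0 => k _; exists set0; split => //; rewrite measure0 lee_fin ltW. Qed.

Lemma small_bigcup (I : Type) (s : seq I) (E : I -> nat -> set Om) :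
  (forall i, List.In i s -> small (E i)) ->
  small (fun k => [set w | exists2 i, List.In i s & E i k w]).
Proof.
elim: s => [|i s IH] h.
  by apply: small_subset small_set0 => k w [].
apply: small_subset (smallU (h i (or_introl erefl)) (IH (fun j js => h j (or_intror js)))).
by move=> k w [j [<-|js] Ew]; [left|right; exists j].
Qed.

Lemma small_null (N : set Om) : measurable N -> P N = 0%E -> small (fun=> N).
Proof. by move=> mN PN e e0; exists 0 => k _; exists N; split => //; rewrite PN lee_fin ltW. Qed.

(** Deterministic facts about limits are read off at one outcome that avoids the bad events. *)
Lemma small_notT E : small E -> exists k0, forall k, (k0 <= k)%N -> exists w, ~ E k w.
Proof.
move=> /(_ 2^-1 ltac:(lra))[k0 h]; exists k0 => k /h[A [mA EA PA]].
apply: contrapT => nE; have AT : A = setT.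
  by apply/seteqP; split => // w _; apply: EA; apply: contrapT => ?; apply: nE; exists w.
by move: PA; rewrite AT probability_setT lee_fin; lra.
Qed.

Lemma small_subseq E (N : nat -> nat) : (forall c : nat, exists k0, forall k, (k0 <= k)%N -> (c <= N k)%N) ->
  small E -> small (fun k => E (N k)).
Proof.
move=> NN sE e e0; have [k0 h] := sE e e0; have [k1 h1] := NN k0.
by exists k1 => k /h1/h.
Qed.

Lemma small_prob_to0 E : small E -> prob_to0 P E.
Proof.
move=> sE.
(* The outer probability of [E k]; choosing a cover within 1/(k+1) of it gives one sequence that
   serves every tolerance. *)
pose q k := ereal_inf [set P A | A in [set A | measurable A /\ E k `<=` A]].
have qge0 k : (0 <= q k)%E by apply: le_ereal_inf_tmp => _ [A _ <-]; exact: measure_ge0.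
have q1 k : (q k <= 1)%E.
  by rewrite -(probability_setT P); apply: ereal_inf_lbound; exists setT => //; split.
have qfin k : q k \is a fin_num by rewrite ge0_fin_numE// (le_lt_trans (q1 k))// ltry.
have /choice[A hA] : forall k, exists A, [/\ measurable A, E k `<=` A & (P A < q k + (k.+1%:R^-1)%:E)%E].
  move=> k; have k0 : (0 : R) < k.+1%:R^-1 by rewrite invr_gt0.
  by have [_ [A [mA EA] <-] PA] := lb_ereal_inf_adherent k0 (qfin k); exists A.
exists A; split => [k|]; first by have [? ? _] := hA k; split.
apply/fine_cvgP; split; first by near=> k; exact: fin_num_measure (let: And3 m _ _ := hA k in m).
apply/cvgrPdist_le => e e0; have e20 : 0 < e / 2 by lra.
have [k0 h] := sE _ e20.
near=> k; have [mA EA PA] := hA k.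
rewrite sub0r normrN ger0_norm ?fine_ge0 ?measure_ge0//.
rewrite -lee_fin fineK; last exact: fin_num_measure.
apply: le_trans (ltW PA) _; rewrite [e]splitr EFinD leeD//.
  have [|B [mB EB PB]] := h k; first by near: k; exact: nbhs_infty_ge.
  by apply: le_trans PB; apply: ereal_inf_lbound; exists B.
rewrite lee_fin ltW//; near: k; exact: near_infty_natSinv_lt (PosNum e20).
Unshelve. all: by end_near. Qed.

Implicit Types F G : nat -> Om -> R.

Definition cvgp (F : nat -> Om -> R) (a : R) :=
  forall e, 0 < e -> small (fun k => [set w | e < `|F k w - a|]).

Lemma cvgp_eventually F G a : (exists k0, forall k, (k0 <= k)%N -> forall w, F k w = G k w) ->
  cvgp F a -> cvgp G a.
Proof.
move=> [k0 FG] cF e e0; apply: small_sub (cF e e0).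
by exists k0 => k k0k w /=; rewrite FG.
Qed.

Lemma cvgp_subseq F a (N : nat -> nat) : (forall c : nat, exists k0, forall k, (k0 <= k)%N -> (c <= N k)%N) ->
  cvgp F a -> cvgp (fun k => F (N k)) a.
Proof. by move=> NN cF e e0; exact: (small_subseq NN (cF e e0)). Qed.

Lemma cvgpD F G a b : cvgp F a -> cvgp G b -> cvgp (fun k w => F k w + G k w) (a + b).
Proof.
move=> cF cG e e0; have e20 : 0 < e / 2 by lra.
apply: small_subset (smallU (cF _ e20) (cG _ e20)) => k w /= h.
have [|h1] := ltP (e / 2) `|F k w - a|; first by left.
right; move: h; rewrite opprD addrACA => h.
by have := ler_normD (F k w - a) (G k w - b); lra.
Qed.

Lemma cvgpZ (r : nat -> R) (r0 : R) F a : r k @[k --> \oo] --> r0 -> cvgp F a ->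
  cvgp (fun k w => r k * F k w) (r0 * a).
Proof.
move=> cr cF e e0.
have D0 : 0 < `|r0| + 1 by rewrite ltr_wpDl.
have A0 : 0 < `|a| + 1 by rewrite ltr_wpDl.
have e1 : 0 < e / 2 / (`|r0| + 1) by rewrite !divr_gt0.
(* The 1 in the minimum keeps |r k| <= |r0| + 1; the ones added to |r0| and |a| keep the divisors
   positive. *)
have e2 : 0 < Num.min 1 (e / 2 / (`|a| + 1)) by rewrite lt_min ltr01 !divr_gt0.
move/cvgrPdist_lt : cr => /(_ _ e2)[k0 _ hk0].
apply: small_sub (cF _ e1); exists k0 => k /hk0/= + w/=.
rewrite lt_min => /andP[r1 r2] h; rewrite ltNge; apply/negP => h'.
move: h; apply/negP; rewrite -leNgt.
rewrite (_ : r k * F k w - r0 * a = r k * (F k w - a) + (r k - r0) * a); last by ring.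
apply: le_trans (ler_normD _ _) _; rewrite !normrM.
have rk : `|r k| <= `|r0| + 1 by have := ler_normB r0 (r0 - r k); rewrite opprB addrC subrK; lra.
have h1 : `|r k| * `|F k w - a| <= (`|r0| + 1) * (e / 2 / (`|r0| + 1)) by rewrite ler_pM.
have h2 : `|r k - r0| * `|a| <= (e / 2 / (`|a| + 1)) * (`|a| + 1).
  by rewrite ler_pM// ?lerDl// distrC ltW.
have := divfK (lt0r_neq0 A0) (e / 2); have := divfK (lt0r_neq0 D0) (e / 2); rewrite mulrC.
by move=> e3 e4; move: h1 h2; rewrite e3 e4; lra.
Qed.

(* A uniform modulus H of equicontinuity, valid up to small events, upgrades pointwise
   convergence to uniform convergence through a finite net. *)
Section uniform.
Variables (T : Type) (dist : T -> T -> R) (S : set T) (F : nat -> Om -> T -> R) (G : T -> R) (H : R).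
Hypothesis H0 : 0 <= H.
Hypothesis FG : forall x, S x -> cvgp (fun k w => F k w x) (G x).
Hypothesis FH : small (fun k => ~` [set w | forall x y, S x -> S y -> `|F k w x - F k w y| <= H * dist x y]).

(** At a late index some outcome satisfies the modulus and both pointwise approximations; the error
    is then sent to zero. *)
Lemma limit_lipschitz x y : S x -> S y -> `|G x - G y| <= H * dist x y.
Proof.
move=> Sx Sy; apply/ler_addgt0Pr => e e0; have e20 : 0 < e / 2 by lra.
have [k0 /(_ _ (leqnn _))[w nE]] := small_notT (smallU FH (smallU (FG Sx e20) (FG Sy e20))).
have h1 : `|F k0 w x - F k0 w y| <= H * dist x y.
  by apply: contrapT => h; apply: nE; left => /(_ x y Sx Sy).
have h2 : `|F k0 w x - G x| <= e / 2.
  by rewrite leNgt; apply/negP => h; apply: nE; right; left.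
have h3 : `|F k0 w y - G y| <= e / 2.
  by rewrite leNgt; apply/negP => h; apply: nE; right; right.
by move: h1 h2 h3; rewrite !ler_norml; lra.
Qed.

Lemma uniform_cvgp e : totally_bounded dist S -> 0 < e ->
  small (fun k => [set w | exists2 x, S x & e < `|F k w x - G x|]).
Proof.
move=> tb e0.
(* With this mesh, moving to the nearest net point costs at most e / 3 for [F] and again for [G]. *)
have h0 : 0 < e / 3 / (H + 1) by rewrite !divr_gt0// ltr_wpDl.
have [s [sS snet]] := tb _ h0.
have e30 : 0 < e / 3 by lra.
have sm : forall y, List.In y s -> small (fun k => [set w | e / 3 < `|F k w y - G y|]).
  by move=> y /sS Sy; exact: FG.
apply: small_subset (smallU FH (small_bigcup sm)) => k w [x Sx xe].
have [h1|] := pselect (forall x y, S x -> S y -> `|F k w x - F k w y| <= H * dist x y); last by left.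
right; have [y ys xy] := snet x Sx; exists y => //=.
have Sy := sS _ ys; have := h1 x y Sx Sy; have := limit_lipschitz Sx Sy.
have : H * dist x y <= e / 3.
  apply: (@le_trans _ _ (H * (e / 3 / (H + 1)))); first by rewrite ler_wpM2l.
  by rewrite mulrA ler_pdivrMr ?ltr_wpDl//; lra.
move=> h2 h3 h4.
have := ler_normD (F k w x - F k w y) (F k w y - G y).
have := ler_normD (F k w x - F k w y + (F k w y - G y)) (G y - G x).
rewrite (_ : F k w x - F k w y + (F k w y - G y) + (G y - G x) = F k w x - G x); last by ring.
by rewrite [`|G y - G x|]distrC; lra.
Qed.

End uniform.
End small.

(** * Integrals under equal laws, independence, and the weak law of large numbers *)

Section laws.
Context (R : realType).

Lemma ge0_integral_same_law d1 d2 d (Om1 : measurableType d1) (Om2 : measurableType d2)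
    (T : measurableType d) (P1 : probability Om1 R) (P2 : probability Om2 R)
    (W1 : Om1 -> T) (W2 : Om2 -> T) (g : T -> \bar R) :
  measurable_fun setT W1 -> measurable_fun setT W2 ->
  (forall A, measurable A -> P1 (W1 @^-1` A) = P2 (W2 @^-1` A)) ->
  measurable_fun setT g -> (forall x, (0 <= g x)%E) ->
  (\int[P1]_w g (W1 w) = \int[P2]_w g (W2 w))%E.
Proof.
move=> mW1 mW2 W12 mg g0.
pose V1 : {mfun Om1 >-> T} := HB.pack W1 (isMeasurableFun.Build _ _ _ _ _ mW1).
pose V2 : {mfun Om2 >-> T} := HB.pack W2 (isMeasurableFun.Build _ _ _ _ _ mW2).
transitivity (\int[distribution P1 V1]_x g x)%E.
  by rewrite ge0_integral_pushforward//; exact: measurable_funTS.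
rewrite (@eq_measure_integral _ _ _ _ (distribution P2 V2)); last by move=> A mA _; exact: W12.
by rewrite ge0_integral_pushforward//; exact: measurable_funTS.
Qed.

Lemma integral_same_law d1 d2 d (Om1 : measurableType d1) (Om2 : measurableType d2)
    (T : measurableType d) (P1 : probability Om1 R) (P2 : probability Om2 R)
    (W1 : Om1 -> T) (W2 : Om2 -> T) (g : T -> \bar R) :
  measurable_fun setT W1 -> measurable_fun setT W2 ->
  (forall A, measurable A -> P1 (W1 @^-1` A) = P2 (W2 @^-1` A)) ->
  measurable_fun setT g ->
  (\int[P1]_w g (W1 w) = \int[P2]_w g (W2 w))%E.
Proof.
move=> mW1 mW2 W12 mg; rewrite -[LHS]/(\int[P1]_w (g \o W1) w)%E -[RHS]/(\int[P2]_w (g \o W2) w)%E.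
have posE d' (S : measurableType d') (V : S -> T) : ((g \o V)^\+ = g^\+ \o V)%E by rewrite funepos_comp.
have negE d' (S : measurableType d') (V : S -> T) : ((g \o V)^\- = g^\- \o V)%E by rewrite funeneg_comp.
rewrite integralE [RHS]integralE (posE _ _ W1) (posE _ _ W2) (negE _ _ W1) (negE _ _ W2).
congr (_ - _)%E.
  exact: (ge0_integral_same_law mW1 mW2 W12 (measurable_funepos mg) (funepos_ge0 g)).
exact: (ge0_integral_same_law mW1 mW2 W12 (measurable_funeneg mg) (funeneg_ge0 g)).
Qed.

Lemma integrable_same_law d1 d2 d (Om1 : measurableType d1) (Om2 : measurableType d2)
    (T : measurableType d) (P1 : probability Om1 R) (P2 : probability Om2 R)
    (W1 : Om1 -> T) (W2 : Om2 -> T) (g : T -> \bar R) :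
  measurable_fun setT W1 -> measurable_fun setT W2 ->
  (forall A, measurable A -> P1 (W1 @^-1` A) = P2 (W2 @^-1` A)) ->
  measurable_fun setT g ->
  P2.-integrable setT (g \o W2) -> P1.-integrable setT (g \o W1).
Proof.
move=> mW1 mW2 W12 mg /integrableP[_ gfin]; apply/integrableP; split; first exact: measurableT_comp.
rewrite (ge0_integral_same_law (g := abse \o g) mW1 mW2 W12)//; first exact: measurableT_comp.
by move=> x; exact: abse_ge0.
Qed.

(** Independence says that the joint law agrees with the product of the marginal laws on rectangles,
    hence everywhere; Tonelli does the rest. *)
Lemma integral_indep_pair d d1 d2 (Om : measurableType d) (T1 : measurableType d1)
    (T2 : measurableType d2) (P : probability Om R) (W1 : Om -> T1) (W2 : Om -> T2)
    (mW1 : measurable_fun setT W1) (mW2 : measurable_fun setT W2) (g : T1 * T2 -> \bar R) :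
  (forall A B, measurable A -> measurable B ->
     P (W1 @^-1` A `&` W2 @^-1` B) = P (W1 @^-1` A) * P (W2 @^-1` B))%E ->
  measurable_fun setT g -> (forall z, (0 <= g z)%E) ->
  (\int[P]_w g (W1 w, W2 w) = \int[P]_w \int[P]_w' g (W1 w, W2 w'))%E.
Proof.
move=> ind mg g0.
pose V1 : {mfun Om >-> T1} := HB.pack W1 (isMeasurableFun.Build _ _ _ _ _ mW1).
pose V2 : {mfun Om >-> T2} := HB.pack W2 (isMeasurableFun.Build _ _ _ _ _ mW2).
have mW : measurable_fun setT (fun w => (W1 w, W2 w)) by exact: measurable_fun_pair.
pose V : {mfun Om >-> (T1 * T2)%type} := HB.pack (fun w => (W1 w, W2 w)) (isMeasurableFun.Build _ _ _ _ _ mW).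
transitivity (\int[distribution P V]_x g x)%E.
  by rewrite ge0_integral_pushforward//; exact: measurable_funTS.
rewrite (@eq_measure_integral _ _ _ _ (distribution P V1 \x distribution P V2)%E); last first.
  by move=> A mA _; apply/esym/product_measure_unique => // A1 A2 mA1 mA2; exact: (ind A1 A2 mA1 mA2).
rewrite fubini_tonelli1// ge0_integral_pushforward//=; last 2 first.
- by apply: measurable_funTS; exact: measurable_fun_fubini_tonelli_F.
- by move=> x _; apply: integral_ge0.
apply: eq_integral => w _ /=; rewrite /fubini_F ge0_integral_pushforward//.
by apply: measurable_funTS; exact: measurableT_comp.
Qed.

Lemma integral_indep_mul d d1 (Om : measurableType d) (T : measurableType d1)
    (P : probability Om R) (W1 W2 : Om -> T) (u v : T -> R)
    (mW1 : measurable_fun setT W1) (mW2 : measurable_fun setT W2) :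
  (forall A B, measurable A -> measurable B ->
     P (W1 @^-1` A `&` W2 @^-1` B) = P (W1 @^-1` A) * P (W2 @^-1` B))%E ->
  measurable_fun setT u -> measurable_fun setT v ->
  P.-integrable setT (EFin \o u \o W1) -> P.-integrable setT (EFin \o v \o W2) ->
  (\int[P]_w (u (W1 w) * v (W2 w))%:E =
   (\int[P]_w (u (W1 w))%:E) * (\int[P]_w (v (W2 w))%:E))%E.
Proof.
move=> ind mu mv iu iv.
pose V1 : {mfun Om >-> T} := HB.pack W1 (isMeasurableFun.Build _ _ _ _ _ mW1).
pose V2 : {mfun Om >-> T} := HB.pack W2 (isMeasurableFun.Build _ _ _ _ _ mW2).
have mW : measurable_fun setT (fun w => (W1 w, W2 w)) by exact: measurable_fun_pair.
pose V : {mfun Om >-> (T * T)%type} := HB.pack (fun w => (W1 w, W2 w)) (isMeasurableFun.Build _ _ _ _ _ mW).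
pose nu1 : probability T R := distribution P V1; pose nu2 : probability T R := distribution P V2.
pose g (z : T * T) := (u z.1 * v z.2)%:E.
have mg : measurable_fun setT g.
  by apply/measurable_EFinP/measurable_funM; exact: measurableT_comp.
have fu : (\int[P]_w `|(u (W1 w))%:E| < +oo)%E by case/integrableP : iu.
have fv : (\int[P]_w `|(v (W2 w))%:E| < +oo)%E by case/integrableP : iv.
have nu1E (h : T -> \bar R) : measurable_fun setT h -> (\int[nu1]_x h x = \int[P]_w h (W1 w))%E.
  move=> mh; apply: (@integral_same_law _ _ _ T Om T nu1 P idfun W1 h) => //; exact: measurable_id.
have nu2E (h : T -> \bar R) : measurable_fun setT h -> (\int[nu2]_x h x = \int[P]_w h (W2 w))%E.
  move=> mh; apply: (@integral_same_law _ _ _ T Om T nu2 P idfun W2 h) => //; exact: measurable_id.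
have mEu : measurable_fun setT (EFin \o u) by exact/measurable_EFinP.
have mEv : measurable_fun setT (EFin \o v) by exact/measurable_EFinP.
have iu1 : nu1.-integrable setT (EFin \o u).
  by apply/integrableP; split => //; rewrite nu1E//; exact: measurableT_comp.
have iv2 : nu2.-integrable setT (EFin \o v).
  by apply/integrableP; split => //; rewrite nu2E//; exact: measurableT_comp.
(* The factors are signed, so Fubini requires integrability on the product first; the iterated
   integral of |u| |v| factors into two finite ones. *)
have ig : (nu1 \x nu2)%E.-integrable setT g.
  apply/integrable12ltyP => //.
  rewrite (eq_integral (fun x => `|(u x)%:E| * \int[nu2]_y `|(v y)%:E|)%E); last first.
    move=> x _; have mav : measurable_fun setT (fun y => `|(v y)%:E|)%E by exact: measurableT_comp.
    have -> : (`|(u x)%:E| * \int[nu2]_y `|(v y)%:E| = \int[nu2]_y (`|(u x)%:E| * `|(v y)%:E|))%E.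
      by apply/esym/ge0_integralZl.
    by apply: eq_integral => y _; rewrite /g/= normrM EFinM.
  rewrite nu2E//; last exact: measurableT_comp.
  have ffv : (\int[P]_w `|(v (W2 w))%:E|)%E \is a fin_num.
    by rewrite ge0_fin_numE// integral_ge0.
  rewrite -(fineK ffv) ge0_integralZr//; last 2 first.
  - exact: measurableT_comp.
  - by rewrite lee_fin fine_ge0// integral_ge0.
  rewrite nu1E//; last exact: measurableT_comp.
  by rewrite lte_mul_pinfty// ?integral_ge0// ?ltry// ge0_fin_numE// integral_ge0.
transitivity (\int[distribution P V]_z g z)%E.
  by apply/esym/(@integral_same_law _ _ _ (T * T)%type Om (T * T)%type (distribution P V) P idfun (fun w => (W1 w, W2 w)) g) => //; exact: measurable_id.
rewrite (@eq_measure_integral _ _ _ _ (nu1 \x nu2)%E); last first.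
  by move=> A mA _; apply/esym/product_measure_unique => // A1 A2 mA1 mA2; exact: (ind A1 A2 mA1 mA2).
rewrite -integral12_prod_meas1// /fubini_F /g/=.
under eq_integral => x _ do (under eq_integral => y _ do rewrite EFinM; rewrite integralZl//).
have fi : (\int[P]_w (v (W2 w))%:E)%E \is a fin_num by exact: integrable_fin_num iv.
rewrite (nu2E (EFin \o v))//= -(fineK fi) integralZr//.
by rewrite (nu1E (EFin \o u)).
Qed.

Lemma measurable_ltr_norm d (Om : measurableType d) (g : Om -> R) (e : R) :
  measurable_fun setT g -> measurable [set w | e < `|g w|].
Proof.
move=> mg; have mn : measurable_fun setT (fun w => `|g w|) by exact: measurableT_comp.
rewrite (_ : [set w | _] = setT `&` (fun w => `|g w|) @^-1` `]e, +oo[%classic); first exact: mn.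
by rewrite setTI; apply/seteqP; split => w; rewrite /= in_itv/= andbT.
Qed.

Lemma markov_sqr d (Om : measurableType d) (P : probability Om R) (g : Om -> R) (e : R) :
  0 < e -> measurable_fun setT g ->
  ((e ^+ 2)%:E * P [set w | (e < `|g w|)%R] <= \int[P]_w (g w ^+ 2)%:E)%E.
Proof.
move=> e0 mg; set A := [set w | _].
have mA : measurable A by exact: measurable_ltr_norm.
have m2 : measurable_fun setT (fun w => (g w ^+ 2)%:E).
  by apply/measurable_EFinP; exact: measurable_funX.
rewrite -integral_cst//; apply: (@le_trans _ _ (\int[P]_(w in A) (g w ^+ 2)%:E)%E).
  apply: ge0_le_integral => //; rewrite ?lee_fin ?sqr_ge0//.
  - by move=> w _; rewrite lee_fin sqr_ge0.
  - exact: measurable_funTS.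
  - move=> w /= ew; rewrite lee_fin -[leRHS]real_normK ?num_real//.
    by rewrite lerXn2r// ?nnegrE ?ltW.
by apply: ge0_subset_integral => // w _; rewrite lee_fin sqr_ge0.
Qed.

(** Chebyshev: the centred terms [u (W i w)] are pairwise orthogonal, so the sum of n of them has
    second moment n V, and n V / (e n)^2 vanishes. *)
Lemma weak_law d0 d1 d (Om0 : measurableType d0) (Om : measurableType d1) (T : measurableType d)
    (P0 : probability Om0 R) (P : probability Om R) (W0 : Om0 -> T) (W : nat -> Om -> T) (phi : T -> R) :
  measurable_fun setT W0 -> (forall i, measurable_fun setT (W i)) ->
  (forall i A, measurable A -> P (W i @^-1` A) = P0 (W0 @^-1` A)) ->
  (forall i j, i != j -> forall A B, measurable A -> measurable B ->
     P (W i @^-1` A `&` W j @^-1` B) = P (W i @^-1` A) * P (W j @^-1` B))%E ->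
  measurable_fun setT phi -> (\int[P0]_w (phi (W0 w) ^+ 2)%:E < +oo)%E ->
  cvgp P (fun n w => n%:R^-1 * \sum_(i < n) phi (W i w)) (fine (\int[P0]_w (phi (W0 w))%:E)).
Proof.
move=> mW0 mW law ind mphi phi2.
have iphi2 : P0.-integrable setT (fun w => (phi (W0 w) ^+ 2)%:E).
  apply/integrableP; split.
    by apply/measurable_EFinP/measurable_funX; exact: measurableT_comp.
  by under eq_integral do rewrite gee0_abs ?lee_fin ?sqr_ge0//.
have iphi : P0.-integrable setT (fun w => (phi (W0 w))%:E).
  apply: (@le_integrable _ _ _ P0 _ measurableT _ (fun w => 1 + (phi (W0 w) ^+ 2)%:E)%E) => //.
  - by apply/measurable_EFinP; exact: measurableT_comp.
  - move=> w _; rewrite -EFinD /= lee_fin [leRHS]ger0_norm ?addr_ge0 ?sqr_ge0//.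
    by rewrite -[X in _ <= _ + X]real_normK ?num_real//; have := sqr_ge0 (`|phi (W0 w)| - 1); nra.
  - by apply: integrableD => //; exact: finite_measure_integrable_cst.
set m := fine _.
have mE : (\int[P0]_w (phi (W0 w))%:E)%E = m%:E by rewrite /m fineK//; exact: integrable_fin_num.
pose u x := phi x - m.
have mu : measurable_fun setT u by exact: measurable_funB.
have mEu : measurable_fun setT (EFin \o u) by exact/measurable_EFinP.
have iu0 : P0.-integrable setT ((EFin \o u) \o W0).
  by have := integrableB measurableT iphi (finite_measure_integrable_cst P0 m measurableT); apply: eq_integrable.
have iu i : P.-integrable setT ((EFin \o u) \o W i) by exact: (integrable_same_law (mW i) mW0 (law i)).
have u0 : (\int[P0]_w (u (W0 w))%:E = 0)%E.
  rewrite /u; under eq_integral do rewrite EFinB.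
  rewrite integralB_EFin//; last exact: finite_measure_integrable_cst.
  rewrite (_ : (\int[P0]_x (phi (W0 x))%:E)%E = m%:E)// integral_cst//.
  transitivity (m%:E - m%:E * 1)%E; last by rewrite mule1 subee.
  by congr (_ - _ * _)%E; exact: probability_setT.
have Eu i : (\int[P]_w (u (W i w))%:E = 0)%E.
  by rewrite (integral_same_law (g := EFin \o u) (mW i) mW0 (law i)).
have m2 : measurable_fun setT (fun x => (u x ^+ 2)%:E) by exact/measurable_EFinP/measurable_funX.
pose V := (\int[P0]_w (u (W0 w) ^+ 2)%:E)%E.
have Vfin : (V < +oo)%E.
  (* (phi - m)^2 <= 2 phi^2 + 2 m^2. *)
  apply: (@le_lt_trans _ _ (\int[P0]_w (2%:E * (phi (W0 w) ^+ 2)%:E + (2 * m ^+ 2)%:E))%E).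
    apply: ge0_le_integral => //.
    - by move=> w _; rewrite lee_fin sqr_ge0.
    - exact: (measurableT_comp m2 mW0).
    - apply/measurable_EFinP; apply: measurable_funD => //; apply: measurable_funM => //.
      by apply: measurable_funX; exact: measurableT_comp.
    - by move=> w _; rewrite -EFinM -EFinD lee_fin /u; have := sqr_ge0 (phi (W0 w) + m); nra.
  have h : P0.-integrable setT (fun w => (2%:E * (phi (W0 w) ^+ 2)%:E + (2 * m ^+ 2)%:E)%E).
    apply: integrableD => //; [exact: integrableZl|exact: finite_measure_integrable_cst].
  case/integrableP : h => _; apply: le_lt_trans; apply: ge0_le_integral => //.
  - by move=> w _; rewrite -EFinM -EFinD lee_fin; nra.
  - apply/measurable_EFinP; apply: measurable_funD => //; apply: measurable_funM => //.
    by apply: measurable_funX; exact: measurableT_comp.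
  - apply: measurableT_comp => //.
    apply/measurable_EFinP; apply: measurable_funD => //; apply: measurable_funM => //.
    by apply: measurable_funX; exact: measurableT_comp.
  - by move=> w _; exact: lee_abs.
have V0 : (0 <= V)%E by apply: integral_ge0 => w _; rewrite lee_fin sqr_ge0.
have VE : V = (fine V)%:E by rewrite fineK// ge0_fin_numE.
have Vi i : (\int[P]_w (u (W i w) ^+ 2)%:E = V)%E.
  by rewrite (integral_same_law (g := fun x => (u x ^+ 2)%:E) (mW i) mW0 (law i)).
have Eij i j : (\int[P]_w (u (W i w) * u (W j w))%:E = if i == j then V else 0)%E.
  have [->|ij] := eqVneq i j; first by under eq_integral do rewrite -expr2.
  by rewrite integral_indep_mul//; [rewrite !Eu mule0|exact: ind].
have muW i : measurable_fun setT (fun w => u (W i w)) by exact: measurableT_comp.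
have iij i j : P.-integrable setT (fun w => (u (W i w) * u (W j w))%:E).
  have i2 k : P.-integrable setT (fun w => (u (W k w) ^+ 2)%:E).
    apply/integrableP; split; first exact/measurable_EFinP/measurable_funX.
    by under eq_integral do rewrite gee0_abs ?lee_fin ?sqr_ge0//; rewrite Vi.
  apply: (@le_integrable _ _ _ P _ measurableT _ (fun w => (u (W i w) ^+ 2)%:E + (u (W j w) ^+ 2)%:E)%E) => //.
  - exact/measurable_EFinP/measurable_funM.
  - move=> w _; rewrite -EFinD /= lee_fin [leRHS]ger0_norm ?addr_ge0 ?sqr_ge0// ler_norml.
    by have := sqr_ge0 (u (W i w) + u (W j w)); have := sqr_ge0 (u (W i w) - u (W j w)); nra.
  - exact: integrableD.
have S2 n : (\int[P]_w ((\sum_(i < n) u (W i w)) ^+ 2)%:E = n%:R%:E * V)%E.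
  rewrite (eq_integral (fun w => \sum_(i < n) \sum_(j < n) (u (W i w) * u (W j w))%:E)%E); last first.
    move=> w _; rewrite expr2 mulr_suml -sumEFin; apply: eq_bigr => i _.
    by rewrite mulr_sumr -sumEFin.
  rewrite integral_sum//; last by move=> i; apply: integrable_sum.
  transitivity (\sum_(i < n) V)%E; last by rewrite VE sumEFin sumr_const card_ord -EFinM mulr_natl.
  apply: eq_bigr => i _; rewrite integral_sum// (bigD1 i)//= Eij eqxx big1 ?adde0// => j ji.
  by rewrite Eij ifN//; apply: contra ji => /eqP ij; exact/eqP/val_inj.
move=> e e0 del del0.
(* Chebyshev's bound V / (e^2 k) is at most [del] as soon as k >= V / (e^2 del). *)
have [k0 hk0] : exists k0 : nat, (fine V) / (e ^+ 2 * del) < k0%:R.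
  exists (Num.bound (fine V / (e ^+ 2 * del))); apply: archi_boundP.
  by apply: divr_ge0; [exact: fine_ge0|apply: mulr_ge0; [exact: sqr_ge0|exact: ltW]].
exists k0.+1 => k kk0; pose A := [set w | e * k%:R < `|\sum_(i < k) u (W i w)|].
have k_gt0 : (0 : R) < k%:R by rewrite ltr0n (leq_trans _ kk0).
have mS : measurable_fun setT (fun w => \sum_(i < k) u (W i w)) by exact: measurable_sum.
exists A; split.
- exact: measurable_ltr_norm.
- move=> w /= h; rewrite /A/= /u sumrB sumr_const card_ord.
  rewrite (_ : _ - _ = k%:R * (k%:R^-1 * \sum_(i < k) phi (W i w) - m)); last first.
    by rewrite mulrBr mulrA mulfV ?gt_eqF// mul1r mulr_natl.
  by rewrite normrM ger0_norm ?(ltW k_gt0)// mulrC ltr_pM2l.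
- have ek0 : 0 < e * k%:R by exact: mulr_gt0.
  have h : (((e * k%:R) ^+ 2)%:E * P A <= (k%:R * fine V)%:E)%E.
    by rewrite EFinM -VE -S2; exact: markov_sqr.
  have PA : P A = (fine (P A))%:E by rewrite fineK// fin_num_measure//; exact: measurable_ltr_norm.
  rewrite PA -EFinM lee_fin in h; rewrite PA lee_fin.
  have kk : k0%:R <= k%:R :> R by rewrite ler_nat ltnW.
  move: hk0; rewrite ltr_pdivrMr ?mulr_gt0 ?exprn_gt0// => hV.
  have e2 : 0 < e ^+ 2 by rewrite exprn_gt0.
  rewrite -(@ler_pM2l _ ((e * k%:R) ^+ 2)) ?exprn_gt0//; apply: le_trans h _.
  have -> : (e * k%:R) ^+ 2 * del = k%:R * (k%:R * (e ^+ 2 * del)) by ring.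
  rewrite ler_wpM2l ?(ltW k_gt0)//; apply: le_trans (ltW hV) _.
  by rewrite ler_wpM2r// ltW// mulr_gt0.
Qed.

End laws.

(** * Induction from indicators to nonnegative measurable functions *)

Section measurable_induction.
Context d (T : measurableType d) (R : realType).
Import HBNNSimple.

(** The induction mentions no measure, so it can compare an expectation with the iterated integral
    [lebint], which is not given as the integral against a measure. *)
Lemma ge0_measurable_ind (Q : (T -> \bar R) -> Prop) :
  (forall A, measurable A -> Q (fun x => (\1_A x)%:E)) ->
  (forall (r : R) (f : T -> \bar R), (0 <= r)%R -> measurable_fun setT f -> (forall x, (0 <= f x)%E) ->
     Q f -> Q (fun x => r%:E * f x)%E) ->
  (forall f g : T -> \bar R, measurable_fun setT f -> (forall x, (0 <= f x)%E) ->
     measurable_fun setT g -> (forall x, (0 <= g x)%E) ->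
     Q f -> Q g -> Q (fun x => f x + g x)%E) ->
  (forall (f_ : nat -> T -> \bar R) (f : T -> \bar R), (forall n, measurable_fun setT (f_ n)) ->
     (forall n x, (0 <= f_ n x)%E) -> (forall x, nondecreasing_seq (f_^~ x)) ->
     measurable_fun setT f ->
     (forall x, f_ ^~ x @ \oo --> f x) -> (forall n, Q (f_ n)) -> Q f) ->
  forall f : T -> \bar R, measurable_fun setT f -> (forall x, (0 <= f x)%E) -> Q f.
Proof.
move=> Qind Qscale Qadd Qlim f mf f0.
pose g := nnsfun_approx measurableT mf.
refine (Qlim (fun (n : nat) (x : T) => (g n x)%:E) f _ _ _ _ _ _) => //.
- by move=> n; exact/measurable_EFinP.
- by move=> n x; rewrite lee_fin.
- by move=> x m n mn; rewrite lee_fin; exact/lefP/nd_nnsfun_approx.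
- by move=> x; apply: cvg_nnsfun_approx => // y _.
move=> n.
(* The absolute value makes each coefficient nonnegative, as [Qscale] requires, for an arbitrary
   list; on the values of [g n] it changes nothing. *)
have Qsum (l : seq R) : Q (fun x => (\sum_(r <- l) `|r| * \1_(g n @^-1` [set r]) x)%:E).
  elim: l => [|r l IH].
    rewrite (_ : (fun _ => _) = (fun x => (\1_set0 x)%:E)); first exact: Qind.
    by apply/funext => x; rewrite big_nil indic0.
  rewrite (_ : (fun _ => _) = (fun x => (`|r|)%:E * (\1_(g n @^-1` [set r]) x)%:E
      + (\sum_(r <- l) `|r| * \1_(g n @^-1` [set r]) x)%:E)%E); last first.
    by apply/funext => x; rewrite big_cons EFinD EFinM.
  have mi s : measurable_fun setT (\1_(g n @^-1` [set s]) : T -> R) by exact: measurable_indic.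
  apply: Qadd => //.
  - by apply: measurable_funeM; exact/measurable_EFinP.
  - by apply/measurable_EFinP/measurable_sum => s; exact: measurable_funM.
  - by move=> x; rewrite lee_fin sumr_ge0// => s _; rewrite mulr_ge0.
  - by apply: Qscale => //; [exact/measurable_EFinP|exact: Qind].
rewrite (_ : (fun _ => _) = (fun x =>
   (\sum_(r <- finmap.enum_fset (fset_set (range (g n)))) `|r| * \1_(g n @^-1` [set r]) x)%:E)) => //.
apply/funext => x; congr EFin; rewrite fimfunE fsbig_finite//=.
rewrite !big_seq; apply: eq_bigr => r.
by rewrite in_fset_set// inE => -[y _ <-]; rewrite ger0_norm.
Qed.

End measurable_induction.

(** * Tonelli-type calculus for the iterated Lebesgue integral *)

Section iterated_integral.
Context (R : realType).
Local Notation mu := (@lebesgue_measure R).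
Implicit Types (F G : (nat -> R) -> \bar R) (u : nat -> R).

Definition upd u n (t : R) := fun i => if i == n then t else u i.

(** Carrying the current point [u] as an argument, instead of composing the integrand with updates
    as [iter_int] does, keeps [F] fixed, so each property is a plain induction on [n]. *)
Fixpoint iter_int_from n F u : \bar R :=
  match n with
  | 0 => F u
  | n'.+1 => (\int[mu]_t iter_int_from n' F (upd u n' t))%E
  end.

Lemma iter_int_fromE n F u :
  iter_int n (fun s => F (fun i => if (i < n)%N then s i else u i)) = iter_int_from n F u.
Proof.
elim: n u => //= n IH u; apply: eq_integral => t _; rewrite -IH; congr iter_int.
apply/funext => s; congr F; apply/funext => i; rewrite /upd ltnS leq_eqVlt.
by case: (ltngtP i n).
Qed.

(* Measurability of a function of infinitely many coordinates, tested along measurable curves. *)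
Definition plot_measurable F := forall d (T : measurableType d) (s : T -> nat -> R),
  (forall i, measurable_fun setT (s^~ i)) -> measurable_fun setT (fun x => F (s x)).

Lemma measurable_upd d (T : measurableType d) (s : T -> nat -> R) (a : T -> R) n :
  (forall i, measurable_fun setT (s^~ i)) -> measurable_fun setT a ->
  forall i, measurable_fun setT (fun x => upd (s x) n (a x) i).
Proof. by move=> ms ma i; rewrite /upd; case: eqP. Qed.

Lemma measurable_fun_integral d (T : measurableType d) (k : T * R -> \bar R) :
  measurable_fun setT k -> measurable_fun setT (fun x => \int[mu]_t k (x, t))%E.
Proof.
move=> mk; under eq_fun do rewrite integralE.
have posE x : ((fun t => k (x, t))^\+ = (fun t => k^\+ (x, t)))%E.
  by rewrite -[LHS]/((k \o (fun t => (x, t)))^\+)%E funepos_comp.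
have negE x : ((fun t => k (x, t))^\- = (fun t => k^\- (x, t)))%E.
  by rewrite -[LHS]/((k \o (fun t => (x, t)))^\-)%E funeneg_comp.
apply: emeasurable_funB.
  rewrite (_ : (fun _ => _) = fubini_F mu (k^\+)%E); last by apply/funext => x; rewrite posE.
  by apply: measurable_fun_fubini_tonelli_F => //; exact: measurable_funepos.
rewrite (_ : (fun _ => _) = fubini_F mu (k^\-)%E); last by apply/funext => x; rewrite negE.
by apply: measurable_fun_fubini_tonelli_F => //; exact: measurable_funeneg.
Qed.

(** The domain of a test curve is arbitrary, so the new integration variable is absorbed by
    replacing [T] with [T * R]. *)
Lemma plot_measurable_iter n F : plot_measurable F -> plot_measurable (iter_int_from n F).
Proof.
move=> mF; elim: n => //= n IH d T s ms.
apply: (measurable_fun_integral (k := fun z => iter_int_from n F (upd (s z.1) n z.2))).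
apply: IH; apply: measurable_upd => // i.
exact: (measurableT_comp (ms i)).
Qed.

Lemma measurable_iter_upd n m F u : plot_measurable F ->
  measurable_fun setT (fun t => iter_int_from n F (upd u m t)).
Proof.
move=> mF; apply: (@plot_measurable_iter n F mF _ _ (fun t => upd u m t)).
exact: (@measurable_upd _ _ (fun=> u) id).
Qed.

Lemma iter_int_from_ge0 n F u : (forall s, (0 <= F s)%E) -> (0 <= iter_int_from n F u)%E.
Proof. by move=> F0; elim: n u => //= n IH u; exact: integral_ge0. Qed.

Lemma le_iter_int_from n F G u : plot_measurable F -> plot_measurable G ->
  (forall s, (0 <= F s)%E) -> (forall s, (F s <= G s)%E) ->
  (iter_int_from n F u <= iter_int_from n G u)%E.
Proof.
move=> mF mG F0 FG; elim: n u => //= n IH u; apply: ge0_le_integral => //.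
- by move=> t _; exact: iter_int_from_ge0.
- exact: measurable_iter_upd.
- exact: measurable_iter_upd.
Qed.

Lemma iter_int_fromD n F G u : plot_measurable F -> plot_measurable G ->
  (forall s, (0 <= F s)%E) -> (forall s, (0 <= G s)%E) ->
  (iter_int_from n (fun s => F s + G s) u = iter_int_from n F u + iter_int_from n G u)%E.
Proof.
move=> mF mG F0 G0; elim: n u => //= n IH u.
under eq_integral do rewrite IH.
by apply: ge0_integralD => //; try (by move=> t _; exact: iter_int_from_ge0); exact: measurable_iter_upd.
Qed.

Lemma iter_int_fromZ n r F u : (0 <= r)%R -> plot_measurable F -> (forall s, (0 <= F s)%E) ->
  (iter_int_from n (fun s => r%:E * F s) u = r%:E * iter_int_from n F u)%E.
Proof.
move=> r0 mF F0; elim: n u => //= n IH u.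
under eq_integral do rewrite IH.
apply: ge0_integralZl => //; [exact: measurable_iter_upd|by move=> t _; exact: iter_int_from_ge0].
Qed.

Lemma cvg_iter_int_from n (F_ : nat -> (nat -> R) -> \bar R) F u :
  (forall k, plot_measurable (F_ k)) -> (forall k s, (0 <= F_ k s)%E) ->
  (forall s, nondecreasing_seq (F_^~ s)) -> (forall s, F_^~ s @ \oo --> F s) ->
  (fun k => iter_int_from n (F_ k) u) @ \oo --> iter_int_from n F u.
Proof.
move=> mF F0 ndF FF; elim: n u => //= n IH u.
have -> : (\int[mu]_t iter_int_from n F (upd u n t) =
    \int[mu]_t limn (fun k => iter_int_from n (F_ k) (upd u n t)))%E.
  by apply: eq_integral => t _; apply/esym/cvg_lim => //; exact: IH.
apply: cvg_monotone_convergence => //.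
- by move=> k; exact: measurable_iter_upd.
- by move=> k t _; exact: iter_int_from_ge0.
- by move=> t _ k l kl; apply: le_iter_int_from => // s; exact: ndF.
Qed.

Lemma plot_measurable_funepos F : plot_measurable F -> plot_measurable (F^\+)%E.
Proof.
move=> mF d T s ms; rewrite -[X in measurable_fun _ X]/(F^\+ \o s)%E -funepos_comp.
by apply: measurable_funepos; exact: mF.
Qed.

Lemma plot_measurable_funeneg F : plot_measurable F -> plot_measurable (F^\-)%E.
Proof.
move=> mF d T s ms; rewrite -[X in measurable_fun _ X]/(F^\- \o s)%E -funeneg_comp.
by apply: measurable_funeneg; exact: mF.
Qed.

Lemma plot_measurable_abse F : plot_measurable F -> plot_measurable (abse \o F)%E.
Proof. by move=> mF d T s ms; apply: measurableT_comp => //; exact: mF. Qed.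

(** Only the full iterated integral of |F| is known to be finite; at each level the induction
    hypothesis therefore applies to almost every value of the outer variable, which is enough under
    the integral. *)
Lemma iter_int_from_posneg n F u : plot_measurable F ->
  (iter_int_from n (abse \o F) u < +oo)%E ->
  (iter_int_from n F u = iter_int_from n (F^\+) u - iter_int_from n (F^\-) u)%E.
Proof.
move=> mF; elim: n u => [u /= _|n IH u /= fin]; first by rewrite [in LHS](funeposneg F).
have mp := plot_measurable_funepos mF; have mn := plot_measurable_funeneg mF.
have ma := plot_measurable_abse mF.
have pa s : (F^\+ s <= (abse \o F) s)%E.
  by rewrite (fune_abse F) leeDl// funeneg_ge0.
have na s : (F^\- s <= (abse \o F) s)%E.
  by rewrite (fune_abse F) leeDr// funepos_ge0.
have p0 m v : (0 <= iter_int_from m (F^\+) v)%E by exact: iter_int_from_ge0.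
have n0 m v : (0 <= iter_int_from m (F^\-) v)%E by exact: iter_int_from_ge0.
have a0 m v : (0 <= iter_int_from m (abse \o F) v)%E.
  by apply: iter_int_from_ge0 => s; exact: abse_ge0.
have ip : mu.-integrable setT (fun t => iter_int_from n (F^\+)%E (upd u n t)).
  apply/integrableP; split; first exact: measurable_iter_upd.
  under eq_integral do rewrite gee0_abs//.
  by apply: le_lt_trans fin; exact: (@le_iter_int_from n.+1).
have iN : mu.-integrable setT (fun t => iter_int_from n (F^\-)%E (upd u n t)).
  apply/integrableP; split; first exact: measurable_iter_upd.
  under eq_integral do rewrite gee0_abs//.
  by apply: le_lt_trans fin; exact: (@le_iter_int_from n.+1).
rewrite -integralB//; apply: ae_eq_integral => //.
- exact: measurable_iter_upd.
- by apply: emeasurable_funB; exact: measurable_iter_upd.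
have ia : mu.-integrable setT (fun t => iter_int_from n (abse \o F)%E (upd u n t)).
  apply/integrableP; split; first exact: measurable_iter_upd.
  under eq_integral do rewrite gee0_abs ?a0//.
  exact: fin.
(* An integrable function is finite almost everywhere: this supplies the finiteness hypothesis of
   [IH]. *)
apply: filterS (integrable_ae measurableT ia) => t /= /(_ Logic.I) ft _.
by rewrite IH//; rewrite ltey_eq ft.
Qed.

End iterated_integral.

(** * Row vectors as a measurable type *)

Section borel_vectors.
Context (R : realType) (p : nat).

(** The generators of [borel_rV] under a name, so that the measurable sets of [rVb] are convertible
    to those of [borel_rV]. *)
Definition rV_cylinders : set (set 'rV[R]_p) :=
  [set S | exists (i : 'I_p) (B : set R), measurable B /\ S = [set v : 'rV[R]_p | B (v ord0 i)]].

Definition rVb := g_sigma_algebraType rV_cylinders.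

Lemma measurable_coord i : measurable_fun setT (fun x : rVb => x ord0 i).
Proof. by move=> _ B mB; rewrite setTI; apply: sub_sigma_algebra; exists i, B. Qed.

Lemma measurable_to_rVb d (T : measurableType d) (s : T -> rVb) :
  (forall i, measurable_fun setT (fun w => s w ord0 i)) -> measurable_fun setT s.
Proof.
move=> ms; apply: (@measurability _ _ T rVb setT s rV_cylinders) => //.
by move=> _ [_ [i [B [mB ->]]] <-]; exact: (ms i measurableT B mB).
Qed.

Lemma measurable_dotp (b : 'rV[R]_p) : measurable_fun setT (fun x : rVb => dotp b x).
Proof.
by apply: measurable_sum => i; apply: measurable_funM => //; exact: measurable_coord.
Qed.

Lemma measurable_enorm_le r : measurable [set x : rVb | enorm x <= r].
Proof.
have [r0|r0] := ltP r 0.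
  rewrite (_ : [set _ | _] = set0)//; apply/seteqP; split => // x /= h.
  by have := le_lt_trans h r0; rewrite ltNge enorm_ge0.
have mq : measurable_fun setT (fun x : rVb => \sum_(i < p) x ord0 i ^+ 2).
  by apply: measurable_sum => i; apply: measurable_funX; exact: measurable_coord.
rewrite (_ : [set _ | _] = setT `&` (fun x : rVb => \sum_(i < p) x ord0 i ^+ 2) @^-1` `]-oo, r ^+ 2]%classic).
  exact: mq.
rewrite setTI; apply/seteqP; split => x; rewrite /= in_itv/= -sqr_enorm;
  by rewrite ler_pXn2r// ?nnegrE ?enorm_ge0.
Qed.

Lemma rmeas_borel_rV d (T : measurableType d) (s : T -> 'rV[R]_p) :
  rmeas (@borel_rV R p) s -> measurable_fun setT (s : T -> rVb).
Proof. by move=> ms _ A mA; rewrite setTI; exact: ms. Qed.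

Lemma borel_pairE (A : set ('rV[R]_p * R)) :
  borel_pair A <-> measurable (A : set (rVb * R)%type).
Proof.
rewrite (_ : measurable (A : set (rVb * R)%type) =
  <<s [set A1 `*` A2 | A1 in @measurable _ rVb & A2 in @measurable _ R] >> A); last first.
  by rewrite -measurable_prod_measurableType.
rewrite /borel_pair (_ : [set S | _] = [set A1 `*` A2 | A1 in @measurable _ rVb & A2 in @measurable _ R])//.
apply/seteqP; split => S.
  by move=> [A1 [A2 [mA1 mA2 ->]]]; exists A1 => //; exists A2.
by move=> [A1 mA1 [A2 mA2 <-]]; exists A1, A2.
Qed.

Lemma rmeas_borel_pair d (T : measurableType d) (s : T -> 'rV[R]_p * R) :
  rmeas (@borel_pair R p) s -> measurable_fun setT (s : T -> (rVb * R)%type).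
Proof. by move=> ms _ A mA; rewrite setTI; apply: ms; exact/borel_pairE. Qed.

End borel_vectors.

(** * Change of variables for a density on the line, and translation invariance *)

Section density.
Context (R : realType).

Lemma ge0_integral_density d d' (Om : measurableType d) (T : measurableType d')
    (P : probability Om R) (nu : {measure set T -> \bar R}) (W : Om -> T) (f : T -> R) (g : T -> \bar R) :
  measurable_fun setT W -> measurable_fun setT f -> (forall t, 0 <= f t) ->
  (forall A, measurable A -> P (W @^-1` A) = (\int[nu]_(t in A) (f t)%:E)%E) ->
  measurable_fun setT g -> (forall t, (0 <= g t)%E) ->
  (\int[P]_w g (W w) = \int[nu]_t (g t * (f t)%:E))%E.
Proof.
move=> mW mf f0 law; have mEf : measurable_fun setT (fun t => (f t)%:E) by exact/measurable_EFinP.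
have fE0 t : (0 <= (f t)%:E)%E by rewrite lee_fin.
move: g; apply: ge0_measurable_ind.
- move=> A mA; rewrite (_ : (fun w => _) = (fun w => (\1_(W @^-1` A) w)%:E)); last by apply/funext.
  rewrite integral_indic//; last by rewrite -[X in measurable X]setTI; exact: mW.
  rewrite setIT [LHS]law// integral_mkcond; apply: eq_integral => t _.
  by rewrite /= patchE indicE; case: (t \in A); rewrite ?mul1e ?mul0e.
- move=> r g r0 mg g0 IH.
  rewrite ge0_integralZl//; last exact: (measurableT_comp mg).
  rewrite IH -ge0_integralZl//; last 2 first.
  + exact: emeasurable_funM.
  + by move=> t _; rewrite mule_ge0.
  by apply: eq_integral => t _; rewrite muleA.
- move=> g h mg g0 mh h0 IHg IHh.
  rewrite ge0_integralD//; [|exact: (measurableT_comp mg)|exact: (measurableT_comp mh)].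
  rewrite IHg IHh -ge0_integralD//; last 4 first.
  + by move=> t _; rewrite mule_ge0.
  + exact: emeasurable_funM.
  + by move=> t _; rewrite mule_ge0.
  + exact: emeasurable_funM.
  by apply: eq_integral => t _; rewrite ge0_muleDl.
- move=> g_ g mg g0 ndg mgg gg IH.
  have c1 : (fun n => \int[P]_w g_ n (W w))%E @ \oo --> (\int[P]_w g (W w))%E.
    have -> : (\int[P]_w g (W w) = \int[P]_w limn (fun n => g_ n (W w)))%E.
      by apply: eq_integral => w _; apply/esym/cvg_lim => //; exact: gg.
    by apply: cvg_monotone_convergence => // n; exact: (measurableT_comp (mg n)).
  have c2 : (fun n => \int[nu]_t (g_ n t * (f t)%:E))%E @ \oo --> (\int[nu]_t (g t * (f t)%:E))%E.
    have -> : (\int[nu]_t (g t * (f t)%:E) = \int[nu]_t limn (fun n => g_ n t * (f t)%:E))%E.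
      by apply: eq_integral => t _; apply/esym/cvg_lim => //; apply: cvgeZr => //; exact: gg.
    apply: cvg_monotone_convergence => // [n|n t _|t _ m n mn].
    + exact: emeasurable_funM.
    + by rewrite mule_ge0.
    + by rewrite lee_wpmul2r//; exact: ndg.
  rewrite -(cvg_lim _ c1)// -(cvg_lim _ c2)//; apply: congr_lim.
  by apply/funext => n; exact: IH.
Qed.

(** The image of Lebesgue measure under the translation gives intervals their length, and this
    characterizes Lebesgue measure. *)
Lemma ge0_integral_shift (g : R -> \bar R) (a : R) :
  measurable_fun setT g -> (forall t, (0 <= g t)%E) ->
  (\int[lebesgue_measure]_t g t = \int[lebesgue_measure]_y g (y - a)%R)%E.
Proof.
move=> mg g0; pose phi := (fun y => y - a) : R -> measurableTypeR R.
have mphi : measurable_fun setT phi by exact: measurable_funB.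
transitivity (\int[pushforward lebesgue_measure phi]_t g t)%E; last first.
  by rewrite ge0_integral_pushforward//; exact: measurable_funTS.
apply: eq_measure_integral => //= A mA _.
apply: lebesgue_measure_unique => //= _ [[b c]] _ <-.
rewrite /pushforward (_ : _ @^-1` _ = `]b + a, c + a]%classic).
  rewrite /= !lebesgue_measure_itv/= !lte_fin ltrD2r.
  by case: ifPn => // _; rewrite -!EFinB; congr EFin; ring.
by apply/seteqP; split => y; rewrite /phi /= !in_itv/= ltrBrDr lerBlDr.
Qed.

End density.

(** * Expectations of functions of [X] as iterated integrals against [fX] *)

Section vector_density.
Context (R : realType) (p : nat) d (Om : measurableType d) (P : probability Om R).
Variables (X : Om -> 'rV[R]_p) (fX : 'rV[R]_p -> R).
Hypothesis mX : measurable_fun setT (X : Om -> rVb R p).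
Hypothesis fX0 : forall x, 0 <= fX x.
Hypothesis mfX : measurable_fun setT (fX : rVb R p -> R).
Hypothesis lawX : forall A, @borel_rV R p A ->
  P (X @^-1` A) = lebint (fun x => ((\1_A x : R) * fX x)%:E).

Let row_of (s : nat -> R) : rVb R p := \row_(i < p) s i.

Let lebintE (g : 'rV[R]_p -> \bar R) : lebint g = iter_int_from p (g \o row_of) (fun=> 0).
Proof.
rewrite -iter_int_fromE; congr iter_int; apply/funext => s /=; congr g.
by apply/rowP => i; rewrite !mxE ltn_ord.
Qed.

Let plot_measurable_row (g : rVb R p -> \bar R) : measurable_fun setT g -> plot_measurable (g \o row_of).
Proof.
move=> mg d' T s ms.
have mr : measurable_fun setT (fun x => row_of (s x)).
  apply: measurable_to_rVb => i; rewrite (_ : (fun _ => _) = s^~ i)//.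
  by apply/funext => x; rewrite mxE.
exact: (measurableT_comp mg mr).
Qed.

(** [lawX] is the case of indicators; sums, scalars and monotone limits pass through both sides. *)
Lemma ge0_lebint_density (g : rVb R p -> \bar R) : measurable_fun setT g -> (forall x, (0 <= g x)%E) ->
  lebint (fun x => g x * (fX x)%:E)%E = (\int[P]_w g (X w))%E.
Proof.
have f0 x : (0 <= (fX x)%:E)%E by rewrite lee_fin.
have mEfX : measurable_fun setT (fun x : rVb R p => (fX x)%:E) by exact/measurable_EFinP.
move: g; apply: ge0_measurable_ind.
- move=> A mA; rewrite (_ : (fun w => (\1_A (X w))%:E) = (fun w => (\1_(X @^-1` A) w)%:E)); last by apply/funext.
  rewrite integral_indic//; last by rewrite -[X in measurable X]setTI; exact: mX.
  by rewrite setIT [RHS]lawX//; congr lebint; apply/funext => x; rewrite EFinM.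
- move=> r g r0 mg g0 IH.
  rewrite ge0_integralZl//; last exact: (measurableT_comp mg mX).
  rewrite -IH !lebintE -iter_int_fromZ//; last 2 first.
  + by apply: plot_measurable_row; exact: emeasurable_funM.
  + by move=> s /=; rewrite mule_ge0.
  by congr iter_int_from; apply/funext => s /=; rewrite muleA.
- move=> g h mg g0 mh h0 IHg IHh.
  rewrite ge0_integralD//; [|exact: (measurableT_comp mg mX)|exact: (measurableT_comp mh mX)].
  rewrite -IHg -IHh !lebintE -iter_int_fromD//; last 4 first.
  + by apply: plot_measurable_row; exact: emeasurable_funM.
  + by apply: plot_measurable_row; exact: emeasurable_funM.
  + by move=> s /=; rewrite mule_ge0.
  + by move=> s /=; rewrite mule_ge0.
  by congr iter_int_from; apply/funext => s /=; rewrite ge0_muleDl.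
- move=> g_ g mg g0 ndg mgg gg IH.
  have c1 : (fun n => \int[P]_w g_ n (X w))%E @ \oo --> (\int[P]_w g (X w))%E.
    have -> : (\int[P]_w g (X w) = \int[P]_w limn (fun n => g_ n (X w)))%E.
      by apply: eq_integral => w _; apply/esym/cvg_lim => //; exact: gg.
    by apply: cvg_monotone_convergence => // n; exact: (measurableT_comp (mg n) mX).
  have c2 : (fun n => lebint (fun x => g_ n x * (fX x)%:E)%E) @ \oo --> lebint (fun x => g x * (fX x)%:E)%E.
    rewrite lebintE; under eq_fun do rewrite lebintE.
    apply: cvg_iter_int_from => [n|n s|s m n mn|s].
    + by apply: plot_measurable_row; exact: emeasurable_funM.
    + by rewrite /= mule_ge0.
    + by rewrite /= lee_wpmul2r//; exact: ndg.
    + by apply: cvgeZr => //; exact: gg.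
  rewrite -(cvg_lim _ c1)// -(cvg_lim _ c2)//; apply: congr_lim.
  by apply/funext => n; exact: IH.
Qed.

Lemma lebint_density (g : rVb R p -> R) : measurable_fun setT g ->
  P.-integrable setT (fun w => (g (X w))%:E) ->
  lebint (fun x => (g x * fX x)%:E) = (\int[P]_w (g (X w))%:E)%E.
Proof.
move=> mg /integrableP[_ ig].
have mEg : measurable_fun setT (fun x : rVb R p => (g x)%:E) by exact/measurable_EFinP.
pose F (x : rVb R p) := (g x * fX x)%:E.
have mF : measurable_fun setT F by apply/measurable_EFinP; exact: measurable_funM.
have absE : lebint (abse \o F) = (\int[P]_w `|(g (X w))%:E|)%E.
  rewrite -(ge0_lebint_density (g := fun x => `|(g x)%:E|%E))//; last exact: measurableT_comp.
  by congr lebint; apply/funext => x; rewrite /F/= normrM EFinM [`|fX x|]ger0_norm.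
have posE : lebint (F^\+)%E = (\int[P]_w ((fun w => (g (X w))%:E)^\+ w))%E.
  transitivity (\int[P]_w (((fun x : rVb R p => (g x)%:E)^\+)%E (X w)))%E.
    rewrite -(ge0_lebint_density (measurable_funepos mEg) (funepos_ge0 _)).
    congr lebint; apply/funext => x; rewrite !funeposE /F -[0%E]/(0%:E) -!EFin_max -EFinM.
    by rewrite maxr_pMl// mul0r.
  by apply: eq_integral => w _; rewrite !funeposE.
have negE : lebint (F^\-)%E = (\int[P]_w ((fun w => (g (X w))%:E)^\- w))%E.
  transitivity (\int[P]_w (((fun x : rVb R p => (g x)%:E)^\-)%E (X w)))%E.
    rewrite -(ge0_lebint_density (measurable_funeneg mEg) (funeneg_ge0 _)).
    congr lebint; apply/funext => x; rewrite !funenegE /F -[0%E]/(0%:E) -!EFinN -!EFin_max -EFinM.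
    by rewrite maxr_pMl// mul0r mulNr.
  by apply: eq_integral => w _; rewrite !funenegE.
rewrite [RHS]integralE -posE -negE !lebintE.
rewrite -[F^\+%E \o _]funepos_comp -[F^\-%E \o _]funeneg_comp.
apply: iter_int_from_posneg; first exact: plot_measurable_row.
by rewrite -[X in iter_int_from _ X]/((abse \o F) \o row_of) -lebintE absE.
Qed.

End vector_density.

(** By symmetry it suffices to integrate over the half-line, where the function is 1 / r times the
    exponential density. *)
Lemma exp_abs_integral_lty (R : realType) (r : R) : 0 < r ->
  (\int[lebesgue_measure]_t (expR (- (r * `|t|)))%:E < +oo)%E.
Proof.
move=> r0; rewrite ge0_symfun_integralT; last 3 first.
- by move=> x; exact: expR_ge0.
- move=> x; apply: continuous_comp; last exact: continuous_expR.
  by apply: continuousN; apply: continuousM; [exact: cst_continuous|exact: norm_continuous].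
- by move=> x /=; rewrite normrN.
have mpdf : measurable_fun setT (fun x => (exponential_pdf r x)%:E).
  by apply/measurable_EFinP; exact: measurable_exponential_pdf.
have pdf0 x : 0 <= exponential_pdf r x by apply: exponential_pdf_ge0; exact: ltW.
have mD : measurable [set x : R | 0 <= x] by rewrite -set_itvcy.
have me : measurable_fun setT (fun x : R => expR (- (r * `|x|))).
  apply: measurableT_comp => //; apply: measurableT_comp => //.
  by apply: measurable_funM => //; exact: measurableT_comp.
have h : (\int[lebesgue_measure]_(x in [set x : R | 0 <= x]%R) (expR (- (r * `|x|)))%:E <= (r^-1)%:E)%E.
  apply: (@le_trans _ _ (\int[lebesgue_measure]_(x in [set x : R | 0 <= x]%R) ((r^-1)%:E * (exponential_pdf r x)%:E))%E).
    apply: ge0_le_integral => //.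
    - by apply/measurable_EFinP; exact: measurable_funTS.
    - by apply: measurable_funTS; exact: measurable_funeM.
    - move=> x /= x0; rewrite -EFinM lee_fin exponential_pdfE// mulrA mulVf ?gt_eqF// mul1r.
      by rewrite ger0_norm// mulNr.
  apply: (@le_trans _ _ (\int[lebesgue_measure]_x ((r^-1)%:E * (exponential_pdf r x)%:E))%E).
    apply: ge0_subset_integral => //; first exact: measurable_funeM.
    by move=> x _; rewrite -EFinM lee_fin mulr_ge0// invr_ge0 ltW.
  rewrite ge0_integralZl//.
  - by rewrite integral_exponential_pdf// mule1.
  - by move=> x _; rewrite lee_fin.
  - by rewrite lee_fin invr_ge0 ltW.
apply: (@le_lt_trans _ _ (2%:E * (r^-1)%:E)%E); last by rewrite -EFinM ltry.
by rewrite lee_wpmul2l.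
Qed.

(** * Bounds, Lipschitz estimates and moments for the noise density *)

Section noise_density.
Context (R : realType) (alpha d : R).
Hypotheses (alpha1 : 1 <= alpha) (d_gt0 : 0 < d).
Hypothesis integral_f : (\int[@lebesgue_measure R]_t (fdens alpha d t)%:E = 1)%E.

Local Notation c := (c_alpha alpha d).
Local Notation kap := (d `^ (- alpha)).
Local Notation f := (fdens alpha d).
Local Notation mu := (@lebesgue_measure R).

Lemma rate_gt0 : 0 < kap. Proof. by rewrite powR_gt0. Qed.

(** A nonpositive constant would make the density nonpositive, contradicting its total mass 1. *)
Lemma norm_const_gt0 : 0 < c.
Proof.
rewrite ltNge; apply/negP => c0.
have f0 t : (0 <= - (f t)%:E)%E.
  by rewrite -EFinN lee_fin oppr_ge0 mulr_le0_ge0// expR_ge0.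
have : (\int[mu]_t - (- (f t)%:E) = - \int[mu]_t - (f t)%:E)%E by apply: integral_ge0N => t _.
under eq_integral do rewrite oppeK.
rewrite integral_f => h; have := integral_ge0 mu (fun t _ => f0 t) : (0 <= \int[mu]_t - (f t)%:E)%E.
by rewrite -leeN2 -h oppe0 lee_fin ler10.
Qed.

Lemma fdens_gt0 t : 0 < f t.
Proof. by rewrite mulr_gt0 ?norm_const_gt0 ?expR_gt0. Qed.

Lemma fdens_le t : f t <= c.
Proof.
rewrite ler_piMr ?(ltW norm_const_gt0)// expR_le1 oppr_le0 mulr_ge0 ?powR_ge0//.
Qed.

Lemma ln_fdens t : ln (f t) = ln c - kap * `|t| `^ alpha.
Proof. by rewrite /fdens lnM ?posrE ?norm_const_gt0 ?expR_gt0// expRK. Qed.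

Lemma measurable_fdens : measurable_fun setT f.
Proof.
apply: measurable_funM => //; apply: measurableT_comp => //; apply: measurableT_comp => //.
apply: measurable_funM => //; apply: (measurableT_comp (f := @powR R ^~ alpha)) => //.
Qed.

(** The Lipschitz bound on the exponent, kept in multiplicative form: this is the shape that
    [ln_mean_le] and [ln_le_of_exp] consume. *)
Lemma fdens_lipschitz T s t : 1 <= T -> `|s| <= T -> `|t| <= T ->
  f s <= expR (kap * (alpha * T `^ alpha * `|s - t|)) * f t.
Proof.
move=> T1 sT tT; rewrite /fdens mulrCA ler_wpM2l ?(ltW norm_const_gt0)// -expRD ler_expR.
rewrite -lerBlDr opprK addrC -mulrBr ler_wpM2l ?powR_ge0//.
by apply: le_trans (norm_powR_lipschitz alpha1 T1 sT tT); rewrite distrC ler_norm.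
Qed.

(** From the multiplicative form: f v >= exp(-e) f u >= (1 - e) f u, and f u <= c. *)
Lemma norm_fdens_lipschitz T s t : 1 <= T -> `|s| <= T -> `|t| <= T ->
  `|f s - f t| <= c * (kap * (alpha * T `^ alpha * `|s - t|)).
Proof.
move=> T1; suff h u v : `|u| <= T -> `|v| <= T -> f u <= c * (kap * (alpha * T `^ alpha * `|u - v|)) + f v.
  by move=> sT tT; apply: norm_sub_le_of; [exact: h|rewrite distrC; exact: h].
move=> uT vT; have := fdens_lipschitz T1 uT vT.
set e := kap * _; have e0 : 0 <= e.
  by rewrite !mulr_ge0 ?powR_ge0// (le_trans ler01 alpha1).
have fu := ltW (fdens_gt0 u); have fuc := fdens_le u => h.
have h1 : expR (- e) * f u <= f v by rewrite expRN mulrC ler_pdivrMr ?expR_gt0// mulrC.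
have h2 : (1 - e) * f u <= expR (- e) * f u by rewrite ler_wpM2r// expR_ge1Dx.
have h3 : e * f u <= e * c by rewrite ler_wpM2l.
by lra.
Qed.

Lemma fdens_ge T t : `|t| <= T -> c * expR (- (kap * T `^ alpha)) <= f t.
Proof.
move=> tT; rewrite /fdens ler_wpM2l ?(ltW norm_const_gt0)// ler_expR lerN2 ler_wpM2l ?powR_ge0//.
have a0 : 0 <= alpha by exact: le_trans ler01 alpha1.
by rewrite ge0_ler_powR ?nnegrE// (le_trans _ tT).
Qed.

Lemma noise_moment_lty A : 1 <= A ->
  (\int[mu]_t ((((`|t| + A) `^ alpha) ^+ 2)%:E * (f t)%:E) < +oo)%E.
Proof.
move=> A1.
have alpha0 : 0 < alpha by exact: lt_le_trans ltr01 alpha1.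
have k0 := rate_gt0; have c0 := norm_const_gt0.
(* With ln x <= del x - ln del, the factor (|t| + A)^(2 alpha) adds 2 alpha del |t| = kap |t| / 2 to
   the exponent, half of the decay kap (|t| - 1) <= kap |t|^alpha. *)
pose del := kap / (4 * alpha).
have del0 : 0 < del by rewrite divr_gt0// mulr_gt0.
pose K := c * expR (kap + alpha * 2 * (del * A - ln del)).
have K0 : 0 < K by rewrite mulr_gt0 ?expR_gt0.
have bound t : ((`|t| + A) `^ alpha) ^+ 2 * f t <= K * expR (- (kap / 2 * `|t|)).
  have x0 : 0 < `|t| + A by rewrite ltr_wpDl// (lt_le_trans ltr01).
  have lnx : ln (`|t| + A) <= del * (`|t| + A) - ln del.
    rewrite lerBrDr addrC -lnM ?posrE//.
    by apply/ltW/ln_sublinear; rewrite mulr_gt0.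
  have tal : `|t| - 1 <= `|t| `^ alpha.
    have [t1|t1] := leP 1 `|t|; last first.
      by rewrite (@le_trans _ _ 0) ?powR_ge0// subr_le0 ltW.
    apply: (@le_trans _ _ (`|t| `^ 1)); first by rewrite powRr1// lerBlDr lerDl.
    by rewrite ler_powR.
  have h1 : alpha * 2 * ln (`|t| + A) <= alpha * 2 * (del * (`|t| + A) - ln del).
    by rewrite ler_wpM2l// mulr_ge0// ltW.
  have h2 : kap * (`|t| - 1) <= kap * `|t| `^ alpha by rewrite ler_wpM2l// ltW.
  have h3 : alpha * 2 * (del * `|t|) = kap / 2 * `|t|.
    by rewrite /del; field; rewrite gt_eqF.
  have h : expR (alpha * 2 * ln (`|t| + A)) * expR (- (kap * `|t| `^ alpha)) <=
      expR (kap + alpha * 2 * (del * A - ln del)) * expR (- (kap / 2 * `|t|)).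
    by rewrite -!expRD ler_expR; lra.
  rewrite -powR_mulrn ?powR_ge0// -powRrM {1}/powR gt_eqF// /fdens /K mulrCA.
  by rewrite -[leRHS]mulrA ler_wpM2l ?(ltW c0).
have mA : measurable_fun setT (fun t : R => ((`|t| + A) `^ alpha) ^+ 2).
  apply: measurable_funX; apply: (measurableT_comp (f := @powR R ^~ alpha)) => //.
  by apply: measurable_funD => //; exact: measurableT_comp.
have me : measurable_fun setT (fun x : R => expR (- (kap / 2 * `|x|))).
  apply: measurableT_comp => //; apply: measurableT_comp => //.
  by apply: measurable_funM => //; exact: measurableT_comp.
apply: (@le_lt_trans _ _ (\int[mu]_t (K%:E * (expR (- (kap / 2 * `|t|)))%:E))%E).
  apply: ge0_le_integral => //.
  - by move=> t _; rewrite -EFinM lee_fin mulr_ge0 ?sqr_ge0// ltW// fdens_gt0.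
  - by apply/measurable_EFinP; apply: measurable_funM => //; exact: measurable_fdens.
  - by apply: measurable_funeM; exact/measurable_EFinP.
  - by move=> t _; rewrite -!EFinM lee_fin.
rewrite ge0_integralZl//; last by rewrite lee_fin ltW.
- by rewrite lte_mul_pinfty ?lee_fin ?(ltW K0)// exp_abs_integral_lty// divr_gt0.
- by exact/measurable_EFinP.
Qed.

End noise_density.

Definition envelope (R : realType) (alpha A y : R) := (`|y| + A) `^ alpha.

Opaque fdens c_alpha.

(** * The regression model: joint law of covariate and response, and the envelope *)

Section model.
Context (R : realType) (p : nat) (beta0 : 'rV[R]_p) (alpha d B : R).
Context (d0 : measure_display) (Om0 : measurableType d0) (P0 : probability Om0 R).
Variables (X : Om0 -> 'rV[R]_p) (eps : Om0 -> R) (fX : 'rV[R]_p -> R).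
Hypotheses (alpha1 : 1 <= alpha) (d_gt0 : 0 < d) (B_gt0 : 0 < B).
Hypothesis mX : measurable_fun setT (X : Om0 -> rVb R p).
Hypothesis fX0 : forall x, 0 <= fX x.
Hypothesis mfX : measurable_fun setT (fX : rVb R p -> R).
Hypothesis lawX : forall A, @borel_rV R p A ->
  P0 (X @^-1` A) = lebint (fun x => ((\1_A x : R) * fX x)%:E).
Hypothesis XB : P0 [set w | enorm (X w) <= B] = 1%E.
Hypothesis meps : measurable_fun setT eps.
Hypothesis law_eps : forall A : set R, measurable A ->
  P0 (eps @^-1` A) = (\int[@lebesgue_measure R]_(t in A) (fdens alpha d t)%:E)%E.
Hypothesis indep : forall A (C : set R), @borel_rV R p A -> measurable C ->
  P0 (X @^-1` A `&` eps @^-1` C) = (P0 (X @^-1` A) * P0 (eps @^-1` C))%E.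

Local Notation c := (c_alpha alpha d).
Local Notation kap := (d `^ (- alpha)).
Local Notation f := (fdens alpha d).
Local Notation mu := (@lebesgue_measure R).
Local Notation Q := (envelope alpha).

Definition response w := dotp beta0 (X w) + eps w.
Local Notation Y := response.

Lemma integral_noise_density : (\int[mu]_t (f t)%:E = 1)%E.
Proof. by rewrite -law_eps// preimage_setT probability_setT. Qed.
Local Notation if1 := integral_noise_density.

Let c0 := norm_const_gt0 if1.
Let k0 := rate_gt0 alpha d_gt0.
Let f0 := fdens_gt0 if1.
Let fc := fdens_le if1.
Let mf := measurable_fdens alpha d.
Let alpha0 : 0 < alpha. Proof. exact: lt_le_trans ltr01 alpha1. Qed.

Lemma measurable_dotpX b : measurable_fun setT (fun w => dotp b (X w)).
Proof. exact: (measurableT_comp (measurable_dotp b) mX). Qed.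

Lemma measurable_response : measurable_fun setT Y.
Proof. by apply: measurable_funD => //; exact: measurable_dotpX. Qed.

Lemma measurable_pairXY : measurable_fun setT (fun w => (X w, Y w) : (rVb R p * R)%type).
Proof. by apply: measurable_fun_pair => //; exact: measurable_response. Qed.

Lemma ae_enormX : {ae P0, forall w, enorm (X w) <= B}.
Proof.
have mE : measurable [set w | enorm (X w) <= B].
  by rewrite -[X in measurable X]setTI; exact: (mX measurableT (@measurable_enorm_le R p B)).
exists (~` [set w | enorm (X w) <= B]); split => //; first exact: measurableC.
by rewrite probability_setC// XB subee.
Qed.

(** Envelope bounds hold only where |X| <= B, an event of probability one. *)
Lemma ae_integral_le (g h : Om0 -> R) : measurable_fun setT g -> measurable_fun setT h ->
  (forall w, 0 <= g w) -> (forall w, 0 <= h w) ->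
  (forall w, enorm (X w) <= B -> g w <= h w) ->
  (\int[P0]_w (g w)%:E <= \int[P0]_w (h w)%:E)%E.
Proof.
move=> mg mh g0 h0 gh; apply: ae_ge0_le_integral => //.
- by move=> w _; rewrite lee_fin.
- exact/measurable_EFinP.
- by move=> w _; rewrite lee_fin.
- exact/measurable_EFinP.
- by apply: filterS ae_enormX => w wB _; rewrite lee_fin gh.
Qed.

Lemma ae_integrable (g h : Om0 -> R) : measurable_fun setT g -> P0.-integrable setT (EFin \o h) ->
  (forall w, enorm (X w) <= B -> `|g w| <= h w) -> P0.-integrable setT (EFin \o g).
Proof.
move=> mg ih gh; apply/integrableP; split; first exact/measurable_EFinP.
have mh : measurable_fun setT h by apply/measurable_EFinP; exact: measurable_int ih.
case/integrableP : ih => _; apply: le_lt_trans => /=.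
apply: ae_integral_le => [||w|w|w wB] //.
- exact: measurableT_comp.
- exact: measurableT_comp.
- exact: le_trans (gh w wB) (ler_norm _).
Qed.

Lemma ge0_integral_noise (g : R -> \bar R) : measurable_fun setT g -> (forall t, (0 <= g t)%E) ->
  (\int[P0]_w g (eps w) = \int[mu]_t (g t * (f t)%:E))%E.
Proof.
move=> mg g0.
exact: (@ge0_integral_density R _ _ Om0 (measurableTypeR R) P0 mu eps f g meps mf (fun t => ltW (f0 t)) law_eps mg g0).
Qed.

(** Given [X], the response is the noise translated by [dotp beta0 (X w)]: independence freezes [X],
    and translation invariance moves the shift into the density. *)
Lemma ge0_integral_model (psi : (rVb R p * R)%type -> \bar R) :
  measurable_fun setT psi -> (forall z, (0 <= psi z)%E) ->
  (\int[P0]_w psi (X w, Y w) =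
   \int[P0]_w \int[mu]_y (psi (X w, y) * (f (y - dotp beta0 (X w)))%:E))%E.
Proof.
move=> mpsi psi0.
pose phi (z : (rVb R p * R)%type) := psi (z.1, dotp beta0 z.1 + z.2).
have md1 : measurable_fun setT (fun z : (rVb R p * R)%type => dotp beta0 z.1).
  exact: (measurableT_comp (measurable_dotp beta0)).
have mphi : measurable_fun setT phi.
  apply: (measurableT_comp mpsi); apply: measurable_fun_pair => //.
  exact: measurable_funD.
rewrite -[LHS]/(\int[P0]_w phi (X w, eps w))%E.
rewrite (@integral_indep_pair _ _ _ _ _ (rVb R p) R P0 X eps)//.
apply: eq_integral => w _.
have mXw : measurable_fun setT (fun t : R => (X w, t) : (rVb R p * R)%type) by exact: measurable_fun_pair.
have mphiw : measurable_fun setT (fun t => phi (X w, t)) by exact: (measurableT_comp mphi mXw).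
rewrite (ge0_integral_noise mphiw (fun t => psi0 _)).
rewrite (@ge0_integral_shift R (fun t => phi (X w, t) * (f t)%:E)%E (dotp beta0 (X w))); last 2 first.
- by apply: emeasurable_funM => //; exact/measurable_EFinP.
- by move=> t; apply: mule_ge0; [exact: psi0|rewrite lee_fin; exact/ltW].
by apply: eq_integral => y _; rewrite /phi/= addrC subrK.
by move=> z; exact: psi0.
Qed.

Lemma measurable_model_density : measurable_fun setT
  (fun z : (Om0 * R)%type => f (z.2 - dotp beta0 (X z.1))).
Proof.
apply: (measurableT_comp mf); apply: measurable_funB => //.
exact: (measurableT_comp (measurable_dotpX beta0)).
Qed.

(** Puts the response outermost, the order of integration in [ell]. *)
Lemma ge0_integral_model_swap (psi : (rVb R p * R)%type -> \bar R) :
  measurable_fun setT psi -> (forall z, (0 <= psi z)%E) ->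
  (\int[P0]_w psi (X w, Y w) =
   \int[mu]_y \int[P0]_w (psi (X w, y) * (f (y - dotp beta0 (X w)))%:E))%E.
Proof.
move=> mpsi psi0; rewrite ge0_integral_model//.
pose k (z : (Om0 * R)%type) := (psi (X z.1, z.2) * (f (z.2 - dotp beta0 (X z.1)))%:E)%E.
have mk : measurable_fun setT k.
  apply: emeasurable_funM; last by apply/measurable_EFinP; exact: measurable_model_density.
  apply: (measurableT_comp mpsi); apply: measurable_fun_pair => //.
  exact: (measurableT_comp mX).
apply: (@fubini_tonelli _ _ Om0 _ R P0 mu k mk).
by move=> z; rewrite mule_ge0// lee_fin ltW.
Qed.

Lemma integral_model (psi : (rVb R p * R)%type -> R) : measurable_fun setT psi ->
  P0.-integrable setT (fun w => (psi (X w, Y w))%:E) ->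
  (\int[P0]_w (psi (X w, Y w))%:E =
   \int[mu]_y \int[P0]_w (psi (X w, y) * f (y - dotp beta0 (X w)))%:E)%E.
Proof.
move=> mpsi /integrableP[_ ipsi].
pose k (z : (Om0 * R)%type) := (psi (X z.1, z.2) * f (z.2 - dotp beta0 (X z.1)))%:E.
have mX1 : measurable_fun setT (fun z : (Om0 * R)%type => (X z.1, z.2) : (rVb R p * R)%type).
  by apply: measurable_fun_pair => //; exact: (measurableT_comp mX).
have mk : measurable_fun setT k.
  apply/measurable_EFinP; apply: measurable_funM; last exact: measurable_model_density.
  exact: (measurableT_comp mpsi mX1).
have mEpsi : measurable_fun setT (fun z => (psi z)%:E) by exact/measurable_EFinP.
have ik : (P0 \x mu)%E.-integrable setT k.
  apply/integrable12ltyP => //.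
  rewrite (_ : (\int[P0]_x _)%E = (\int[P0]_w `|(psi (X w, Y w))%:E|)%E)//.
  rewrite (ge0_integral_model (psi := fun z => `|(psi z)%:E|%E))//; last exact: measurableT_comp.
  apply: eq_integral => w _; apply: eq_integral => y _.
  by rewrite /k/= normrM EFinM (ger0_norm (ltW (f0 _))).
rewrite -[RHS]/(\int[mu]_y fubini_G P0 k y)%E integral21_prod_meas1// integralE [in RHS]integralE.
have posM (a b : R) : 0 <= b -> (maxe (a * b)%:E 0 = maxe a%:E 0 * b%:E)%E.
  by move=> b0; rewrite -[0%E]/(0%:E) -!EFin_max -EFinM maxr_pMl// mul0r.
congr (_ - _)%E.
- transitivity (\int[P0]_w ((fun z => (psi z)%:E)^\+%E (X w, Y w)))%E.
    by apply: eq_integral => w _; rewrite !funeposE.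
  rewrite ge0_integral_model//; last exact: measurable_funepos.
  rewrite fubini_tonelli1//; last exact: measurable_funepos.
  apply: eq_integral => w _; apply: eq_integral => y _.
  by rewrite !funeposE /k posM// ltW.
- transitivity (\int[P0]_w ((fun z => (psi z)%:E)^\-%E (X w, Y w)))%E.
    by apply: eq_integral => w _; rewrite !funenegE.
  rewrite ge0_integral_model//; last exact: measurable_funeneg.
  rewrite fubini_tonelli1//; last exact: measurable_funeneg.
  apply: eq_integral => w _; apply: eq_integral => y _.
  by rewrite [in RHS]funenegE /k -EFinN -mulNr (posM _ _ (ltW (f0 _))) funenegE EFinN.
Qed.

Lemma measurable_envelope A : measurable_fun setT (Q A).
Proof.
apply: (measurableT_comp (f := @powR R ^~ alpha)) => //.
by apply: measurable_funD => //; exact: measurableT_comp.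
Qed.

Lemma envelope_ge0 A y : 0 <= Q A y. Proof. exact: powR_ge0. Qed.

Lemma envelope_ge_norm (A y : R) : 1 <= A -> `|y| <= Q A y.
Proof.
move=> A1; have yA : 1 <= `|y| + A by rewrite (le_trans A1)// lerDr.
apply: (@le_trans _ _ ((`|y| + A) `^ 1)).
  by rewrite powRr1 ?(le_trans ler01 yA)// lerDl (le_trans ler01).
by rewrite ler_powR.
Qed.

Lemma le_envelope (A y z : R) : `|z| <= `|y| + A -> `|z| `^ alpha <= Q A y.
Proof.
by move=> zy; rewrite ge0_ler_powR ?nnegrE ?(ltW alpha0)// (le_trans _ zy).
Qed.

Lemma envelope_sqr_lty A : 1 <= A -> (\int[P0]_w (Q A (Y w) ^+ 2)%:E < +oo)%E.
Proof.
(* |Y| <= |beta0| B + |eps| almost surely: the shift is absorbed into the constant of the envelope,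
   which leaves a moment of the noise. *)
move=> A1; pose A' := enorm beta0 * B + A.
have A'1 : 1 <= A' by rewrite (le_trans A1)// lerDr mulr_ge0 ?enorm_ge0// ltW.
have mq A2 : measurable_fun setT (fun t => Q A2 t ^+ 2).
  by apply: measurable_funX; exact: measurable_envelope.
apply: (@le_lt_trans _ _ (\int[P0]_w (Q A' (eps w) ^+ 2)%:E)%E).
  apply: ae_integral_le => [||w|w|w wB]; rewrite ?sqr_ge0//.
  - exact: (measurableT_comp (mq A) measurable_response).
  - exact: (measurableT_comp (mq A') meps).
  rewrite lerXn2r ?nnegrE ?envelope_ge0// ge0_ler_powR ?nnegrE ?(ltW alpha0)//.
  - by rewrite addr_ge0// (le_trans ler01).
  - by rewrite addr_ge0// (le_trans ler01).
  have := ler_normD (dotp beta0 (X w)) (eps w); have := dotp_le_enorm beta0 (X w).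
  by have := ler_wpM2l (enorm_ge0 beta0) wB; rewrite /response /A'; lra.
rewrite (ge0_integral_noise (g := fun t => (Q A' t ^+ 2)%:E)).
- exact: (noise_moment_lty alpha1 d_gt0 if1 A'1).
- exact/measurable_EFinP.
- by move=> t; rewrite lee_fin sqr_ge0.
Qed.

(** * The mixture density, bounds on both logarithms, and [ell] as an expectation *)

(** The density that the response would have if [b] were the true parameter; it is convertible to
    the inner integral of [ell], and at [beta0] to [fY]. *)
Definition mixture b y := fine (lebint (fun x => (f (y - dotp b x) * fX x)%:E)).
Local Notation h := mixture.

Lemma residual_le (r : R) b (x : 'rV[R]_p) (y : R) : enorm b <= r -> enorm x <= B ->
  `|y - dotp b x| <= `|y| + (r * B + 1).
Proof.
move=> br xB; have := ler_normB y (dotp b x); have := dotp_le_enorm b x.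
by have := ler_pM (enorm_ge0 b) (enorm_ge0 x) br xB; lra.
Qed.

Lemma fdens_residual_ge (r : R) b (x : 'rV[R]_p) (y : R) : enorm b <= r -> enorm x <= B ->
  c * expR (- (kap * Q (r * B + 1) y)) <= f (y - dotp b x).
Proof. by move=> br xB; apply: (@fdens_ge R alpha d alpha1 if1); exact: residual_le. Qed.

Lemma measurable_fdens_residual b : measurable_fun setT
  (fun z : (rVb R p * R)%type => f (z.2 - dotp b z.1)).
Proof.
apply: (measurableT_comp mf); apply: measurable_funB => //.
exact: (measurableT_comp (measurable_dotp b)).
Qed.

Lemma measurable_fdens_X b y : measurable_fun setT (fun w => f (y - dotp b (X w))).
Proof. by apply: (measurableT_comp mf); apply: measurable_funB => //; exact: measurable_dotpX. Qed.

Lemma integrable_fdens_X b y : P0.-integrable setT (EFin \o (fun w => f (y - dotp b (X w)))).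
Proof.
apply: (ae_integrable (h := fun=> c)); first exact: measurable_fdens_X.
- exact: finite_measure_integrable_cst.
- by move=> w _; rewrite ger0_norm ?(ltW (f0 _)).
Qed.

Lemma mixtureE b y : (\int[P0]_w (f (y - dotp b (X w)))%:E = (h b y)%:E)%E.
Proof.
rewrite /mixture; have mg : measurable_fun setT (fun x : rVb R p => (f (y - dotp b x))%:E).
  apply/measurable_EFinP; apply: (measurableT_comp mf).
  by apply: measurable_funB => //; exact: measurable_dotp.
rewrite -(ge0_lebint_density mX fX0 mfX lawX mg) => [|x]; last by rewrite lee_fin ltW.
have -> : (fun x => (f (y - dotp b x))%:E * (fX x)%:E)%E = (fun x => (f (y - dotp b x) * fX x)%:E).
  by apply/funext => x; rewrite EFinM.
rewrite fineK//; have := integrable_fin_num measurableT (integrable_fdens_X b y).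
rewrite /comp -(ge0_lebint_density mX fX0 mfX lawX mg) => [|x]; last by rewrite lee_fin ltW.
by under eq_fun do rewrite -EFinM.
Qed.

Lemma mixture_le b y : h b y <= c.
Proof.
rewrite -lee_fin -mixtureE; apply: (@le_trans _ _ (\int[P0]_w c%:E)%E).
  apply: ge0_le_integral => //.
  - by move=> w _; rewrite lee_fin ltW.
  - by apply/measurable_EFinP; exact: measurable_fdens_X.
  - by move=> w _; rewrite lee_fin fc.
by rewrite integral_cst// [X in (_ * X)%E]probability_setT mule1.
Qed.

Lemma mixture_ge (r : R) b y : enorm b <= r -> c * expR (- (kap * Q (r * B + 1) y)) <= h b y.
Proof.
move=> br; rewrite -lee_fin -mixtureE.
have e0 : 0 <= c * expR (- (kap * Q (r * B + 1) y)) by rewrite mulr_ge0 ?expR_ge0// ltW.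
apply: (@le_trans _ _ (\int[P0]_w (c * expR (- (kap * Q (r * B + 1) y)))%:E)%E).
  by rewrite integral_cst// [X in (_ * X)%E]probability_setT mule1.
apply: ae_integral_le => [||w|w|w wB].
- exact: measurable_cst.
- exact: measurable_fdens_X.
- exact: e0.
- exact/ltW/f0.
- exact: fdens_residual_ge.
Qed.

Lemma mixture_gt0 b y : 0 < h b y.
Proof. by apply: lt_le_trans (mixture_ge y (lexx (enorm b))); rewrite mulr_gt0 ?expR_gt0. Qed.

Lemma measurable_mixture b : measurable_fun setT (h b).
Proof.
have -> : h b = (fun y => fine (fubini_G P0 (fun z : (Om0 * R)%type => (f (z.2 - dotp b (X z.1)))%:E) y)).
  by apply/funext => y; rewrite /fubini_G mixtureE.
apply: measurableT_comp => //.
apply: measurable_fun_fubini_tonelli_G.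
- apply/measurable_EFinP; apply: (measurableT_comp mf); apply: measurable_funB => //.
  exact: (measurableT_comp (measurable_dotpX b)).
- by move=> z; rewrite lee_fin ltW.
Qed.

(** |ln u| <= |ln c| + kap Q when c exp(- kap Q) <= u <= c; since Q >= 1 the constant term is
    absorbed as well. *)
Definition ln_bound := `|ln c| + kap.
Local Notation M := ln_bound.

Lemma ln_bound_ge0 : 0 <= M. Proof. by rewrite addr_ge0// ltW. Qed.

Lemma envelope_ge1 (A y : R) : 1 <= A -> 1 <= Q A y.
Proof.
move=> A1; have E1 : 1 `^ alpha = 1 :> R by rewrite powR1.
rewrite -[leLHS]E1 ge0_ler_powR ?nnegrE ?(ltW alpha0)//.
  by rewrite addr_ge0// (le_trans ler01).
by rewrite (le_trans A1)// lerDr.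
Qed.

Lemma norm_ln_le (A y u : R) : 1 <= A -> c * expR (- (kap * Q A y)) <= u -> u <= c -> `|ln u| <= M * Q A y.
Proof.
move=> A1 ul uc; have e0 : 0 < c * expR (- (kap * Q A y)) by rewrite mulr_gt0 ?expR_gt0.
have u0 : 0 < u by exact: lt_le_trans ul.
have h1 : ln u <= ln c by rewrite ler_ln.
have h2 : ln c - kap * Q A y <= ln u.
  by rewrite -[X in _ - X]opprK opprK -[- (kap * _)]expRK -lnM ?posrE ?expR_gt0// ler_ln.
have Q1 := envelope_ge1 y A1.
have : `|ln c| * 1 <= `|ln c| * Q A y by rewrite ler_wpM2l.
have := ler_norm (ln c); have := ler_norm (- ln c); rewrite normrN.
have : 0 <= kap * Q A y by rewrite mulr_ge0 ?envelope_ge0// ltW.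
by rewrite /ln_bound ler_norml; lra.
Qed.

Lemma radius_ge1 (r : R) : 0 <= r -> 1 <= r * B + 1.
Proof. by move=> r0; rewrite lerDr mulr_ge0// ltW. Qed.

Lemma norm_ln_mixture_le (r : R) b y : enorm b <= r -> `|ln (h b y)| <= M * Q (r * B + 1) y.
Proof.
move=> br; apply: norm_ln_le; [|exact: mixture_ge|exact: mixture_le].
by apply: radius_ge1; exact: le_trans (enorm_ge0 b) br.
Qed.

Lemma norm_ln_fdens_le (r : R) b (x : 'rV[R]_p) (y : R) : enorm b <= r -> enorm x <= B ->
  `|ln (f (y - dotp b x))| <= M * Q (r * B + 1) y.
Proof.
move=> br xB; apply: norm_ln_le; [|exact: fdens_residual_ge|exact: fc].
by apply: radius_ge1; exact: le_trans (enorm_ge0 b) br.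
Qed.

Lemma sqr_lty_integrable (g : Om0 -> R) : measurable_fun setT g ->
  (\int[P0]_w (g w ^+ 2)%:E < +oo)%E -> P0.-integrable setT (EFin \o g).
Proof.
move=> mg g2; apply: (ae_integrable (h := fun w => 1 + g w ^+ 2)) => //.
  rewrite (_ : EFin \o _ = (fun w => 1 + (g w ^+ 2)%:E)%E); last by apply/funext => w /=; rewrite EFinD.
  apply: integrableD => //; first exact: finite_measure_integrable_cst.
  apply/integrableP; split; first by apply/measurable_EFinP; exact: measurable_funX.
  by under eq_integral do rewrite gee0_abs ?lee_fin ?sqr_ge0//.
move=> w _; rewrite -[X in _ <= _ + X]real_normK ?num_real//.
by have := sqr_ge0 (`|g w| - 1); nra.
Qed.

Lemma envelope_bound_sqr_lty (A K : R) (g : Om0 -> R) : 1 <= A -> measurable_fun setT g ->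
  (forall w, enorm (X w) <= B -> `|g w| <= K * Q A (Y w)) -> (\int[P0]_w (g w ^+ 2)%:E < +oo)%E.
Proof.
move=> A1 mg gQ; have mQ : measurable_fun setT (fun w => Q A (Y w)).
  exact: (measurableT_comp (measurable_envelope A) measurable_response).
apply: (@le_lt_trans _ _ (\int[P0]_w (K ^+ 2 * Q A (Y w) ^+ 2)%:E)%E).
  apply: ae_integral_le => [||w|w|w wB].
  - exact: measurable_funX.
  - by apply: measurable_funM => //; exact: measurable_funX.
  - exact: sqr_ge0.
  - exact: mulr_ge0 (sqr_ge0 _) (sqr_ge0 _).
  rewrite -exprMn -[leLHS]real_normK ?num_real// lerXn2r ?nnegrE ?gQ//.
  exact: le_trans (normr_ge0 _) (gQ w wB).
under eq_integral do rewrite EFinM.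
rewrite ge0_integralZl ?lee_fin ?sqr_ge0//.
- by rewrite lte_mul_pinfty ?lee_fin ?sqr_ge0//; exact: envelope_sqr_lty.
- by apply/measurable_EFinP; exact: measurable_funX.
- by move=> w _; rewrite lee_fin sqr_ge0.
Qed.

Lemma measurable_ln_mixture b : measurable_fun setT (fun y => ln (h b y)).
Proof. by apply: measurableT_comp => //; exact: measurable_mixture. Qed.

Lemma measurable_ln_fdens_residual b : measurable_fun setT
  (fun z : (rVb R p * R)%type => ln (f (z.2 - dotp b z.1))).
Proof. by apply: measurableT_comp => //; exact: measurable_fdens_residual. Qed.

Lemma ln_mixture_sqr_lty b : (\int[P0]_w (ln (h b (Y w)) ^+ 2)%:E < +oo)%E.
Proof.
apply: (@envelope_bound_sqr_lty (enorm b * B + 1) M).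
- exact: radius_ge1 (enorm_ge0 b).
- exact: (measurableT_comp (measurable_ln_mixture b) measurable_response).
- by move=> w _; exact: norm_ln_mixture_le.
Qed.

Lemma ln_fdens_sqr_lty b : (\int[P0]_w (ln (f (Y w - dotp b (X w))) ^+ 2)%:E < +oo)%E.
Proof.
apply: (@envelope_bound_sqr_lty (enorm b * B + 1) M).
- exact: radius_ge1 (enorm_ge0 b).
- exact: (measurableT_comp (measurable_ln_fdens_residual b) measurable_pairXY).
- by move=> w wB; exact: norm_ln_fdens_le.
Qed.

Lemma integrable_ln_mixture b : P0.-integrable setT (EFin \o (fun w => ln (h b (Y w)))).
Proof.
apply: sqr_lty_integrable; last exact: ln_mixture_sqr_lty.
exact: (measurableT_comp (measurable_ln_mixture b) measurable_response).
Qed.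

Lemma integrable_ln_fdens b : P0.-integrable setT (EFin \o (fun w => ln (f (Y w - dotp b (X w))))).
Proof.
apply: sqr_lty_integrable; last exact: ln_fdens_sqr_lty.
exact: (measurableT_comp (measurable_ln_fdens_residual b) measurable_pairXY).
Qed.

Definition ell_unmatched b := fine (\int[P0]_w (ln (h b (Y w)))%:E)%E.
Definition ell_matched b := fine (\int[P0]_w (ln (f (Y w - dotp b (X w))))%:E)%E.

Lemma ell_unmatchedE b : (\int[P0]_w (ln (h b (Y w)))%:E = (ell_unmatched b)%:E)%E.
Proof. by rewrite fineK//; exact: integrable_fin_num (integrable_ln_mixture b). Qed.

Lemma ell_matchedE b : (\int[P0]_w (ln (f (Y w - dotp b (X w))))%:E = (ell_matched b)%:E)%E.
Proof. by rewrite fineK//; exact: integrable_fin_num (integrable_ln_fdens b). Qed.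

(** Both integrals in [ell] are expectations under the model, finite by the envelope, so the limit
    can be handled as a real number from here on. *)
Lemma ellE lambda b : ell alpha d lambda fX beta0 b =
  ((1 + lambda)^-1 * ell_unmatched b + lambda / (1 + lambda) * ell_matched b)%:E.
Proof.
rewrite EFinD !EFinM -ell_unmatchedE -ell_matchedE /ell; congr (_ * _ + _ * _)%E.
- rewrite (integral_model (psi := fun z => ln (h b z.2))); last 2 first.
  + exact: (measurableT_comp (measurable_ln_mixture b)).
  + exact: integrable_ln_mixture.
  apply: eq_integral => y _.
  rewrite -[RHS]/(\int[P0]_w (ln (h b y) * f (y - dotp beta0 (X w)))%:E)%E.
  under [RHS]eq_integral do rewrite EFinM.
  by rewrite integralZl//; [rewrite mixtureE EFinM|exact: integrable_fdens_X].
- rewrite (integral_model (psi := fun z => ln (f (z.2 - dotp b z.1)))); last 2 first.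
  + exact: measurable_ln_fdens_residual.
  + exact: integrable_ln_fdens.
  apply: eq_integral => y _.
  have mg : measurable_fun setT (fun x : rVb R p => ln (f (y - dotp b x)) * f (y - dotp beta0 x)).
    apply: measurable_funM.
      apply: measurableT_comp => //; apply: (measurableT_comp mf).
      by apply: measurable_funB => //; exact: measurable_dotp.
    apply: (measurableT_comp mf).
    by apply: measurable_funB => //; exact: measurable_dotp.
  apply: (lebint_density mX fX0 mfX lawX mg).
  apply: (ae_integrable (h := fun=> M * Q (enorm b * B + 1) y * c)).
  + exact: (measurableT_comp mg mX).
  + exact: finite_measure_integrable_cst.
  + move=> w wB; rewrite normrM ler_pM// ?norm_ln_fdens_le//.
    by rewrite ger0_norm ?(ltW (f0 _)).
Qed.

(* Identifiability *)
Opaque mixture ell_unmatched ell_matched.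

(* From [ln q <= q - 1], with equality only at [q = 1]. *)
Lemma gibbs (q : Om0 -> R) : measurable_fun setT q -> (forall w, 0 < q w) ->
  (\int[P0]_w (q w)%:E <= 1)%E -> P0.-integrable setT (EFin \o (fun w => ln (q w))) ->
  (\int[P0]_w (ln (q w))%:E <= 0)%E /\
  ((0 <= \int[P0]_w (ln (q w))%:E)%E -> {ae P0, forall w, q w = 1}).
Proof.
move=> mq q0 q1 ilnq.
have iq : P0.-integrable setT (EFin \o q).
  apply/integrableP; split; first exact/measurable_EFinP.
  under eq_integral do rewrite /= ger0_norm ?(ltW (q0 _))//.
  by apply: le_lt_trans q1 _; rewrite ltry.
have i1 : P0.-integrable setT (EFin \o (fun=> 1 : R)) by exact: finite_measure_integrable_cst.
have iq1 : P0.-integrable setT (EFin \o (fun w => q w - 1)).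
  by have := integrableB measurableT iq i1; apply: eq_integrable.
pose D w := q w - 1 - ln (q w).
have D0 w : 0 <= D w.
  have := @le_ln1Dx R (q w - 1); rewrite subrKC /D subr_ge0; apply.
  by rewrite ltrBrDr addNr.
have ID : (\int[P0]_w (D w)%:E = \int[P0]_w (q w)%:E - 1 - \int[P0]_w (ln (q w))%:E)%E.
  rewrite /D; under eq_integral do rewrite EFinB.
  rewrite (integralB_EFin measurableT iq1 ilnq); congr (_ - _)%E.
  under eq_integral do rewrite EFinB.
  rewrite (integralB_EFin measurableT iq i1) integral_cst//; congr (_ - _)%E.
  by rewrite [X in (_ * X)%E]probability_setT mule1.
have /fineK fq := integrable_fin_num measurableT iq.
have /fineK fl := integrable_fin_num measurableT ilnq.
have ID0 : (0 <= \int[P0]_w (D w)%:E)%E by apply: integral_ge0 => w _; rewrite lee_fin.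
rewrite -[X in (X <= 1)%E]fq lee_fin in q1.
rewrite ID -[X in (X - 1 - _)%E]fq -[X in (_ - X)%E]fl -!EFinB lee_fin in ID0.
rewrite -[X in (X <= 0)%E]fl -[X in (0 <= X)%E]fl !lee_fin; split; first lra.
move=> l0; have mD : measurable_fun setT (EFin \o D).
  apply/measurable_EFinP; apply: measurable_funB; last exact: measurableT_comp.
  exact: measurable_funB.
have : (\int[P0]_w `|(EFin \o D) w| = 0)%E.
  under eq_integral do rewrite /= ger0_norm//.
  by rewrite ID -[X in (X - 1 - _)%E]fq -[X in (_ - X)%E]fl -!EFinB; congr EFin; lra.
move/(ae_eq_integral_abs P0 measurableT mD); apply: filterS => w /(_ Logic.I) /= [Dw].
apply/eqP; rewrite -ln_eq0//; apply: contraT => /expR_gt1Dx; rewrite lnK ?posrE//.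
by move: Dw; rewrite /D; lra.
Qed.

Lemma integral_shifted_noise a : (\int[mu]_y (f (y - a))%:E = 1)%E.
Proof.
rewrite -[RHS]if1; apply/esym/(@ge0_integral_shift R (fun t => (f t)%:E)).
- exact/measurable_EFinP.
- by move=> t; rewrite lee_fin; exact/ltW.
Qed.

Lemma integral_mixture b : (\int[mu]_y (h b y)%:E = 1)%E.
Proof.
under eq_integral do rewrite -mixtureE.
pose k (z : (Om0 * R)%type) := (f (z.2 - dotp b (X z.1)))%:E.
have mk : measurable_fun setT k.
  apply/measurable_EFinP; apply: (measurableT_comp mf); apply: measurable_funB => //.
  exact: (measurableT_comp (measurable_dotpX b)).
transitivity (\int[P0]_w \int[mu]_y k (w, y))%E.
  apply/esym/(@fubini_tonelli _ _ Om0 _ R P0 mu k mk).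
  by move=> z; rewrite lee_fin; exact/ltW.
transitivity (\int[P0]_w (cst 1%E w))%E.
  apply: eq_integral => w _; exact (integral_shifted_noise (dotp b (X w))).
by rewrite integral_cst// [X in (_ * X)%E]probability_setT mule1.
Qed.

Lemma ell_unmatched_le b : ell_unmatched b <= ell_unmatched beta0.
Proof.
have mh b' : measurable_fun setT (fun w => h b' (Y w)).
  exact: (measurableT_comp (measurable_mixture b') measurable_response).
(* The likelihood ratio, written as an exponential so that its positivity and logarithm are
   immediate; its mean under the model is the total mass of [mixture b]. *)
pose ratio y := expR (ln (h b y) - ln (h beta0 y)).
have ratioM y : ratio y * h beta0 y = h b y.
  exact (expR_lnB_mul (mixture_gt0 b y) (mixture_gt0 beta0 y)).
pose q w := ratio (Y w).
have mr : measurable_fun setT ratio.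
  apply: measurableT_comp; first exact: measurable_expR.
  by apply: measurable_funB; exact: measurable_ln_mixture.
have q0 w : 0 < q w by exact: expR_gt0.
have lnq w : ln (q w) = ln (h b (Y w)) - ln (h beta0 (Y w)) by exact: expRK.
have ilnq : P0.-integrable setT (EFin \o (fun w => ln (q w))).
  have := integrableB measurableT (integrable_ln_mixture b) (integrable_ln_mixture beta0).
  by apply: eq_integrable => // w _; rewrite /= lnq.
have Iq : (\int[P0]_w (q w)%:E = 1)%E.
  rewrite (ge0_integral_model_swap (psi := fun z => (ratio z.2)%:E)); last 2 first.
  - by apply/measurable_EFinP; exact: (measurableT_comp mr).
  - by move=> z; rewrite lee_fin expR_ge0.
  rewrite -(integral_mixture b); apply: eq_integral => y _ /=.
  rewrite ge0_integralZl ?lee_fin ?expR_ge0//.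
  - by rewrite mixtureE -EFinM ratioM.
  - by apply/measurable_EFinP; exact: measurable_fdens_X.
  - by move=> w _; rewrite lee_fin; exact/ltW.
have [|le0 _] := gibbs (measurableT_comp mr measurable_response) q0 _ ilnq; first by rewrite Iq.
have : (\int[P0]_w (ln (q w))%:E = (ell_unmatched b)%:E - (ell_unmatched beta0)%:E)%E.
  under eq_integral do rewrite lnq EFinB.
  apply: (etrans (integralB_EFin measurableT (integrable_ln_mixture b) (integrable_ln_mixture beta0))).
  exact (f_equal2 (fun u v => u - v)%E (ell_unmatchedE b) (ell_unmatchedE beta0)).
by move=> E; move: le0; rewrite [X in (X <= _)%E]E -EFinB lee_fin subr_le0.
Qed.

(** Given [X] the response has a density, so a set whose sections over almost every [X] are at most
    one point is null. This expresses that the noise is no function of [X]. *)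
Lemma model_null (S : set (rVb R p * R)%type) (s : Om0 -> R) : measurable S ->
  {ae P0, forall w, forall y, S (X w, y) -> y = s w} -> P0 [set w | S (X w, Y w)] = 0%E.
Proof.
move=> mS aeS.
have mS1 : measurable_fun setT (fun z => (\1_S z : R)%:E).
  by apply/measurable_EFinP; exact: measurable_indic.
have mSw : measurable [set w | S (X w, Y w)].
  by rewrite -[X in measurable X]setTI; exact: (measurable_pairXY measurableT mS).
have -> : P0 [set w | S (X w, Y w)] = (\int[P0]_w (\1_S (X w, Y w) : R)%:E)%E.
  rewrite -[RHS]/(\int[P0]_w (\1_[set w | S (X w, Y w)] w : R)%:E)%E.
  by rewrite integral_indic// setIT.
rewrite (ge0_integral_model_swap (psi := fun z => (\1_S z : R)%:E))//.
pose k (z : (Om0 * R)%type) := ((\1_S (X z.1, z.2) : R)%:E * (f (z.2 - dotp beta0 (X z.1)))%:E)%E.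
have mk : measurable_fun setT k.
  apply: emeasurable_funM; last by apply/measurable_EFinP; exact: measurable_model_density.
  apply: (measurableT_comp mS1); apply: measurable_fun_pair => //.
  exact: (measurableT_comp mX).
have k0' z : (0 <= k z)%E by rewrite mule_ge0// lee_fin; exact/ltW.
rewrite -[LHS]/(\int[mu]_y \int[P0]_w k (w, y))%E -(@fubini_tonelli _ _ Om0 _ R P0 mu k mk k0').
transitivity (\int[P0]_w (cst 0%E w))%E; last by rewrite integral0.
apply: ae_eq_integral => //.
  exact: measurable_fun_integral.
apply: filterS aeS => w Sw _.
transitivity (\int[mu]_y (cst 0%E y))%E; last by rewrite integral0.
apply: ae_eq_integral; [exact: measurableT| |exact: measurable_cst|].
  by have := measurableT_comp mk (measurable_fun_pair (measurable_cst w) (@measurable_id _ R setT)).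
exists [set s w]; split; [exact: measurable_set1|exact: lebesgue_measure_set1|].
move=> y /= nk; apply: contrapT => ys; apply: nk => _.
by rewrite /k /= indicE memNset ?mul0e// => /Sw.
Qed.

Lemma ell_matched_lt b : (forall v : 'rV[R]_p, v != 0 -> P0 [set w | dotp v (X w) = 0] = 0%E) ->
  b != beta0 -> ell_matched b < ell_matched beta0.
Proof.
move=> Xv bb0.
pose ratio (z : (rVb R p * R)%type) :=
  expR (ln (f (z.2 - dotp b z.1)) - ln (f (z.2 - dotp beta0 z.1))).
have ratioM z : ratio z * f (z.2 - dotp beta0 z.1) = f (z.2 - dotp b z.1).
  exact (expR_lnB_mul (f0 (z.2 - dotp b z.1)) (f0 (z.2 - dotp beta0 z.1))).
pose q w := ratio (X w, Y w).
have mr : measurable_fun setT ratio.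
  apply: measurableT_comp; first exact: measurable_expR.
  by apply: measurable_funB; exact: measurable_ln_fdens_residual.
have q0 w : 0 < q w by exact: expR_gt0.
have lnq w : ln (q w) = ln (f (Y w - dotp b (X w))) - ln (f (Y w - dotp beta0 (X w))) by exact: expRK.
have ilnq : P0.-integrable setT (EFin \o (fun w => ln (q w))).
  have := integrableB measurableT (integrable_ln_fdens b) (integrable_ln_fdens beta0).
  by apply: eq_integrable => // w _; rewrite /= lnq.
have Iq : (\int[P0]_w (q w)%:E = 1)%E.
  rewrite (ge0_integral_model_swap (psi := fun z => (ratio z)%:E)); last 2 first.
  - exact/measurable_EFinP.
  - by move=> z; rewrite lee_fin expR_ge0.
  rewrite -(integral_mixture b); apply: eq_integral => y _ /=.
  by rewrite -mixtureE; apply: eq_integral => w _; rewrite -EFinM ratioM.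
have [|le0 eq1] := gibbs (measurableT_comp mr measurable_pairXY) q0 _ ilnq; first by rewrite Iq.
have E : (\int[P0]_w (ln (q w))%:E = (ell_matched b)%:E - (ell_matched beta0)%:E)%E.
  under eq_integral do rewrite lnq EFinB.
  apply: (etrans (integralB_EFin measurableT (integrable_ln_fdens b) (integrable_ln_fdens beta0))).
  exact (f_equal2 (fun u v => u - v)%E (ell_matchedE b) (ell_matchedE beta0)).
rewrite ltNge; apply/negP => le1.
have {}eq1 : {ae P0, forall w, q w = 1}.
  by apply: eq1; rewrite [X in (_ <= X)%E]E -EFinB lee_fin subr_ge0.
pose S : set (rVb R p * R)%type := [set z | f (z.2 - dotp b z.1) - f (z.2 - dotp beta0 z.1) = 0].
have mS : measurable S.
  rewrite -[S]setTI; have := measurable_funB (measurable_fdens_residual b) (measurable_fdens_residual beta0).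
  by move=> /(_ measurableT _ (measurable_set1 0)).
have inj s t : f s = f t -> `|s| = `|t|.
  move=> fst; have : ln (f s) = ln (f t) by rewrite fst.
  rewrite !(ln_fdens if1) => /addrI /oppr_inj /(mulfI (lt0r_neq0 k0)).
  by move/(powR_injective alpha0); apply; rewrite nnegrE.
have null : P0 [set w | S (X w, Y w)] = 0%E.
  (* Equal densities mean that [y] is equidistant from [dotp b (X w)] and [dotp beta0 (X w)]; these
     differ almost surely, so only their midpoint remains. *)
  apply: (model_null (s := fun w => (dotp b (X w) + dotp beta0 (X w)) / 2)) => //.
  have mv : measurable [set w | dotp (b - beta0) (X w) = 0].
    by rewrite -[X in measurable X]setTI; exact: (measurable_dotpX (b - beta0) measurableT (measurable_set1 0)).
  exists [set w | dotp (b - beta0) (X w) = 0]; split => //; first by apply: Xv; rewrite subr_eq0.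
  move=> w /=; apply: contra_notP; rewrite dotpBl => /eqP; rewrite subr_eq0 => nb y.
  move/eqP; rewrite subr_eq0 => /eqP /inj /eqP; rewrite eqr_norm2 => /orP[/eqP e|/eqP e].
    by move: nb; rewrite (oppr_inj (addrI _ e)) eqxx.
  exact (midpoint_of e).
have mSw : measurable [set w | S (X w, Y w)].
  by rewrite -[X in measurable X]setTI; exact: (measurable_pairXY measurableT mS).
(* Almost surely the ratio is 1, and almost surely the two densities differ: the whole space would
   be null. *)
have : {ae P0, forall w : Om0, False}.
  have nS : {ae P0, forall w, ~ S (X w, Y w)}.
    by exists [set w | S (X w, Y w)]; split => // w /= /contrapT.
  apply: filterS2 eq1 nS => w q1; apply; rewrite /S /=; apply/eqP; rewrite subr_eq0; apply/eqP.
  by rewrite -(ratioM (X w, Y w)) -/(q w) q1 mul1r.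
move=> [N [mN PN NT]]; have NT' : N = setT by apply/seteqP; split => // w _; exact: NT.
by move: PN; rewrite NT' probability_setT => /eqP; rewrite onee_eq0.
Qed.

Lemma ell_lt lambda b : 0 < lambda ->
  (forall v : 'rV[R]_p, v != 0 -> P0 [set w | dotp v (X w) = 0] = 0%E) -> b != beta0 ->
  (ell alpha d lambda fX beta0 b < ell alpha d lambda fX beta0 beta0)%E.
Proof.
move=> l0 Xv bb0; have l1 : 0 < 1 + lambda by exact: addr_gt0 ltr01 l0.
rewrite !ellE lte_fin; apply: ler_ltD.
  by apply: ler_wpM2l; [rewrite invr_ge0; exact: ltW|exact: ell_unmatched_le].
by rewrite ltr_pM2l; [exact: ell_matched_lt|exact: divr_gt0].
Qed.

(** * Moments of order [alpha] of projections and of the response *)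

Lemma dotp_moment_gt0 u : (forall v : 'rV[R]_p, v != 0 -> P0 [set w | dotp v (X w) = 0] = 0%E) ->
  u != 0 -> (0 < \int[P0]_w (`|dotp u (X w)| `^ alpha)%:E)%E.
Proof.
move=> Xv u0; rewrite lt_def integral_ge0 ?andbT; last by move=> w _; rewrite lee_fin powR_ge0.
apply/eqP => I0.
have mg : measurable_fun setT (EFin \o (fun w => `|dotp u (X w)| `^ alpha)).
  apply/measurable_EFinP; apply: (measurableT_comp (f := @powR R ^~ alpha)) => //.
  by apply: measurableT_comp => //; exact: measurable_dotpX.
pose g w := `|dotp u (X w)| `^ alpha.
have : (\int[P0]_w `|(EFin \o g) w| = 0)%E.
  by under eq_integral do rewrite /= ger0_norm ?powR_ge0//.
move/(ae_eq_integral_abs P0 measurableT mg) => [N [mN PN NT]].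
pose Z := [set w | dotp u (X w) = 0].
have mZ : measurable Z.
  by rewrite -[X in measurable X]setTI; exact: (measurable_dotpX u measurableT (measurable_set1 0)).
have : (P0 setT <= P0 (N `|` Z))%E.
  apply: le_measure; rewrite ?inE//; first exact: measurableU.
  move=> w _; have [|nv] := pselect (Z w); first by right.
  left; apply: NT => /= /(_ Logic.I) [] /powR_eq0_eq0 /eqP; rewrite normr_eq0 => /eqP; exact: nv.
apply/negP; rewrite -ltNge probability_setT; apply: le_lt_trans (measureU2 _ mN mZ) _.
by rewrite [X in (X + _ < _)%E]PN [X in (_ + X < _)%E](Xv _ u0) adde0 lte01.
Qed.

Lemma measurable_norm_powR d' (T : measurableType d') (g : T -> R) :
  measurable_fun setT g -> measurable_fun setT (fun w => `|g w| `^ alpha).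
Proof.
by move=> mg; apply: (measurableT_comp (f := @powR R ^~ alpha)) => //; exact: measurableT_comp.
Qed.

Lemma response_moment_sqr_lty : (\int[P0]_w ((`|Y w| `^ alpha) ^+ 2)%:E < +oo)%E.
Proof.
apply: (@envelope_bound_sqr_lty 1 1) => //.
  exact: (measurable_norm_powR measurable_response).
by move=> w _; rewrite mul1r ger0_norm ?powR_ge0// le_envelope// lerDl.
Qed.

Lemma dotp_moment_sqr_lty u : (\int[P0]_w ((`|dotp u (X w)| `^ alpha) ^+ 2)%:E < +oo)%E.
Proof.
apply: (@envelope_bound_sqr_lty (enorm u * B + 1) 1).
- exact: radius_ge1 (enorm_ge0 u).
- exact: (measurable_norm_powR (measurable_dotpX u)).
move=> w wB; rewrite mul1r ger0_norm ?powR_ge0// le_envelope//.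
apply: le_trans (dotp_le_enorm _ _) _; have := ler_wpM2l (enorm_ge0 u) wB.
by have := normr_ge0 (Y w); lra.
Qed.

(** [C] scales both the radius and the error margin of the coercivity argument; its positivity
    follows from [model_null], as {Y = 0} has one-point sections. *)
Lemma response_moment_gt0 : (0 < \int[P0]_w (`|Y w| `^ alpha)%:E)%E.
Proof.
rewrite lt_def integral_ge0 ?andbT; last by move=> w _; rewrite lee_fin powR_ge0.
apply/eqP => I0.
have mg : measurable_fun setT (EFin \o (fun w => `|Y w| `^ alpha)).
  by apply/measurable_EFinP; exact: (measurable_norm_powR measurable_response).
pose g w := `|Y w| `^ alpha.
have : (\int[P0]_w `|(EFin \o g) w| = 0)%E.
  by under eq_integral do rewrite /= ger0_norm ?powR_ge0//.
move/(ae_eq_integral_abs P0 measurableT mg) => [N [mN PN NT]].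
pose S : set (rVb R p * R)%type := [set z | z.2 = 0].
have mS : measurable S.
  have ms : measurable_fun setT (fun z : (rVb R p * R)%type => z.2) by exact: measurable_snd.
  by rewrite -[S]setTI; exact: (ms measurableT _ (measurable_set1 0)).
have Y0 : P0 [set w | S (X w, Y w)] = 0%E.
  by apply: (model_null (s := fun=> 0)) => //; exact: nearW.
have mSw : measurable [set w | S (X w, Y w)].
  by rewrite -[X in measurable X]setTI; exact: (measurable_pairXY measurableT mS).
have : (P0 setT <= P0 (N `|` [set w | S (X w, Y w)]))%E.
  apply: le_measure; rewrite ?inE//; first exact: measurableU.
  move=> w _; have [|nv] := pselect (Y w = 0); first by right.
  left; apply: NT => /= /(_ Logic.I) [] /powR_eq0_eq0 /eqP; rewrite normr_eq0 => /eqP; exact: nv.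
apply/negP; rewrite -ltNge probability_setT.
apply: le_lt_trans (measureU2 _ mN mSw) _.
by rewrite [X in (X + _ < _)%E]PN [X in (_ + X < _)%E]Y0 adde0 lte01.
Qed.

(** * Lipschitz dependence on the parameter *)

Definition lipschitz_rate := kap * alpha * B.
Local Notation L := lipschitz_rate.

Lemma lipschitz_rate_ge0 : 0 <= L.
Proof.
exact (mulr_ge0 (mulr_ge0 (ltW k0) (ltW alpha0)) (ltW B_gt0)).
Qed.

Lemma enormBC (u v : 'rV[R]_p) : enorm (u - v) = enorm (v - u).
Proof. by rewrite -enormN opprB. Qed.

(** Residuals over the ball are bounded by |y| + r B + 1, whose power is the envelope; they differ
    by (b' - b).x, and Cauchy-Schwarz contributes the factor [B] of [lipschitz_rate]. *)
Lemma fdens_residual_lipschitz (r : R) (b b' x : 'rV[R]_p) (y : R) :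
  enorm b <= r -> enorm b' <= r -> enorm x <= B ->
  f (y - dotp b x) <= expR (L * Q (r * B + 1) y * enorm (b - b')) * f (y - dotp b' x).
Proof.
move=> br b'r xB; have r0 : 0 <= r by exact: le_trans (enorm_ge0 b) br.
have T1 : 1 <= `|y| + (r * B + 1).
  by apply: le_trans (radius_ge1 r0) _; rewrite lerDr.
apply: le_trans (@fdens_lipschitz R alpha d alpha1 if1 _ _ _ T1 (residual_le y br xB) (residual_le y b'r xB)) _.
apply: ler_wpM2r; first exact/ltW/f0.
rewrite ler_expR /lipschitz_rate -!mulrA; apply: ler_wpM2l; first exact (ltW k0).
apply: ler_wpM2l; first exact (ltW alpha0).
rewrite /envelope [leRHS]mulrCA; apply: ler_wpM2l; first exact: powR_ge0.
rewrite (_ : y - dotp b x - (y - dotp b' x) = dotp (b' - b) x); last by rewrite dotpBl; ring.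
apply: le_trans (dotp_le_enorm _ _) _; rewrite (enormBC b' b) mulrC.
exact (ler_wpM2r (enorm_ge0 (b - b')) xB).
Qed.

Lemma ln_fdens_lipschitz (r : R) (b b' x : 'rV[R]_p) (y : R) :
  enorm b <= r -> enorm b' <= r -> enorm x <= B ->
  `|ln (f (y - dotp b x)) - ln (f (y - dotp b' x))| <= L * Q (r * B + 1) y * enorm (b - b').
Proof.
move=> br b'r xB.
have := ln_le_of_exp (f0 _) (f0 _) (fdens_residual_lipschitz y br b'r xB).
have := ln_le_of_exp (f0 _) (f0 _) (fdens_residual_lipschitz y b'r br xB).
rewrite (enormBC b' b) => h1 h2; exact (norm_sub_le_of h2 h1).
Qed.

Definition emp_mixture n b (xs : nat -> 'rV[R]_p) (y : R) :=
  n%:R^-1 * \sum_(i < n) f (y - dotp b (xs i)).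

(** * Pathwise bounds for the empirical mixture *)

Section empirical_mixture.
Variables (n : nat) (xs : nat -> 'rV[R]_p).
Hypotheses (n_gt0 : (0 < n)%N) (xsB : forall i, enorm (xs i) <= B).

Lemma emp_mixture_le b y : emp_mixture n b xs y <= c.
Proof.
rewrite /emp_mixture; case: n n_gt0 => // k _.
by apply: mean_le_cst => i; exact: fc.
Qed.

Lemma emp_mixture_ge (r : R) b y : enorm b <= r ->
  c * expR (- (kap * Q (r * B + 1) y)) <= emp_mixture n b xs y.
Proof.
move=> br; rewrite /emp_mixture; case: n n_gt0 => // k _.
by apply: mean_ge_cst => i; exact: fdens_residual_ge.
Qed.

Lemma emp_mixture_gt0 b y : 0 < emp_mixture n b xs y.
Proof.
apply: lt_le_trans (emp_mixture_ge y (lexx (enorm b))).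
by apply: mulr_gt0; [exact: c0|exact: expR_gt0].
Qed.

Lemma norm_ln_emp_mixture_le (r : R) b y : enorm b <= r ->
  `|ln (emp_mixture n b xs y)| <= M * Q (r * B + 1) y.
Proof.
move=> br; apply: norm_ln_le; [|exact: emp_mixture_ge|exact: emp_mixture_le].
by apply: radius_ge1; exact: le_trans (enorm_ge0 b) br.
Qed.

Lemma ln_emp_mixture_lipschitz (r : R) b b' y : enorm b <= r -> enorm b' <= r ->
  `|ln (emp_mixture n b xs y) - ln (emp_mixture n b' xs y)| <= L * Q (r * B + 1) y * enorm (b - b').
Proof.
move=> br b'r.
have h u v : enorm u <= r -> enorm v <= r -> ln (emp_mixture n u xs y) <=
    L * Q (r * B + 1) y * enorm (u - v) + ln (emp_mixture n v xs y).
  move=> ur vr; rewrite /emp_mixture; case: n n_gt0 => // k _.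
  by apply: ln_mean_le => i; [exact: f0|exact: f0|exact: fdens_residual_lipschitz].
have := h _ _ br b'r; have := h _ _ b'r br.
rewrite (enormBC b' b) => h1 h2; exact (norm_sub_le_of h2 h1).
Qed.

(** Lipschitz in the response rather than in the parameter: this feeds the net over [-K, K] in
    [emp_mixture_uniform]. *)
Lemma emp_mixture_lipschitz (r K : R) b (y z : R) : enorm b <= r -> `|y| <= K -> `|z| <= K ->
  `|emp_mixture n b xs y - emp_mixture n b xs z| <=
  c * (kap * (alpha * (K + (r * B + 1)) `^ alpha)) * `|y - z|.
Proof.
move=> br yK zK; set H := _ * (_ * _).
have r0 : 0 <= r by exact: le_trans (enorm_ge0 b) br.
have T1 : 1 <= K + (r * B + 1).
  by apply: le_trans (radius_ge1 r0) _; rewrite lerDr (le_trans _ yK).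
rewrite /emp_mixture; case: n n_gt0 => // k _.
apply: le_trans (norm_mean_sub_le (e := fun=> H * `|y - z|) _) _; last by apply: mean_le_cst.
move=> i; have bd u : `|u| <= K -> `|u - dotp b (xs i)| <= K + (r * B + 1).
  by move=> uK; apply: le_trans (residual_le u br (xsB i)) _; rewrite lerD2r.
have := @norm_fdens_lipschitz R alpha d alpha1 if1 _ _ _ T1 (bd _ yK) (bd _ zK).
rewrite (_ : y - dotp b (xs i) - (z - dotp b (xs i)) = y - z); last by ring.
by rewrite /H -!mulrA.
Qed.

End empirical_mixture.

(** * The three samples: laws of large numbers for both parts of the likelihood *)

Section samples.
Context (d1 : measure_display) (Om : measurableType d1) (P : probability Om R).
Variables (Xt : nat -> Om -> 'rV[R]_p) (Yt : nat -> Om -> R).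
Variables (Xm : nat -> Om -> 'rV[R]_p) (Ym : nat -> Om -> R).
Hypothesis mXt : forall i, measurable_fun setT (Xt i : Om -> rVb R p).
Hypothesis mYt : forall j, measurable_fun setT (Yt j).
Hypothesis mXYm : forall k, measurable_fun setT (fun w => (Xm k w, Ym k w) : (rVb R p * R)%type).
Hypothesis lawXt : forall i (A : set (rVb R p)), measurable A -> P (Xt i @^-1` A) = P0 (X @^-1` A).
Hypothesis lawYt : forall j (A : set R), measurable A -> P (Yt j @^-1` A) = P0 (Y @^-1` A).
Hypothesis lawXYm : forall k (A : set (rVb R p * R)%type), measurable A ->
  P ((fun w => (Xm k w, Ym k w)) @^-1` A) = P0 ((fun w => (X w, Y w)) @^-1` A).
Hypothesis indXt : forall i j, i != j -> forall A C : set (rVb R p), measurable A -> measurable C ->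
  P (Xt i @^-1` A `&` Xt j @^-1` C) = (P (Xt i @^-1` A) * P (Xt j @^-1` C))%E.
Hypothesis indYt : forall i j, i != j -> forall A C : set R, measurable A -> measurable C ->
  P (Yt i @^-1` A `&` Yt j @^-1` C) = (P (Yt i @^-1` A) * P (Yt j @^-1` C))%E.
Hypothesis indXYm : forall i j, i != j -> forall A C : set (rVb R p * R)%type, measurable A -> measurable C ->
  P ((fun w => (Xm i w, Ym i w)) @^-1` A `&` (fun w => (Xm j w, Ym j w)) @^-1` C) =
  (P ((fun w => (Xm i w, Ym i w)) @^-1` A) * P ((fun w => (Xm j w, Ym j w)) @^-1` C))%E.

Lemma weak_law_Xt (phi : rVb R p -> R) : measurable_fun setT phi ->
  (\int[P0]_w (phi (X w) ^+ 2)%:E < +oo)%E ->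
  cvgp P (fun n w => n%:R^-1 * \sum_(i < n) phi (Xt i w)) (fine (\int[P0]_w (phi (X w))%:E)).
Proof. exact: (weak_law mX mXt lawXt indXt). Qed.

Lemma weak_law_Yt (phi : R -> R) : measurable_fun setT phi ->
  (\int[P0]_w (phi (Y w) ^+ 2)%:E < +oo)%E ->
  cvgp P (fun n w => n%:R^-1 * \sum_(i < n) phi (Yt i w)) (fine (\int[P0]_w (phi (Y w))%:E)).
Proof. exact: (weak_law measurable_response mYt lawYt indYt). Qed.

Lemma weak_law_XYm (phi : (rVb R p * R)%type -> R) : measurable_fun setT phi ->
  (\int[P0]_w (phi (X w, Y w) ^+ 2)%:E < +oo)%E ->
  cvgp P (fun n w => n%:R^-1 * \sum_(i < n) phi (Xm i w, Ym i w)) (fine (\int[P0]_w (phi (X w, Y w))%:E)).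
Proof. exact: (weak_law measurable_pairXY mXYm lawXYm indXYm). Qed.

Definition bounded_design : set Om := [set w | forall i, enorm (Xt i w) <= B /\ enorm (Xm i w) <= B].

Lemma small_unbounded_design : small P (fun=> ~` bounded_design).
Proof.
have PX (Z : Om -> rVb R p) : measurable_fun setT Z ->
    P (Z @^-1` [set x | enorm x <= B]) = P0 (X @^-1` [set x | enorm x <= B]) ->
    P.-negligible [set w | ~ enorm (Z w) <= B].
  move=> mZ PZ; have mE : measurable [set w | enorm (Z w) <= B].
    by rewrite -[X in measurable X]setTI; exact: (mZ measurableT _ (@measurable_enorm_le R p B)).
  exists (~` [set w | enorm (Z w) <= B]); split => //; first exact: measurableC.
  by rewrite probability_setC// [P _]PZ XB subee.
have [N [mN PN NT]] : P.-negligible (~` bounded_design).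
  pose N i := [set w | ~ enorm (Xt i w) <= B] `|` [set w | ~ enorm (Xm i w) <= B].
  have nN : P.-negligible (\bigcup_i N i).
    apply: negligible_bigcup => i; apply: negligibleU.
      by apply: PX => //; apply: lawXt; exact: measurable_enorm_le.
    have mf1 : measurable_fun setT (fst : (rVb R p * R)%type -> rVb R p) by exact: measurable_fst.
    apply: (PX (Xm i)); first exact: (measurableT_comp mf1 (mXYm i)).
    apply: (lawXYm i (A := fst @^-1` [set x | enorm x <= B])).
    by rewrite -[X in measurable X]setTI; exact: (mf1 measurableT _ (@measurable_enorm_le R p B)).
  apply: negligibleS nN => w /= /existsNP[i] /not_andP[nb|nb]; exists i => //; [by left|by right].
exact: small_subset (fun=> NT) (small_null mN PN).
Qed.

Lemma cvgp_matched b :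
  cvgp P (fun m w => m%:R^-1 * \sum_(k < m) ln (f (Ym k w - dotp b (Xm k w)))) (ell_matched b).
Proof.
apply: (weak_law_XYm (phi := fun z => ln (f (z.2 - dotp b z.1)))).
- exact: measurable_ln_fdens_residual.
- exact: ln_fdens_sqr_lty.
Qed.

Lemma cvgp_envelope_Yt A : 1 <= A ->
  cvgp P (fun n w => n%:R^-1 * \sum_(j < n) Q A (Yt j w)) (fine (\int[P0]_w (Q A (Y w))%:E)).
Proof. by move=> A1; apply: weak_law_Yt; [exact: measurable_envelope|exact: envelope_sqr_lty]. Qed.

Lemma cvgp_envelope_Ym A : 1 <= A ->
  cvgp P (fun m w => m%:R^-1 * \sum_(k < m) Q A (Ym k w)) (fine (\int[P0]_w (Q A (Y w))%:E)).
Proof.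
move=> A1; apply: (weak_law_XYm (phi := fun z => Q A z.2)); last exact: envelope_sqr_lty.
exact: (measurableT_comp (measurable_envelope A)).
Qed.

(** At fixed [y] the mixture is a sample mean over [Xt]. Uniformity in [y] decouples it from the
    random responses at which it is evaluated later. *)
Lemma emp_mixture_uniform b (K e : R) : 0 <= K -> 0 < e ->
  small P (fun n => [set w | exists2 y, `|y| <= K & e < `|emp_mixture n b (Xt^~ w) y - h b y|]).
Proof.
move=> K0 e0; pose S : set R := [set y | `|y| <= K].
pose H := c * (kap * (alpha * (K + (enorm b * B + 1)) `^ alpha)).
have H0 : 0 <= H.
  apply: mulr_ge0; first exact/ltW/c0.
  exact (mulr_ge0 (ltW k0) (mulr_ge0 (ltW alpha0) (powR_ge0 _ _))).
apply: (@uniform_cvgp _ _ _ P _ (fun y z : R => `|y - z|) S (fun n w y => emp_mixture n b (Xt^~ w) y) (h b) H H0).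
- move=> y _; have -> : h b y = fine (\int[P0]_w (f (y - dotp b (X w)))%:E) by rewrite mixtureE.
  have mg : measurable_fun setT (fun x : rVb R p => f (y - dotp b x)).
    by apply: (measurableT_comp mf); apply: measurable_funB => //; exact: measurable_dotp.
  apply: (weak_law_Xt (phi := fun x => f (y - dotp b x)) mg).
  apply: (@le_lt_trans _ _ (\int[P0]_w (c ^+ 2)%:E)%E).
    apply: ae_integral_le => [||w|w|w _].
    + by apply: measurable_funX; exact: (measurableT_comp mg mX).
    + exact: measurable_cst.
    + exact: sqr_ge0.
    + exact: sqr_ge0.
    by rewrite lerXn2r ?nnegrE ?fc// ltW// f0.
  by rewrite integral_cst// [X in (_ * X)%E]probability_setT mule1 ltry.
- apply: small_sub small_unbounded_design; exists 1%N => n n1 w /= nS wB; apply: nS => y z yK zK.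
  by apply: emp_mixture_lipschitz => // i; have [] := wB i.
- apply: compact_totally_bounded.
  + rewrite (_ : S = `[- K, K]%classic); first exact: segment_compact.
    by apply/seteqP; split => y; rewrite /S /= in_itv/= ler_norml.
  + by move=> y; rewrite subrr normr0.
  + move=> y z; apply: (@continuous_comp _ _ _ (fun t : R => t - y) (fun t : R => `|t|)); last exact: norm_continuous.
    exact: (@cvgB _ _ _ _ _ _ _ _ _ (@cvg_id _ _) (cvg_cst _)).
- exact: e0.
Qed.

Opaque ln_bound lipschitz_rate.

Lemma cvgp_unmatched b :
  cvgp P (fun n w => n%:R^-1 * \sum_(j < n) ln (emp_mixture n b (Xt^~ w) (Yt j w))) (ell_unmatched b).
Proof.
move=> e e0; pose A := enorm b * B + 1.
have A1 : 1 <= A by exact: radius_ge1 (enorm_ge0 b).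
have M0 := ln_bound_ge0.
pose V := fine (\int[P0]_w (Q A (Y w) ^+ 2)%:E).
have mQ : measurable_fun setT (fun w => Q A (Y w)).
  exact: (measurableT_comp (measurable_envelope A) measurable_response).
have V0 : 0 <= V by apply/fine_ge0/integral_ge0 => w _; rewrite lee_fin sqr_ge0.
have VE : (\int[P0]_w (Q A (Y w) ^+ 2)%:E = V%:E)%E.
  rewrite /V fineK// ge0_fin_numE; first exact: envelope_sqr_lty.
  by apply/integral_ge0 => w _; rewrite lee_fin sqr_ge0.
(* The mean of the tail is at most V / K; this level makes [2 * M * (V / K)] at most e / 4. *)
pose K := 8 * (M * V) / e + 1.
have MV0 : 0 <= M * V by exact: mulr_ge0.
have K0 : 0 < K by rewrite ltr_wpDl// divr_ge0 ?(ltW e0)// mulr_ge0.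
have KE : 2 * M * (V / K) <= e / 4.
  by rewrite mulrA -(mulrA 2); exact: cutoff_bound.
pose tail y : R := Q A y * \1_[set y : R | K < `|y|] y.
have mtail : measurable_fun setT tail.
  apply: measurable_funM; first exact: measurable_envelope.
  by apply: measurable_indic; exact: (@measurable_ltr_norm _ _ R id).
have tail0 y : 0 <= tail y by rewrite mulr_ge0 ?envelope_ge0// indicE.
have tailQ y : tail y <= Q A y.
  by rewrite /tail indicE; case: (_ \in _); rewrite ?mulr1 ?mulr0 ?envelope_ge0.
(* Where |y| > K, also Q > K because |y| <= Q, so Q <= Q^2 / K. *)
have tailK y : tail y <= K^-1 * Q A y ^+ 2.
  have h0 : 0 <= K^-1 * Q A y ^+ 2 by rewrite mulr_ge0 ?sqr_ge0// invr_ge0 ltW.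
  rewrite /tail indicE; case: (boolP (y \in _)) => [|_]; last by rewrite mulr0.
  rewrite mulr1 ler_pdivlMl// expr2 inE /= => yK.
  by rewrite ler_wpM2r ?envelope_ge0// (le_trans (ltW yK))// envelope_ge_norm.
have tail2 : (\int[P0]_w (tail (Y w) ^+ 2)%:E < +oo)%E.
  apply: (@envelope_bound_sqr_lty A 1) => // [|w _].
    exact: (measurableT_comp mtail measurable_response).
  by rewrite mul1r ger0_norm.
have tailE : fine (\int[P0]_w (tail (Y w))%:E) <= V / K.
  rewrite -lee_fin fineK; last first.
    apply: integrable_fin_num => //; apply: (sqr_lty_integrable _ tail2).
    exact: (measurableT_comp mtail measurable_response).
  rewrite mulrC EFinM -VE -ge0_integralZl//; last 3 first.
  - by apply/measurable_EFinP; exact: measurable_funX.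
  - by move=> w _; rewrite lee_fin sqr_ge0.
  - by rewrite lee_fin invr_ge0 ltW.
  apply: ge0_le_integral => //.
  - by move=> w _; rewrite lee_fin.
  - by apply/measurable_EFinP; exact: (measurableT_comp mtail measurable_response).
  - by apply/measurable_EFinP; apply: measurable_funM => //; exact: measurable_funX.
  - by move=> w _; rewrite -EFinM lee_fin.
(* A common lower bound of both mixtures for |y| <= K; the logarithm is 1/m-Lipschitz above it,
   hence the accuracy m e / 4 requested in [s1]. *)
pose m := c * expR (- (kap * (K + A) `^ alpha)).
have m0 : 0 < m by exact (mulr_gt0 c0 (expR_gt0 _)).
have mle y : `|y| <= K -> m <= c * expR (- (kap * Q A y)).
  move=> yK; apply: ler_wpM2l; first exact (ltW c0).
  rewrite ler_expR lerN2; apply: ler_wpM2l; first exact (ltW k0).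
  have yA : 0 <= `|y| + A by rewrite addr_ge0// (le_trans ler01).
  have yAK : `|y| + A <= K + A by rewrite lerD2r.
  by apply: ge0_ler_powR; rewrite ?nnegrE ?(ltW alpha0) ?(le_trans yA).
have s1 := @emp_mixture_uniform b K (m * (e / 4)) (ltW K0) (mulr_gt0 m0 (divr_gt0 e0 (ltr0n _ 4))).
have e'0 : 0 < e / 4 / (2 * M + 1) by rewrite !divr_gt0// ltr_wpDl// mulr_ge0.
have s2 := weak_law_Yt mtail tail2 e'0.
have s3 := weak_law_Yt (measurable_ln_mixture b) (ln_mixture_sqr_lty b) (divr_gt0 e0 (ltr0n _ 4)).
apply: small_sub (smallU small_unbounded_design (smallU s1 (smallU s2 s3))).
exists 1%N => n n1 w /=; apply: contraPP => /not_orP[/contrapT wB /not_orP[h1 /not_orP[/negP h2 /negP h3]]].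
rewrite -leNgt in h2; rewrite -leNgt ell_unmatchedE/= in h3; apply/negP; rewrite -leNgt.
have xB i : enorm (Xt i w) <= B by have [] := wB i.
set s := _ * _; set g := n%:R^-1 * _ in h3; set t := n%:R^-1 * _ in h2.
(* Up to the cutoff the two logarithms differ by at most e / 4; beyond it each is at most M Q, and Q
   equals [tail]. *)
have : `|s - g| <= n%:R^-1 * \sum_(j < n) (e / 4 + 2 * M * tail (Yt j w)).
  apply: norm_mean_sub_le => j; set y := Yt j w.
  have [yK|yK] := leP `|y| K.
    apply: (@le_trans _ _ (e / 4)); last by rewrite lerDl mulr_ge0// mulr_ge0.
    have em : m <= emp_mixture n b (Xt^~ w) y.
      exact: le_trans (mle _ yK) (@emp_mixture_ge n (Xt^~ w) n1 xB _ b y (lexx _)).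
    have hm : m <= h b y by exact: le_trans (mle _ yK) (mixture_ge y (lexx _)).
    apply: le_trans (norm_ln_sub_le m0 em hm) _; rewrite ler_pdivrMr// mulrC leNgt.
    by apply/negP => lt; apply: h1; exists y.
  have -> : tail y = Q A y by rewrite /tail indicE mem_set ?mulr1.
  have b1 := @norm_ln_emp_mixture_le n (Xt^~ w) n1 xB _ b y (lexx _).
  have b2 := norm_ln_mixture_le y (lexx (enorm b)).
  apply: le_trans (ler_normB _ _) _; rewrite -mulrA mulr2n mulrDl !mul1r.
  apply: le_trans (lerD b1 b2) _; rewrite -/A lerDr; exact: ltW (divr_gt0 e0 (ltr0n _ 4)).
rewrite mean_affine// -/t => sg.
have tb : t <= V / K + e / 4 / (2 * M + 1).
  by move: h2; rewrite ler_norml => /andP[_]; rewrite lerBlDr => h2; rewrite (le_trans h2)// addrC lerD2r.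
exact: (cutoff_arith M0 e0 KE tb sg h3).
Qed.

(** * The likelihood along the asymptotic regime: weights, uniform convergence, separation *)

Variables (N N' : nat -> nat) (lambda : R).
Hypothesis lambda0 : 0 < lambda.
Hypothesis N_oo : forall q : nat, exists k0, forall k, (k0 <= k)%N -> (q <= N k)%N.
Hypothesis N'_oo : forall q : nat, exists k0, forall k, (k0 <= k)%N -> (q <= N' k)%N.
Hypothesis ratio_cvg : ((N' k)%:R / (N k)%:R : R) @[k --> \oo] --> lambda.

Local Notation lnm k w b := (ell_nm alpha d (fun i => Xt i w) (fun j => Yt j w)
  (fun i => Xm i w) (fun i => Ym i w) (N k) (N' k) b).
Definition ell_lim b := (1 + lambda)^-1 * ell_unmatched b + lambda / (1 + lambda) * ell_matched b.
Definition weight k : R := (N k)%:R / (N k + N' k)%:R.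
Definition weight' k : R := (N' k)%:R / (N k + N' k)%:R.

Lemma weight_ge0 k : 0 <= weight k. Proof. by rewrite divr_ge0. Qed.
Lemma weight'_ge0 k : 0 <= weight' k. Proof. by rewrite divr_ge0. Qed.

Lemma weightD k : (0 < N k)%N -> weight k + weight' k = 1.
Proof.
move=> Nk; rewrite -mulrDl -natrD divff// pnatr_eq0 addn_eq0 negb_and -lt0n Nk//.
Qed.

Let lambda1 : 1 + lambda != 0. Proof. by rewrite gt_eqF// addr_gt0. Qed.

Lemma eventually_pos : exists k0, forall k, (k0 <= k)%N -> (0 < N k)%N /\ (0 < N' k)%N.
Proof.
have [k1 h1] := N_oo 1; have [k2 h2] := N'_oo 1.
by exists (maxn k1 k2) => k; rewrite geq_max => /andP[/h1 ? /h2 ?].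
Qed.

Let cvg_inv : (1 + (N' k)%:R / (N k)%:R)^-1 @[k --> \oo] --> (1 + lambda)^-1.
Proof. by apply: cvgV => //; apply: cvgD => //; exact: cvg_cst. Qed.

Let near_weight : \forall k \near \oo, weight k = (1 + (N' k)%:R / (N k)%:R)^-1.
Proof.
have [kk h] := eventually_pos; exists kk => // k /= /h[n1 _].
have n0 : (N k)%:R != 0 :> R by rewrite pnatr_eq0 -lt0n.
rewrite /weight natrD -[in LHS](mulfK n0 (N' k)%:R) -[X in X + _](mul1r (N k)%:R) [_ * _ / _]mulrAC -mulrDl.
by rewrite invfM mulrCA mulfV// mulr1.
Qed.

Lemma cvg_weight : weight k @[k --> \oo] --> (1 + lambda)^-1.
Proof.
apply: cvg_trans cvg_inv; apply: near_eq_cvg; apply: filterS near_weight => k ->//.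
Qed.

Lemma cvg_weight' : weight' k @[k --> \oo] --> lambda / (1 + lambda).
Proof.
have h : (1 - weight k) @[k --> \oo] --> lambda / (1 + lambda).
  have -> : lambda / (1 + lambda) = 1 - (1 + lambda)^-1 by field.
  by apply: cvgB; [exact: cvg_cst|exact: cvg_weight].
apply: cvg_trans h; apply: near_eq_cvg; have [kk hk] := eventually_pos.
by exists kk => // k /= /hk[n1 _]; rewrite -(weightD n1) addrAC subrr add0r.
Qed.

Lemma lnmE k w b : (0 < N k)%N -> (0 < N' k)%N -> lnm k w b =
  weight k * ((N k)%:R^-1 * \sum_(j < N k) ln (emp_mixture (N k) b (Xt^~ w) (Yt j w))) +
  weight' k * ((N' k)%:R^-1 * \sum_(i < N' k) ln (f (Ym i w - dotp b (Xm i w)))).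
Proof.
move=> n1 n1'; have n0 : (N k)%:R != 0 :> R by rewrite pnatr_eq0 -lt0n.
have n0' : (N' k)%:R != 0 :> R by rewrite pnatr_eq0 -lt0n.
have E x : weight k * ((N k)%:R^-1 * x) = (N k + N' k)%:R^-1 * x.
  by rewrite /weight mulrA (mulrAC (N k)%:R) mulfV// mul1r.
have E' x : weight' k * ((N' k)%:R^-1 * x) = (N k + N' k)%:R^-1 * x.
  by rewrite /weight' mulrA (mulrAC (N' k)%:R) mulfV// mul1r.
by rewrite E E'.
Qed.

Lemma cvgp_lnm b : cvgp P (fun k w => lnm k w b) (ell_lim b).
Proof.
have [kk hk] := eventually_pos.
apply: (@cvgp_eventually _ _ _ _ (fun k w =>
  weight k * ((N k)%:R^-1 * \sum_(j < N k) ln (emp_mixture (N k) b (Xt^~ w) (Yt j w))) +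
  weight' k * ((N' k)%:R^-1 * \sum_(i < N' k) ln (f (Ym i w - dotp b (Xm i w)))))).
  by exists kk => k /hk[n1 n1'] w; rewrite lnmE.
apply: cvgpD; apply: cvgpZ.
- exact: cvg_weight.
- exact: (cvgp_subseq N_oo (cvgp_unmatched b)).
- exact: cvg_weight'.
- exact: (cvgp_subseq N'_oo (cvgp_matched b)).
Qed.

Lemma lnm_lipschitz k w (r : R) b b' : bounded_design w -> (0 < N k)%N -> (0 < N' k)%N ->
  enorm b <= r -> enorm b' <= r -> `|lnm k w b - lnm k w b'| <=
  L * (weight k * ((N k)%:R^-1 * \sum_(j < N k) Q (r * B + 1) (Yt j w)) +
       weight' k * ((N' k)%:R^-1 * \sum_(i < N' k) Q (r * B + 1) (Ym i w))) * enorm (b - b').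
Proof.
move=> wB n1 n1' br b'r.
pose a u := (N k)%:R^-1 * \sum_(j < N k) ln (emp_mixture (N k) u (Xt^~ w) (Yt j w)).
pose a' u := (N' k)%:R^-1 * \sum_(i < N' k) ln (f (Ym i w - dotp u (Xm i w))).
pose q := (N k)%:R^-1 * \sum_(j < N k) Q (r * B + 1) (Yt j w).
pose q' := (N' k)%:R^-1 * \sum_(i < N' k) Q (r * B + 1) (Ym i w).
have E u : lnm k w u = weight k * a u + weight' k * a' u by exact: lnmE.
have h1 : `|a b - a b'| <= L * q * enorm (b - b').
  apply: le_trans (norm_mean_sub_le (e := fun j => 0 + L * enorm (b - b') * Q (r * B + 1) (Yt j w)) _) _.
    move=> j; rewrite add0r mulrAC.
    apply: (@ln_emp_mixture_lipschitz _ (Xt^~ w) n1 _ _ _ _ _ br b'r) => i.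
    by have [] := wB i.
  by rewrite (mean_affine _ _ _ n1) add0r mulrAC.
have h2 : `|a' b - a' b'| <= L * q' * enorm (b - b').
  apply: le_trans (norm_mean_sub_le (e := fun j => 0 + L * enorm (b - b') * Q (r * B + 1) (Ym j w)) _) _.
    move=> j; rewrite add0r mulrAC.
    by apply: (ln_fdens_lipschitz _ br b'r); have [] := wB j.
  by rewrite (mean_affine _ _ _ n1') add0r mulrAC.
rewrite (E b) (E b').
exact (norm_weighted_sub_le (weight_ge0 k) (weight'_ge0 k) h1 h2).
Qed.

Lemma lnm_equicontinuous (r : R) : 0 <= r -> exists2 H : R, 0 <= H &
  small P (fun k => ~` [set w | forall u v, enorm u <= r -> enorm v <= r ->
    `|lnm k w u - lnm k w v| <= H * enorm (u - v)]).
Proof.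
move=> r0; pose A := r * B + 1.
have A1 : 1 <= A by exact: radius_ge1.
pose q := fine (\int[P0]_w (Q A (Y w))%:E).
have q0 : 0 <= q by apply/fine_ge0/integral_ge0 => w _; rewrite lee_fin envelope_ge0.
have L0 := lipschitz_rate_ge0.
have s1 := cvgp_subseq N_oo (cvgp_envelope_Yt A1) ltr01.
have s2 := cvgp_subseq N'_oo (cvgp_envelope_Ym A1) ltr01.
(* Outside a small event both averages of the envelope are at most their mean [q] plus 1. *)
exists (L * (q + 1)); first by apply: mulr_ge0 => //; exact: addr_ge0.
apply: small_sub (smallU small_unbounded_design (smallU s1 s2)).
have [kk hk] := eventually_pos; exists kk => k /hk[n1 n1'] w.
apply: contraPP => /not_orP[/contrapT wB /not_orP[/negP h1 /negP h2]]; apply => u v ur vr.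
apply: le_trans (lnm_lipschitz wB n1 n1' ur vr) _.
apply: ler_wpM2r; first exact: enorm_ge0.
apply: ler_wpM2l => //; apply: convex_comb_le.
- exact: weight_ge0.
- exact: weight'_ge0.
- exact: weightD.
- by move: h1; rewrite -leNgt ler_distl => /andP[_].
- by move: h2; rewrite -leNgt ler_distl => /andP[_].
Qed.

Lemma lnm_uniform (r e : R) : 0 <= r -> 0 < e ->
  small P (fun k => [set w | exists2 b, enorm b <= r & e < `|lnm k w b - ell_lim b|]).
Proof.
move=> r0 e0; have [H H0 FH] := lnm_equicontinuous r0.
apply: (@uniform_cvgp _ _ _ P _ (fun u v => enorm (u - v)) [set v | enorm v <= r]
  (fun k w b => lnm k w b) ell_lim H H0 _ FH) => //.
- by move=> b _; exact: cvgp_lnm.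
- by apply: totally_bounded_enorm; apply: (@compact_enorm_ball _ _ r); first exact: closed_enorm_le.
Qed.

Lemma ell_lim_lipschitz (r : R) : 0 <= r -> exists H : R, forall u v,
  enorm u <= r -> enorm v <= r -> `|ell_lim u - ell_lim v| <= H * enorm (u - v).
Proof.
move=> r0; have [H H0 FH] := lnm_equicontinuous r0; exists H => u v ur vr.
apply: (@limit_lipschitz _ _ _ P _ (fun u v => enorm (u - v)) [set v | enorm v <= r]
  (fun k w b => lnm k w b) ell_lim H _ FH) => //.
by move=> b _; exact: cvgp_lnm.
Qed.

Hypothesis X_nondegenerate : forall v : 'rV[R]_p, v != 0 -> P0 [set w | dotp v (X w) = 0] = 0%E.

(** The limit attains its maximum on the compact set where |b| <= s and |b - beta0| >= r, so strict
    inequality at that one point is a uniform gap. *)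
Lemma ell_lim_separated (r s : R) : 0 <= s -> 0 < r -> exists2 g : R, 0 < g &
  forall b, enorm b <= s -> r <= enorm (b - beta0) -> ell_lim b <= ell_lim beta0 - g.
Proof.
move=> s0 r0; pose S := [set v | enorm v <= s] `&` [set v | r <= enorm (v - beta0)].
have [H hH] := ell_lim_lipschitz s0.
(* If no parameter qualifies, any positive gap will do. *)
have [Sn0|S0] := pselect (S !=set0); last first.
  by exists 1 => // b bs br; exfalso; apply: S0; exists b.
have cS : compact S.
  apply: (@compact_enorm_ball _ _ s); last exact: subIsetl.
  by apply: closedI; [exact: closed_enorm_le|exact: closed_enorm_ge].
have [u [us ur] uM] := lipschitz_argmax cS Sn0 (fun u v Su Sv => hH u v Su.1 Sv.1).
exists (ell_lim beta0 - ell_lim u); last by move=> b bs br; rewrite subKr; exact: uM.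
have ub : u != beta0 by apply: contraTneq ur => -> /=; rewrite subrr enorm0 -ltNge.
by have := ell_lt lambda0 X_nondegenerate ub; rewrite ellE ellE lte_fin subr_gt0.
Qed.

(** * Coercivity: empirical moments on the unit sphere and the comparison with zero *)

Definition dotp_moment u := fine (\int[P0]_w (`|dotp u (X w)| `^ alpha)%:E).
Definition emp_moment m w u := m%:R^-1 * \sum_(i < m) `|dotp u (Xm i w)| `^ alpha.
Definition sphere := [set u : 'rV[R]_p | enorm u = 1].

Lemma dotp_momentE u : (\int[P0]_w (`|dotp u (X w)| `^ alpha)%:E = (dotp_moment u)%:E)%E.
Proof.
rewrite /dotp_moment fineK//; apply: integrable_fin_num => //; apply: sqr_lty_integrable.
  exact: (measurable_norm_powR (measurable_dotpX u)).
exact: dotp_moment_sqr_lty.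
Qed.

Lemma cvgp_emp_moment u : cvgp P (fun m w => emp_moment m w u) (dotp_moment u).
Proof.
apply: (weak_law_XYm (phi := fun z => `|dotp u z.1| `^ alpha)).
- apply: measurable_norm_powR.
  exact: (measurableT_comp (measurable_dotp u) measurable_fst).
- exact: dotp_moment_sqr_lty.
Qed.

Lemma compact_sphere : compact sphere.
Proof.
have -> : sphere = [set v | enorm v <= 1] `&` [set v | 1 <= enorm (v - 0)].
  apply/seteqP; split => v; first by move=> /= v1; rewrite subr0 v1.
  by move=> /= [v1]; rewrite subr0 => v2; apply/eqP; rewrite eq_le v1.
apply: (@compact_enorm_ball _ _ 1); last exact: subIsetl.
by apply: closedI; [exact: closed_enorm_le|exact: closed_enorm_ge].
Qed.

Lemma sphere_nonempty : (0 < p)%N -> sphere !=set0.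
Proof.
move=> p0; pose v : 'rV[R]_p := const_mx 1.
have v0 : enorm v != 0.
  apply/eqP => /enorm0_eq0 /rowP /(_ (Ordinal p0)); rewrite !mxE => /eqP.
  by rewrite oner_eq0.
exists ((enorm v)^-1 *: v) => /=.
by rewrite /sphere /= enormZ ger0_norm ?invr_ge0 ?enorm_ge0// mulVf.
Qed.

Definition moment_rate := alpha * (B + 1) `^ alpha * B.

Lemma emp_moment_lipschitz m w u v : bounded_design w -> (0 < m)%N -> sphere u -> sphere v ->
  `|emp_moment m w u - emp_moment m w v| <= moment_rate * enorm (u - v).
Proof.
move=> wB m0 /= u1 v1.
apply: le_trans (norm_mean_sub_le (e := fun=> moment_rate * enorm (u - v) + 0 * 0) _) _; last first.
  by rewrite (mean_affine _ _ _ m0) mul0r addr0.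
move=> i; rewrite mul0r addr0; have [_ xB] := wB i.
have B1 : 1 <= B + 1 by rewrite lerDr; exact: ltW B_gt0.
have T (z : 'rV[R]_p) : enorm z = 1 -> `|dotp z (Xm i w)| <= B + 1.
  move=> z1; apply: le_trans (dotp_le_enorm _ _) _; rewrite z1 mul1r.
  by apply: le_trans xB _; rewrite lerDl.
apply: le_trans (norm_powR_lipschitz alpha1 B1 (T _ u1) (T _ v1)) _.
rewrite /moment_rate -(mulrA _ B); apply: ler_wpM2l.
  by apply: mulr_ge0; [exact: (ltW alpha0)|exact: powR_ge0].
rewrite -dotpBl mulrC; apply: le_trans (dotp_le_enorm _ _) _.
by apply: ler_wpM2l => //; exact: enorm_ge0.
Qed.

Let moment_rate_ge0 : 0 <= moment_rate.
Proof.
apply: mulr_ge0; last exact: (ltW B_gt0).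
by apply: mulr_ge0; [exact: (ltW alpha0)|exact: powR_ge0].
Qed.

Lemma small_emp_moment_lipschitz : small P (fun m => ~` [set w | forall u v, sphere u -> sphere v ->
  `|emp_moment m w u - emp_moment m w v| <= moment_rate * enorm (u - v)]).
Proof.
apply: small_sub small_unbounded_design; exists 1%N => m m0 w; apply: contra_not => wB u v su sv.
exact: emp_moment_lipschitz.
Qed.

(** Coercivity concerns all directions at once, so the empirical moments have to be bounded below
    uniformly over the sphere. *)
Lemma emp_moment_uniform (e : R) : 0 < e ->
  small P (fun m => [set w | exists2 u, sphere u & e < `|emp_moment m w u - dotp_moment u|]).
Proof.
move=> e0; apply: (@uniform_cvgp _ _ _ P _ (fun u v => enorm (u - v)) sphere
  emp_moment dotp_moment _ moment_rate_ge0 _ small_emp_moment_lipschitz) => //.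
- by move=> u _; exact: cvgp_emp_moment.
- exact: totally_bounded_enorm compact_sphere.
Qed.

(** Every direction has a positive moment, and by compactness the infimum is one of these
    moments. *)
Lemma dotp_moment_argmin : (0 < p)%N ->
  exists2 u, sphere u & 0 < dotp_moment u /\ forall v, sphere v -> dotp_moment u <= dotp_moment v.
Proof.
move=> p0.
have lip u v : sphere u -> sphere v ->
    `|(- dotp_moment u) - (- dotp_moment v)| <= moment_rate * enorm (u - v).
  move=> su sv; rewrite -opprD normrN.
  apply: (@limit_lipschitz _ _ _ P _ (fun u v => enorm (u - v)) sphere
    emp_moment dotp_moment _ _ small_emp_moment_lipschitz) => //.
  by move=> z _; exact: cvgp_emp_moment.
have [u su uM] := lipschitz_argmax compact_sphere (sphere_nonempty p0) lip.
exists u => //; split; last by move=> v sv; rewrite -lerN2; exact: uM.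
rewrite -lte_fin -dotp_momentE; apply: dotp_moment_gt0 => //.
by apply/eqP => u0; move: su; rewrite /sphere /= u0 enorm0 => /eqP; rewrite eq_sym oner_eq0.
Qed.

Lemma emp_moment_scale m w b : b != 0 -> enorm b `^ alpha * emp_moment m w ((enorm b)^-1 *: b) =
  m%:R^-1 * \sum_(i < m) `|dotp b (Xm i w)| `^ alpha.
Proof.
move=> b0; have eb : enorm b != 0 by apply: contra b0 => /eqP/enorm0_eq0/eqP.
rewrite /emp_moment mulrCA; congr (_ * _); rewrite mulr_sumr; apply: eq_bigr => i _.
rewrite -powRM ?enorm_ge0//; congr (_ `^ _).
rewrite dotpZl normrM ger0_norm ?invr_ge0 ?enorm_ge0// mulrA mulfV// mul1r.
by [].
Qed.

Lemma emp_moment_le m w b :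
  m%:R^-1 * (\sum_(i < m) `|dotp b (Xm i w)| `^ alpha) <=
  2 `^ alpha * (m%:R^-1 * (\sum_(i < m) `|Ym i w| `^ alpha) +
                m%:R^-1 * (\sum_(i < m) `|Ym i w - dotp b (Xm i w)| `^ alpha)).
Proof.
rewrite -mulrDr mulrCA; apply: ler_wpM2l; first by rewrite invr_ge0.
rewrite -big_split/= mulr_sumr; apply: ler_sum => i _.
have := norm_powRD (Ym i w) (- (Ym i w - dotp b (Xm i w))) (ltW alpha0).
by rewrite normrN subKr.
Qed.

Lemma emp_mixture0 n xs (y : R) : (0 < n)%N -> emp_mixture n 0 xs y = f y.
Proof.
move=> n0; rewrite /emp_mixture.
under eq_bigr do rewrite dot0p subr0.
rewrite sumr_const card_ord -[X in _ * X]mulr_natl mulrA mulVf ?mul1r//.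
by rewrite pnatr_eq0 -lt0n.
Qed.

Lemma mean_ln_fdens n (y : 'I_n -> R) : (0 < n)%N ->
  n%:R^-1 * (\sum_i ln (f (y i))) = ln c - kap * (n%:R^-1 * \sum_i `|y i| `^ alpha).
Proof.
move=> n0; rewrite -mulNr -(mean_affine _ _ _ n0); congr (_ * _).
by apply: eq_bigr => i _; rewrite (ln_fdens if1) mulNr.
Qed.

(** Zero is the point of comparison because the covariates drop out there, leaving explicit moments
    of the responses. *)
Lemma lnm_zero k w : (0 < N k)%N -> (0 < N' k)%N -> lnm k w 0 =
  weight k * (ln c - kap * ((N k)%:R^-1 * \sum_(j < N k) `|Yt j w| `^ alpha)) +
  weight' k * (ln c - kap * ((N' k)%:R^-1 * \sum_(j < N' k) `|Ym j w| `^ alpha)).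
Proof.
move=> n1 n1'; rewrite (lnmE _ _ n1 n1'); congr (_ * _ + _ * _).
  apply: etrans (mean_ln_fdens _ n1); congr (_ * _); apply: eq_bigr => j _.
  by rewrite emp_mixture0.
under eq_bigr do rewrite dot0p subr0.
exact (mean_ln_fdens _ n1').
Qed.

(** The unmatched part is bounded merely by ln c, as [f <= c]; growth in [b] comes from the matched
    residuals alone, which is why (1 + lambda) / lambda enters [R*]. *)
Lemma lnm_le k w b : bounded_design w -> (0 < N k)%N -> (0 < N' k)%N -> lnm k w b <=
  weight k * ln c +
  weight' k * (ln c - kap * ((N' k)%:R^-1 * \sum_(i < N' k) `|Ym i w - dotp b (Xm i w)| `^ alpha)).
Proof.
move=> wB n1 n1'; rewrite (lnmE _ _ n1 n1') -(mean_ln_fdens _ n1'); apply: lerD => //.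
apply: ler_wpM2l; first exact: weight_ge0.
have xB i : enorm (Xt i w) <= B by have [] := wB i.
rewrite mulrC ler_pdivrMr ?ltr0n//.
apply: (@le_trans _ _ (\sum_(j < N k) ln c)); last by rewrite sumr_const card_ord mulr_natr.
apply: ler_sum => j _; rewrite ler_ln ?posrE; first exact: emp_mixture_le.
- exact: (@emp_mixture_gt0 _ (Xt^~ w) n1 xB).
- exact c0.
Qed.

Lemma eventually_weight' : exists k0, forall k, (k0 <= k)%N ->
  11 / 12 <= weight' k * ((1 + lambda) / lambda).
Proof.
have h : weight' k * ((1 + lambda) / lambda) @[k --> \oo] --> (1 : R).
  have E : lambda / (1 + lambda) * ((1 + lambda) / lambda) = 1.
    by field; rewrite lambda1 gt_eqF.
  by rewrite -[X in _ --> X]E; apply: cvgM; [exact: cvg_weight'|exact: cvg_cst].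
have lt1 : 11 / 12 < 1 :> R by lra.
have [kk _ hk] := cvgr_ge _ h _ lt1.
by exists kk => k; exact: hk.
Qed.

Definition response_moment := fine (\int[P0]_w (`|Y w| `^ alpha)%:E).

Lemma response_momentE : (\int[P0]_w (`|Y w| `^ alpha)%:E = response_moment%:E)%E.
Proof.
rewrite /response_moment fineK//; apply: integrable_fin_num => //; apply: sqr_lty_integrable.
  exact: (measurable_norm_powR measurable_response).
exact: response_moment_sqr_lty.
Qed.

Lemma cvgp_moment_Yt : cvgp P (fun n w => n%:R^-1 * \sum_(j < n) `|Yt j w| `^ alpha) response_moment.
Proof.
apply: (weak_law_Yt (phi := fun y => `|y| `^ alpha)); last exact: response_moment_sqr_lty.
exact: measurable_norm_powR.
Qed.

Lemma cvgp_moment_Ym : cvgp P (fun n w => n%:R^-1 * \sum_(j < n) `|Ym j w| `^ alpha) response_moment.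
Proof.
apply: (weak_law_XYm (phi := fun z => `|z.2| `^ alpha)); last exact: response_moment_sqr_lty.
by apply: measurable_norm_powR; exact: measurable_snd.
Qed.

(** All [b] outside the ball are treated at once: by homogeneity the empirical moment at [b] is
    |b|^alpha times the one at b / |b|, which is controlled on the whole sphere. *)
Lemma lnm_coercive (bb s : R) : 0 < bb -> (forall u, sphere u -> bb <= dotp_moment u) -> 0 < s ->
  2 `^ alpha * (3 * ((1 + lambda) / lambda) * (response_moment / bb)) <= s `^ alpha ->
  small P (fun k => [set w | exists2 b, s <= enorm b & lnm k w 0 <= lnm k w b]).
Proof.
move=> bb0 hbb s0 hs; set C := response_moment in hs.
have C0 : 0 < C by have := response_moment_gt0; rewrite response_momentE lte_fin.
(* The tolerances under which [coercive_arith] keeps its margin. *)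
pose eta := Num.min (bb / 6) (C / 12).
have eta0 : 0 < eta by rewrite lt_min !divr_gt0.
have e1 : eta <= bb / 6 by rewrite ge_min lexx.
have e2 : eta <= C / 12 by rewrite ge_min lexx orbT.
have s1 := cvgp_subseq N_oo cvgp_moment_Yt eta0.
have s2 := cvgp_subseq N'_oo cvgp_moment_Ym eta0.
have s3 : small P (fun k => [set w | exists2 u, sphere u & eta < `|emp_moment (N' k) w u - dotp_moment u|]).
  exact (small_subseq N'_oo (emp_moment_uniform eta0)).
apply: small_sub (smallU small_unbounded_design (smallU s1 (smallU s2 s3))).
have [kk hk] := eventually_pos; have [k1 hk1] := eventually_weight'.
exists (maxn kk k1) => k; rewrite geq_max => /andP[/hk[n1 n1'] /hk1 hr] w.
apply: contraPP => /not_orP[/contrapT wB /not_orP[/negP h1 /not_orP[/negP h2 h3]]] [b sb].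
apply/negP; rewrite -ltNge; apply: le_lt_trans (lnm_le b wB n1 n1') _.
rewrite (lnm_zero _ n1 n1').
have nb0 : 0 < enorm b by exact: lt_le_trans sb.
have b0 : b != 0 by apply: contraTneq nb0 => ->; rewrite enorm0 ltxx.
have su : sphere ((enorm b)^-1 *: b).
  by rewrite /sphere /= enormZ ger0_norm ?invr_ge0 ?enorm_ge0// mulVf// gt_eqF.
have ht := emp_moment_le (N' k) w b; rewrite -(emp_moment_scale _ _ b0) in ht.
have pw0 : 0 < 2 `^ alpha by exact: powR_gt0.
have rho0 : 0 <= (1 + lambda) / lambda.
  by apply: divr_ge0; [exact: ltW (addr_gt0 ltr01 lambda0)|exact: ltW].
have hY : (N k)%:R^-1 * \sum_(j < N k) `|Yt j w| `^ alpha <= C + eta.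
  by move: h1; rewrite -leNgt ler_distl => /andP[_].
have hM : (N' k)%:R^-1 * \sum_(j < N' k) `|Ym j w| `^ alpha <= C + eta.
  by move: h2; rewrite -leNgt ler_distl => /andP[_].
have hS : bb - eta <= emp_moment (N' k) w ((enorm b)^-1 *: b).
  have [h3'|h3'] := ltP eta `|emp_moment (N' k) w ((enorm b)^-1 *: b) - dotp_moment ((enorm b)^-1 *: b)|.
    by exfalso; apply: h3; exists ((enorm b)^-1 *: b).
  move: h3'; rewrite ler_distl => /andP[h4 _]; apply: le_trans h4.
  by apply: lerB => //; exact: hbb.
have hT : 2 `^ alpha * (3 * ((1 + lambda) / lambda) * (C / bb)) <= enorm b `^ alpha.
  by apply: le_trans hs _; apply: ge0_ler_powR; rewrite ?nnegrE ?(ltW alpha0) ?(ltW s0) ?enorm_ge0//.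
have co := coercive_arith _ k0 (weight_ge0 k) (weight'_ge0 k) (weightD n1)
  C0 bb0 pw0 rho0 hY hM hS e1 e2 hT ht hr.
exact (co (ln c)).
Qed.

(** * Consistency, and the three conclusions in extended-real form *)

Variable hat : nat -> Om -> 'rV[R]_p.
Hypothesis hat_max : forall k w, (exists bm, forall b, lnm k w b <= lnm k w bm) ->
  forall b, lnm k w b <= lnm k w (hat k w).

Lemma hat_consistent (bb s e : R) : 0 < bb -> (forall u, sphere u -> bb <= dotp_moment u) -> 0 < s ->
  2 `^ alpha * (3 * ((1 + lambda) / lambda) * (response_moment / bb)) <= s `^ alpha ->
  enorm beta0 <= s -> 0 < e -> small P (fun k => [set w | e < enorm (hat k w - beta0)]).
Proof.
move=> bb0 hbb s0 hs bs e0.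
have [g g0 hg] := ell_lim_separated (ltW s0) e0.
have s1 := lnm_coercive bb0 hbb s0 hs.
have g3 : 0 < g / 3 by rewrite divr_gt0.
have s2 := lnm_uniform (ltW s0) g3.
apply: small_sub (smallU small_unbounded_design (smallU s1 s2)).
have [kk hk] := eventually_pos; exists kk => k /hk[n1 n1'] w.
apply: contraPP => /not_orP[/contrapT wB /not_orP[h1 h2]] /= eh.
have cB : compact [set v : 'rV[R]_p | enorm v <= s].
  by apply: (@compact_enorm_ball _ _ s) => //; exact: closed_enorm_le.
have nB : [set v : 'rV[R]_p | enorm v <= s] !=set0 by exists beta0.
have [u us uM] := lipschitz_argmax cB nB (fun a b ha hb => lnm_lipschitz wB n1 n1' ha hb).
have out b : s <= enorm b -> lnm k w b < lnm k w 0.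
  by move=> sb; rewrite ltNge; apply/negP => h; apply: h1; exists b.
(* [hat_max] says something only where a maximizer exists: the maximum over the ball is at least the
   value at zero, which beats every value outside. *)
have max : exists bm, forall b, lnm k w b <= lnm k w bm.
  exists u => b; have [bs'|bs'] := leP (enorm b) s; first exact: uM.
  apply: le_trans (ltW (out b (ltW bs'))) _; apply: uM.
  by rewrite /= enorm0 ltW.
have hm := hat_max max.
have hs' : enorm (hat k w) <= s.
  rewrite leNgt; apply/negP => /ltW /out; apply/negP; rewrite -leNgt; exact: hm.
have close b : enorm b <= s -> `|lnm k w b - ell_lim b| <= g / 3.
  by move=> b_s; rewrite leNgt; apply/negP => h; apply: h2; exists b.
have := argmax_close_arith g0 (hm beta0) (close _ bs) (close _ hs').
by apply/negP; rewrite -leNgt; exact: hg (ltW eh).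
Qed.

Local Notation ell_ b := (ell alpha d lambda fX beta0 b).

Lemma prob_to0_sup_lnm (r e : R) : 0 <= r -> 0 < e -> prob_to0 P (fun k =>
  [set w | (e%:E < ereal_sup [set `|(lnm k w b)%:E - ell_ b|%E |
                              b in [set b | (enorm b <= r)%R]])%E]).
Proof.
move=> r0 e0; apply: small_prob_to0; apply: small_subset (lnm_uniform r0 e0) => k w /=.
move=> /ereal_sup_gt[_ [b br <-]] h; exists b => //.
by move: h; rewrite ellE -EFinB abse_EFin lte_fin.
Qed.

Lemma sup_ell_lt (r s : R) : 0 <= s -> 0 < r ->
  (ereal_sup [set ell_ b | b in [set b | (enorm b < s)%R /\ (r < enorm (b - beta0))%R]] <
   ell_ beta0)%E.
Proof.
move=> s0 r0; have [g g0 hg] := ell_lim_separated s0 r0.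
apply: (@le_lt_trans _ _ (ell_lim beta0 - g)%:E); last by rewrite ellE lte_fin ltrBlDr ltrDl.
apply: ge_ereal_sup => _ [b [/ltW bs /ltW br] <-].
by rewrite ellE lee_fin; exact: hg.
Qed.

Hypothesis p_gt0 : (0 < p)%N.
Local Notation bb := (ereal_inf [set (\int[P0]_w (`|dotp u (X w)| `^ alpha)%:E)%E
                                 | u in [set u : 'rV[R]_p | enorm u = 1]]).
Local Notation CC := (\int[P0]_w (`|Y w| `^ alpha)%:E)%E.
Local Notation radius := (Num.max (2 * 3 `^ (1 / alpha)
  * ((1 + lambda) / lambda * (fine CC / fine bb)) `^ (1 / alpha)) (enorm beta0)).

(** Since the infimum is attained it is a finite positive moment, so [fine] loses nothing in the
    formula of [R*]. *)
Lemma dotp_moment_inf : 0 < fine bb /\ forall u, sphere u -> fine bb <= dotp_moment u.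
Proof.
have [u su [u0 uM]] := dotp_moment_argmin p_gt0.
suff -> : bb = (dotp_moment u)%:E by [].
apply/eqP; rewrite eq_le; apply/andP; split.
  by apply: ereal_inf_lbound; exists u => //; exact: dotp_momentE.
apply: le_ereal_inf_tmp => _ [v sv <-]; rewrite dotp_momentE lee_fin.
exact: uM.
Qed.

Lemma prob_to0_hat (e : R) : 0 < e -> prob_to0 P (fun k => [set w | e < enorm (hat k w - beta0)]).
Proof.
move=> e0; have [b0 hb] := dotp_moment_inf.
have C0 : 0 < fine CC by rewrite -lte_fin -[X in (_ < X)%E]response_momentE; exact: response_moment_gt0.
have z0 : 0 < (1 + lambda) / lambda * (fine CC / fine bb).
  by apply: mulr_gt0; apply: divr_gt0 => //; exact: addr_gt0.
have R0 : 0 < radius.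
  rewrite lt_max; apply/orP; left.
  by apply: mulr_gt0; [apply: mulr_gt0 => //; exact: powR_gt0|exact: powR_gt0].
apply: small_prob_to0; apply: (hat_consistent b0 hb R0) => //; last by rewrite le_max lexx orbT.
(* Raising the first entry of the maximum to the power [alpha] gives 2^alpha * 3 * (1 + lambda) /
   lambda * C / b, the threshold of [hat_consistent]. *)
rewrite -mulrA; apply: powR_radius; [exact alpha0|exact: ler0n|exact: ler0n|exact: ltW z0|].
by rewrite le_max lexx.
Qed.

End samples.
End model.

(** * Pairwise independence from mutual independence, and assembly of the theorem *)

Lemma mutual_indep_pair (R : realType) d (Om : measurableType d) (P : probability Om R)
    (I : eqType) (E : I -> set (set Om)) (i j : I) (A D : set Om) :
  mutual_indep P E -> i != j -> E i A -> E j D -> P (A `&` D) = (P A * P D)%E.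
Proof.
move=> mut ij EA ED.
(* The events must come as one family over [I]; a case distinction on the index places [A] at [i]
   and [D] at [j]. *)
have := mut [:: i; j] (fun k => if k == i then A else D).
rewrite /= inE ij => /(_ isT); rewrite !big_cons big_nil mule1 eqxx eq_sym (negbTE ij) => <-.
  congr (P _); apply/seteqP; split => w.
    by move=> [Aw Dw] k /=; case: ifP.
  move=> h; split.
    by have := h i; rewrite /= eqxx; apply; rewrite inE eqxx.
  by have := h j; rewrite /= eq_sym (negbTE ij); apply; rewrite !inE eqxx orbT.
by move=> k; rewrite !inE => /orP[]/eqP->; rewrite ?eqxx// eq_sym (negbTE ij).
Qed.

Theorem theorem1 (R : realType) (p : nat) (beta0 : 'rV[R]_p)
  (alpha d lambda B : R)
  (* the model: X with density fX and epsilon with density f, on (Om0, P0) *)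
  (d0 : measure_display) (Om0 : measurableType d0) (P0 : probability Om0 R)
  (X : Om0 -> 'rV[R]_p) (eps : Om0 -> R) (fX : 'rV[R]_p -> R)
  (* the three samples, on (Om, P) *)
  (d1 : measure_display) (Om : measurableType d1) (P : probability Om R)
  (Xt : nat -> Om -> 'rV[R]_p) (Yt : nat -> Om -> R)
  (Xm : nat -> Om -> 'rV[R]_p) (Ym : nat -> Om -> R)
  (* the asymptotic regime n = N k, m = M k *)
  (N M : nat -> nat)
  (* any maximizer of l_{n,m} *)
  (hat : nat -> Om -> 'rV[R]_p) :
  (1 <= p)%N ->
  1 <= alpha -> 0 < d -> 0 < B -> 0 < lambda < 1 ->
  (* X: random vector with Lebesgue density fX *)
  rmeas (@borel_rV R p) X ->
  (forall x, 0 <= fX x) ->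
  (forall A : set R, measurable A -> @borel_rV R p (fX @^-1` A)) ->
  (forall A, @borel_rV R p A ->
     P0 (X @^-1` A) = lebint (fun x => ((\1_A x : R) * fX x)%:E)) ->
  P0 [set w | enorm (X w) <= B] = 1%E ->
  (forall v : 'rV[R]_p, v != 0 -> P0 [set w | dotp v (X w) = 0] = 0%E) ->
  (* epsilon: density f, independent of X *)
  measurable_fun setT eps ->
  (forall A : set R, measurable A ->
     P0 (eps @^-1` A) = (\int[@lebesgue_measure R]_(t in A) (fdens alpha d t)%:E)%E) ->
  (forall A (C : set R), @borel_rV R p A -> measurable C ->
     P0 (X @^-1` A `&` eps @^-1` C) = (P0 (X @^-1` A) * P0 (eps @^-1` C))%E) ->
  let Y := fun w => dotp beta0 (X w) + eps w in
  (* the samples are measurable, with the laws of X, Y and (X, Y) *)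
  (forall i, rmeas (@borel_rV R p) (Xt i)) ->
  (forall j, measurable_fun setT (Yt j)) ->
  (forall k, rmeas (@borel_pair R p) (fun w => (Xm k w, Ym k w))) ->
  (forall i A, @borel_rV R p A -> P (Xt i @^-1` A) = P0 (X @^-1` A)) ->
  (forall j (A : set R), measurable A -> P (Yt j @^-1` A) = P0 (Y @^-1` A)) ->
  (forall k A, @borel_pair R p A ->
     P ((fun w => (Xm k w, Ym k w)) @^-1` A) = P0 ((fun w => (X w, Y w)) @^-1` A)) ->
  (* the samples are all mutually independent *)
  mutual_indep P (fun i : (nat + nat) + nat =>
     match i with
     | inl (inl i) => preim_class (@borel_rV R p) (Xt i)
     | inl (inr j) => preim_class measurable (Yt j)
     | inr k => preim_class (@borel_pair R p) (fun w => (Xm k w, Ym k w))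
     end) ->
  (* n, m -> oo with m / n -> lambda *)
  (forall c : nat, exists k0, forall k, (k0 <= k)%N -> (c <= N k)%N) ->
  (forall c : nat, exists k0, forall k, (k0 <= k)%N -> (c <= M k)%N) ->
  ((M k)%:R / (N k)%:R : R) @[k --> \oo] --> lambda ->
  let lnm := fun k w beta =>
    ell_nm alpha d (fun i => Xt i w) (fun j => Yt j w) (fun k => Xm k w)
      (fun k => Ym k w) (N k) (M k) beta in
  let l := fun beta => ell alpha d lambda fX beta0 beta in
  let b := ereal_inf [set (\int[P0]_w (`|dotp u (X w)| `^ alpha)%:E)%E
                      | u in [set u : 'rV[R]_p | enorm u = 1]] in
  let C := (\int[P0]_w (`|Y w| `^ alpha)%:E)%E in
  let Rstar := Num.max (2 * 3 `^ (1 / alpha)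
                 * ((1 + lambda) / lambda * (fine C / fine b)) `^ (1 / alpha))
                 (enorm beta0) in
  (forall k w, (exists bm, forall beta, lnm k w beta <= lnm k w bm) ->
     forall beta, lnm k w beta <= lnm k w (hat k w)) ->
  [/\ (* uniform convergence in probability on the ball of radius R* *)
      (forall e : R, 0 < e -> prob_to0 P (fun k =>
         [set w | (e%:E < ereal_sup [set `|(lnm k w beta)%:E - l beta|%E
                                    | beta in [set beta | (enorm beta <= Rstar)%R]])%E])),
      (* identifiability / well-separated maximum *)
      (forall r : R, 0 < r ->
         (ereal_sup [set l beta | beta in
            [set beta | (enorm beta < Rstar)%R /\ (r < enorm (beta - beta0))%R]] < l beta0)%E) &
      (* consistency of any maximizer *)
      (forall e : R, 0 < e ->
         prob_to0 P (fun k => [set w | e < enorm (hat k w - beta0)]))].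
Proof.
move=> p1 alpha1 d_gt0 B_gt0 /andP[lambda0 _] mX fX0 mfX lawX XB Xv meps law_eps indep Y
  mXt mYt mXYm lawXt lawYt lawXYm mut N_oo M_oo ratio lnm l b C Rstar hat_max.
have mX' := rmeas_borel_rV mX.
have mfX' : measurable_fun setT (fX : rVb R p -> R) by move=> _ A mA; rewrite setTI; exact: mfX.
have mXt' i := rmeas_borel_rV (mXt i).
have mXYm' k := rmeas_borel_pair (mXYm k).
have lawXYm' k (A : set (rVb R p * R)%type) : measurable A ->
    P ((fun w => (Xm k w, Ym k w)) @^-1` A) = P0 ((fun w => (X w, Y w)) @^-1` A).
  by move=> mA; apply: lawXYm; exact/borel_pairE.
have indXt i j : i != j -> forall A D : set (rVb R p), measurable A -> measurable D ->
    P (Xt i @^-1` A `&` Xt j @^-1` D) = (P (Xt i @^-1` A) * P (Xt j @^-1` D))%E.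
  move=> ij A D mA mD; apply: (mutual_indep_pair (i := inl (inl i)) (j := inl (inl j)) mut) => //.
  - by exists A.
  - by exists D.
have indYt i j : i != j -> forall A D : set R, measurable A -> measurable D ->
    P (Yt i @^-1` A `&` Yt j @^-1` D) = (P (Yt i @^-1` A) * P (Yt j @^-1` D))%E.
  move=> ij A D mA mD; apply: (mutual_indep_pair (i := inl (inr i)) (j := inl (inr j)) mut) => //.
  - by exists A.
  - by exists D.
have indXYm i j : i != j -> forall A D : set (rVb R p * R)%type, measurable A -> measurable D ->
    P ((fun w => (Xm i w, Ym i w)) @^-1` A `&` (fun w => (Xm j w, Ym j w)) @^-1` D) =
    (P ((fun w => (Xm i w, Ym i w)) @^-1` A) * P ((fun w => (Xm j w, Ym j w)) @^-1` D))%E.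
  move=> ij A D mA mD; apply: (mutual_indep_pair (i := inr i) (j := inr j) mut) => //.
  - by exists A => //; exact/borel_pairE.
  - by exists D => //; exact/borel_pairE.
have R0 : 0 <= Rstar by rewrite le_max enorm_ge0 orbT.
split.
- move=> e e0.
  exact (prob_to0_sup_lnm alpha1 d_gt0 B_gt0 mX' fX0 mfX' lawX XB meps law_eps indep mXt' mYt
    mXYm' lawXt lawYt lawXYm' indXt indYt indXYm lambda0 N_oo M_oo ratio R0 e0).
- move=> r r0.
  exact (sup_ell_lt alpha1 d_gt0 B_gt0 mX' fX0 mfX' lawX XB meps law_eps indep mXt' mYt
    mXYm' lawXt lawYt lawXYm' indXt indYt indXYm lambda0 N_oo M_oo ratio Xv R0 r0).
- move=> e e0.
  exact (prob_to0_hat alpha1 d_gt0 B_gt0 mX' fX0 mfX' lawX XB meps law_eps indep mXt' mYt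
    mXYm' lawXt lawYt lawXYm' indXt indYt indXYm lambda0 N_oo M_oo ratio Xv hat_max p1 e0).
Qed.
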